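(* The $\mathbb{N}$-coloured operad $\check B$ of natural operations indexed by pairs $(V,M)$ (an additive strict symmetric monoidal category with a distinguished unital monoid) and the $\mathbb{N}$-coloured operad $B$ of $(l;k_1,\ldots,k_n)$-trees are canonically isomorphic (as $\mathbb{N}$-coloured operads in abelian groups).
   Context: All operads are symmetric. $\mathbb{N}=\{0,1,2,\ldots\}$. Modules and tensor products are over $\mathbb{Z}$. **The operad $B$.** For $l,k_1,\ldots,k_n\ge 0$, an $(l;k_1,\ldots,k_n)$-tree is a planar rooted tree with $l$ legs (external input edges) labelled bijectively by $1,\ldots,l$ and with three types of vertices: (a) $n$ white vertices labelled bijectively by $1,\ldots,n$, the $i$-th one having arity (number of input edges) $k_i$; (b) black vertices of arities $\ge 2$; (c) special vertices of arity $0$. No edge connects two black vertices or a black vertex with a special vertex. For $n=0$ one also allows two exceptional trees: the $(1;)$-tree consisting of a single edge, and the $(0;)$-tree consisting of a special vertex attached to the root edge. $B^l_{k_1,\ldots,k_n}$ is the free abelian group on all $(l;k_1,\ldots,k_n)$-trees. Black vertices represent iterated products, special vertices represent the unit. These groups form an $\mathbb{N}$-coloured operad $B$ (output colour $l$, input colours $k_1,\ldots,k_n$): the composition $T'\circ_i T''$ of an $(l';k'_1,\ldots,k'_n)$-tree $T'$ with an $(l'';k''_1,\ldots,k''_m)$-tree $T''$, $l''=k'_i$, replaces the white vertex of $T'$ labelled $i$ by $T''$ (the leg of $T''$ labelled $j$ being joined to the $j$-th input of that vertex), followed by the reduction expressing associativity and unitality (edges between black vertices are contracted; a special vertex attached to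 a black vertex is removed, and a black vertex left with one input is replaced by an edge). Symmetric groups relabel white vertices. **The operad $\check B$.** Let $\mathrm{SymCat}_\bullet$ be the category whose objects are pairs $(V,M)$ of an additive (i.e. enriched in abelian groups, with biadditive tensor product) strict symmetric monoidal category $V$ and a unital monoid $M$ in $V$; morphisms are additive strict symmetric monoidal functors preserving the distinguished monoids. Write $\underline V(-,-)$ for the abelian groups of morphisms. $\check B^l_{k_1,\ldots,k_n}$ is the abelian group of families of linear maps $$\alpha_{(V,M)}:\underline V(M^{\otimes k_1},M)\otimes\cdots\otimes\underline V(M^{\otimes k_n},M)\to\underline V(M^{\otimes l},M)$$ indexed by objects $(V,M)\in\mathrm{SymCat}_\bullet$ that are natural: for every morphism $F:(V,M)\to(W,N)$, $F\circ\alpha_{(V,M)}=\alpha_{(W,N)}\circ(F\otimes\cdots\otimes F)$. With composition of families and permutation of the inputs, $\check B$ is an $\mathbb{N}$-coloured operad in abelian groups. *)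

(* Defs.v *)
From HB Require Import structures.
From mathcomp Require Import all_boot all_algebra.
From mathcomp Require Import boolp freeg.

Set Implicit Arguments.
Unset Strict Implicit.
Unset Printing Implicit Defensive.

Import GRing.Theory.
Local Open Scope ring_scope.

(* Conventions for N-coloured symmetric operads in abelian groups.  A profile of
   input colours k_1, ..., k_n is a list ks : seq nat; inputs are numbered from 0.
   The symmetric groups act through the groupoid of profiles: a relabelling from ks
   to ks' is a bijection s between the positions of ks and those of ks' that
   preserves colours; it moves input i to input s i.  Only the values of s below
   size ks matter. *)
Record relabelling (ks ks' : seq nat) := Relabelling {
  relab_fun :> nat -> nat;
  relab_bij : perm_eq [seq relab_fun i | i <- iota 0 (size ks)]
                      (iota 0 (size ks'));
  relab_col : forall i, (i < size ks)%N -> nth 0%N ks' (relab_fun i) = nth 0%N ks i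
}.

(* Position, among the inputs of a partial composite at input i with an operation
   having m inputs, of the input p != i of the outer operation. *)
Definition shift (i m p : nat) : nat := if (p < i)%N then p else (p + m).-1.

(* opd_comp is the partial composition at input i = size ks1. *)
Record operad_data := OperadData {
  opd_car :> nat -> seq nat -> zmodType;
  opd_id : forall c, opd_car c [:: c];
  opd_comp : forall l ks1 c ks2 js,
    opd_car l (ks1 ++ c :: ks2) -> opd_car c js -> opd_car l (ks1 ++ js ++ ks2);
  opd_act : forall l ks ks', relabelling ks ks' -> opd_car l ks -> opd_car l ks'
}.

Arguments opd_id {o} c.
Arguments opd_comp {o l} ks1 {c} ks2 {js} x y.
Arguments opd_act {o l ks ks'} s x.

Definition pcast (P : operad_data) l ks ks' (e : ks = ks') (x : P l ks) : P l ks' :=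
  ecast k (P l k) e x.

(* All the equations e between profiles quantified over below hold, by the
   associativity of ++ ; they have a unique proof since nat is an eqType. *)
Record is_operad (P : operad_data) : Prop := IsOperad {
  opd_compDl : forall l ks1 c ks2 js (x x' : P l (ks1 ++ c :: ks2)) (y : P c js),
    opd_comp ks1 ks2 (x + x') y = opd_comp ks1 ks2 x y + opd_comp ks1 ks2 x' y;
  opd_compDr : forall l ks1 c ks2 js (x : P l (ks1 ++ c :: ks2)) (y y' : P c js),
    opd_comp ks1 ks2 x (y + y') = opd_comp ks1 ks2 x y + opd_comp ks1 ks2 x y';
  opd_actD : forall l ks ks' (s : relabelling ks ks') (x x' : P l ks),
    opd_act s (x + x') = opd_act s x + opd_act s x';
  opd_act1 : forall l ks (s : relabelling ks ks) (x : P l ks),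
    (forall i, (i < size ks)%N -> s i = i) -> opd_act s x = x;
  opd_actM : forall l ks ks' ks'' (s : relabelling ks ks') (t : relabelling ks' ks'')
      (u : relabelling ks ks'') (x : P l ks),
    (forall i, (i < size ks)%N -> u i = t (s i)) ->
    opd_act u x = opd_act t (opd_act s x);
  opd_comp1l : forall c js (y : P c js) (e : js ++ [::] = js),
    pcast e (opd_comp [::] [::] (opd_id c) y) = y;
  opd_comp1r : forall l ks1 c ks2 (x : P l (ks1 ++ c :: ks2)),
    opd_comp ks1 ks2 x (opd_id c) = x;
  opd_compA : forall l ks1 c ks2 js1 d js2 hs
      (x : P l (ks1 ++ c :: ks2)) (y : P c (js1 ++ d :: js2)) (z : P d hs)
      (e : ks1 ++ (js1 ++ d :: js2) ++ ks2 = (ks1 ++ js1) ++ d :: (js2 ++ ks2))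
      (e' : ks1 ++ (js1 ++ hs ++ js2) ++ ks2 = (ks1 ++ js1) ++ hs ++ (js2 ++ ks2)),
    pcast e' (opd_comp ks1 ks2 x (opd_comp js1 js2 y z)) =
    opd_comp (ks1 ++ js1) (js2 ++ ks2) (pcast e (opd_comp ks1 ks2 x y)) z;
  opd_compC : forall l ks1 c ks2 d ks3 js hs
      (x : P l (ks1 ++ c :: (ks2 ++ d :: ks3))) (y : P c js) (z : P d hs)
      (e1 : ks1 ++ js ++ (ks2 ++ d :: ks3) = (ks1 ++ js ++ ks2) ++ d :: ks3)
      (e2 : ks1 ++ c :: (ks2 ++ d :: ks3) = (ks1 ++ c :: ks2) ++ d :: ks3)
      (e3 : (ks1 ++ c :: ks2) ++ hs ++ ks3 = ks1 ++ c :: (ks2 ++ hs ++ ks3))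
      (e4 : ks1 ++ js ++ (ks2 ++ hs ++ ks3) = (ks1 ++ js ++ ks2) ++ hs ++ ks3),
    opd_comp (ks1 ++ js ++ ks2) ks3
      (pcast e1 (opd_comp ks1 (ks2 ++ d :: ks3) x y)) z =
    pcast e4 (opd_comp ks1 (ks2 ++ hs ++ ks3)
      (pcast e3 (opd_comp (ks1 ++ c :: ks2) ks3 (pcast e2 x) z)) y);
  opd_comp_act : forall l ks1 ks2 ks1' ks2' c js js'
      (s : relabelling (ks1 ++ c :: ks2) (ks1' ++ c :: ks2')) (t : relabelling js js')
      (u : relabelling (ks1 ++ js ++ ks2) (ks1' ++ js' ++ ks2'))
      (x : P l (ks1 ++ c :: ks2)) (y : P c js),
    s (size ks1) = size ks1' ->
    (forall p, (p < size (ks1 ++ c :: ks2))%N -> p != size ks1 ->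
       u (shift (size ks1) (size js) p) = shift (size ks1') (size js') (s p)) ->
    (forall q, (q < size js)%N -> u (size ks1 + q)%N = (size ks1' + t q)%N) ->
    opd_comp ks1' ks2' (opd_act s x) (opd_act t y) = opd_act u (opd_comp ks1 ks2 x y)
}.

Record is_operad_iso (P Q : operad_data)
    (Phi : forall l ks, {additive P l ks -> Q l ks}) : Prop := IsOperadIso {
  iso_id : forall c, Phi c [:: c] (opd_id c) = opd_id c;
  iso_comp : forall l ks1 c ks2 js (x : P l (ks1 ++ c :: ks2)) (y : P c js),
    Phi l (ks1 ++ js ++ ks2) (opd_comp ks1 ks2 x y) =
    opd_comp ks1 ks2 (Phi l (ks1 ++ c :: ks2) x) (Phi c js y);
  iso_act : forall l ks ks' (s : relabelling ks ks') (x : P l ks),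
    Phi l ks' (opd_act s x) = opd_act s (Phi l ks x);
  iso_bij : forall l ks, bijective (Phi l ks)
}.

(* Planar rooted trees up to isomorphism; Leg j is an edge coming from the leg
   labelled j, and the lists are the inputs of a vertex in planar order.  Labels of
   legs and of white vertices start at 0. *)
Inductive rtree : Type :=
  | Leg of nat
  | White of nat & seq rtree
  | Black of seq rtree
  | Special.

Section RtreeInd.
Variable P : rtree -> Prop.
Hypothesis PL : forall j, P (Leg j).
Hypothesis PW : forall i ts, (forall n, P (nth Special ts n)) -> P (White i ts).
Hypothesis PB : forall ts, (forall n, P (nth Special ts n)) -> P (Black ts).
Hypothesis PS : P Special.

Fixpoint rtree_nth_ind (t : rtree) : P t :=
  let fix all_ind ts n : P (nth Special ts n) :=
    match ts, n with
    | [::], 0%N => PS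
    | [::], _.+1 => PS
    | t0 :: _, 0%N => rtree_nth_ind t0
    | _ :: ts0, n0.+1 => all_ind ts0 n0
    end in
  match t with
  | Leg j => PL j
  | White i ts => PW i (all_ind ts)
  | Black ts => PB (all_ind ts)
  | Special => PS
  end.
End RtreeInd.

Fixpoint rtree_encode (t : rtree) : GenTree.tree nat :=
  match t with
  | Leg j => GenTree.Leaf j
  | White i ts => GenTree.Node i.+2 (map rtree_encode ts)
  | Black ts => GenTree.Node 1 (map rtree_encode ts)
  | Special => GenTree.Node 0 [::]
  end.

Fixpoint rtree_decode (t : GenTree.tree nat) : rtree :=
  match t with
  | GenTree.Leaf j => Leg j
  | GenTree.Node i.+2 ts => White i (map rtree_decode ts)
  | GenTree.Node 1 ts => Black (map rtree_decode ts)
  | GenTree.Node 0 _ => Special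
  end.

Lemma rtree_encodeK : cancel rtree_encode rtree_decode.
Proof.
have mapK ts : (forall n, rtree_decode (rtree_encode (nth Special ts n)) =
    nth Special ts n) -> map rtree_decode (map rtree_encode ts) = ts.
  move=> IH; rewrite -map_comp; apply: (@eq_from_nth _ Special); rewrite size_map //.
  by move=> n nlt; rewrite (nth_map Special) //= IH.
by elim/rtree_nth_ind => [j|i ts /mapK IH|ts /mapK IH|] //=; rewrite IH.
Qed.

HB.instance Definition _ := Countable.copy rtree (can_type rtree_encodeK).

Fixpoint legs (t : rtree) : seq nat :=
  match t with
  | Leg j => [:: j]
  | White _ ts | Black ts => flatten (map legs ts)
  | Special => [::]
  end.

(* pairs (label, arity) *)
Fixpoint whites (t : rtree) : seq (nat * nat) :=
  match t with
  | White i ts => (i, size ts) :: flatten (map whites ts)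
  | Black ts => flatten (map whites ts)
  | _ => [::]
  end.

Definition blackable (t : rtree) : bool :=
  match t with Black _ | Special => false | _ => true end.

Fixpoint reduced_tree (t : rtree) : bool :=
  match t with
  | White _ ts => all reduced_tree ts
  | Black ts => [&& (1 < size ts)%N, all blackable ts & all reduced_tree ts]
  | _ => true
  end.

(* For ks = [::] this includes the exceptional trees Leg 0 (l = 1) and Special
   (l = 0). *)
Definition is_tree (l : nat) (ks : seq nat) (t : rtree) : bool :=
  [&& perm_eq (legs t) (iota 0 l),
      perm_eq (whites t) (zip (iota 0 (size ks)) ks)
    & reduced_tree t].

Definition tree (l : nat) (ks : seq nat) := {t : rtree | is_tree l ks t}.
HB.instance Definition _ l ks := Countable.on (tree l ks).

Fixpoint relabel (s : nat -> nat) (t : rtree) : rtree :=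
  match t with
  | White i ts => White (s i) (map (relabel s) ts)
  | Black ts => Black (map (relabel s) ts)
  | _ => t
  end.

Fixpoint plug (cs : seq rtree) (t : rtree) : rtree :=
  match t with
  | Leg j => nth Special cs j
  | White i ts => White i (map (plug cs) ts)
  | Black ts => Black (map (plug cs) ts)
  | Special => Special
  end.

(* Replaces the white vertex i of t by u, whose white labels are already the
   final ones; m is the number of white vertices of u. *)
Fixpoint replace_white (i m : nat) (u t : rtree) : rtree :=
  match t with
  | White j ts => let cs := map (replace_white i m u) ts in
      if j == i then plug cs u else White (shift i m j) cs
  | Black ts => Black (map (replace_white i m u) ts)
  | _ => t
  end.

Definition black_inputs (t : rtree) : seq rtree :=
  match t with Black ts => ts | Special => [::] | _ => [:: t] end.

Definition mk_black (ts : seq rtree) : rtree :=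
  match flatten (map black_inputs ts) with
  | [::] => Special
  | [:: t] => t
  | ts' => Black ts'
  end.

Fixpoint reduce_tree (t : rtree) : rtree :=
  match t with
  | White i ts => White i (map reduce_tree ts)
  | Black ts => mk_black (map reduce_tree ts)
  | _ => t
  end.

Definition graft (i m : nat) (t u : rtree) : rtree :=
  reduce_tree (replace_white i m (relabel (addn i) u) t).

Definition corolla (c : nat) : rtree := White 0 (map Leg (iota 0 c)).

Section TreeClosure.

Lemma rtree_mem_ind (P : rtree -> Prop) :
  (forall j, P (Leg j)) ->
  (forall i ts, {in ts, forall t, P t} -> P (White i ts)) ->
  (forall ts, {in ts, forall t, P t} -> P (Black ts)) ->
  P Special -> forall t, P t.
Proof.
move=> PL PW PB PS; elim/rtree_nth_ind => // [i ts IH|ts IH].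
  by apply: PW => t /(nthP Special)[n _ <-].
by apply: PB => t /(nthP Special)[n _ <-].
Qed.

Lemma flatten_black_inputs (T : Type) (f : rtree -> seq T) ts :
  f Special = [::] -> (forall ss, f (Black ss) = flatten (map f ss)) ->
  flatten (map f (flatten (map black_inputs ts))) = flatten (map f ts).
Proof.
move=> fS fB; elim: ts => //= t ts IH; rewrite map_cat flatten_cat IH.
by congr (_ ++ _); case: t => [j|j us|us|] //=; rewrite ?cats0 ?fS ?fB.
Qed.

Lemma mk_blackE (T : Type) (f : rtree -> seq T) ts :
  f Special = [::] -> (forall ss, f (Black ss) = flatten (map f ss)) ->
  f (mk_black ts) = flatten (map f ts).
Proof.
move=> fS fB; rewrite -(flatten_black_inputs ts fS fB) /mk_black.
by case: flatten => [|t [|t' ts']] //=; rewrite ?fS ?fB ?cats0.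
Qed.

Lemma legs_reduce t : legs (reduce_tree t) = legs t.
Proof.
elim/rtree_mem_ind: t => //= [i ts IH|ts IH]; rewrite ?(@mk_blackE _ legs) // -map_comp.
  by congr flatten; apply/eq_in_map.
by congr flatten; apply/eq_in_map.
Qed.

Lemma whites_reduce t : whites (reduce_tree t) = whites t.
Proof.
elim/rtree_mem_ind: t => //= [i ts IH|ts IH]; rewrite ?(@mk_blackE _ whites) // -map_comp.
  by rewrite size_map; congr (_ :: flatten _); apply/eq_in_map.
by congr flatten; apply/eq_in_map.
Qed.

Lemma reduced_mk_black ts : all reduced_tree ts -> reduced_tree (mk_black ts).
Proof.
move=> redts; rewrite /mk_black.
have : all blackable (flatten (map black_inputs ts)) &&
       all reduced_tree (flatten (map black_inputs ts)).
  elim: ts redts => //= t ts IH /andP[redt /IH /andP[bt rt]].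
  rewrite !all_cat bt rt !andbT.
  by case: t redt => //= [i us ->|us /and3P[_ -> ->]].
by case: flatten => [|t [|t' ts']] //= /and3P[_ ]; rewrite ?andbT // => /andP[-> ->] ->.
Qed.

Lemma reduced_reduce t : reduced_tree (reduce_tree t).
Proof.
elim/rtree_mem_ind: t => //= [i ts IH|ts IH]; last apply: reduced_mk_black.
  by rewrite all_map; apply/allP.
by rewrite all_map; apply/allP.
Qed.

Lemma legs_relabel s t : legs (relabel s t) = legs t.
Proof.
by elim/rtree_mem_ind: t => //= [i ts IH|ts IH]; rewrite -map_comp;
   congr flatten; apply/eq_in_map.
Qed.

Lemma whites_relabel s t : whites (relabel s t) = [seq (s p.1, p.2) | p <- whites t].
Proof.
elim/rtree_mem_ind: t => //= [i ts IH|ts IH];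
  rewrite ?size_map -map_comp map_flatten -map_comp.
  by congr (_ :: flatten _); apply/eq_in_map.
by congr flatten; apply/eq_in_map.
Qed.

Lemma reduced_relabel s t : reduced_tree (relabel s t) = reduced_tree t.
Proof.
elim/rtree_mem_ind: t => //= [i ts IH|ts IH]; rewrite ?size_map !all_map.
  exact: eq_in_all.
by congr [&& _, _ & _]; [apply: eq_all; case | apply: eq_in_all].
Qed.

Lemma perm_flatten_map (T : Type) (U : eqType) (f g : T -> seq U) s :
  (forall x, perm_eq (f x) (g x)) -> perm_eq (flatten (map f s)) (flatten (map g s)).
Proof. by move=> fg; elim: s => //= x s IH; rewrite perm_cat. Qed.

Lemma perm_flatten_map_in (T U : eqType) (f g : T -> seq U) (s : seq T) :
  {in s, forall x, perm_eq (f x) (g x)} ->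
  perm_eq (flatten (map f s)) (flatten (map g s)).
Proof.
elim: s => //= x s IH fg; rewrite perm_cat ?fg ?mem_head //.
by apply: IH => y ys; rewrite fg // inE ys orbT.
Qed.

Lemma perm_flatten_cat (T : Type) (U : eqType) (f g : T -> seq U) s :
  perm_eq (flatten [seq f x ++ g x | x <- s]) (flatten (map f s) ++ flatten (map g s)).
Proof.
elim: s => //= x s IH; rewrite -!catA perm_cat2l.
apply: perm_trans (perm_cat (perm_refl _) IH) _.
by rewrite !catA perm_cat2r perm_catC.
Qed.

Lemma flatten_flatten (T U V : Type) (f : U -> seq V) (g : T -> seq U) s :
  flatten [seq flatten (map f (g x)) | x <- s] = flatten (map f (flatten (map g s))).
Proof. by elim: s => //= x s IH; rewrite map_cat flatten_cat IH. Qed.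

Lemma legs_plug cs t :
  legs (plug cs t) = flatten [seq legs (nth Special cs j) | j <- legs t].
Proof.
elim/rtree_mem_ind: t => //= [j|i ts IH|ts IH]; rewrite ?cats0 //;
  rewrite -map_comp -flatten_flatten; congr flatten; exact/eq_in_map.
Qed.

Lemma whites_plug cs t : perm_eq (whites (plug cs t))
  (whites t ++ flatten [seq whites (nth Special cs j) | j <- legs t]).
Proof.
elim/rtree_mem_ind: t => //= [j|i ts IH|ts IH]; rewrite ?cats0 //;
  rewrite ?size_map ?perm_cons -map_comp -flatten_flatten;
  apply: perm_trans (perm_flatten_map_in _) (perm_flatten_cat _ _ _); exact: IH.
Qed.

Lemma flatten_nth (T : eqType) (f : rtree -> seq T) cs w :
  perm_eq w (iota 0 (size cs)) ->
  perm_eq (flatten [seq f (nth Special cs j) | j <- w]) (flatten (map f cs)).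
Proof.
move=> /(perm_map (fun j => f (nth Special cs j))) /perm_flatten /permPl ->.
by rewrite -[X in perm_eq _ (flatten (map f X))](mkseq_nth Special cs) /mkseq -map_comp.
Qed.

Lemma all_flatten_map (T : eqType) (U : Type) (a : pred U) (f : T -> seq U) s x :
  x \in s -> all a (flatten (map f s)) -> all a (f x).
Proof.
elim: s => //= y s IH; rewrite inE all_cat => /orP[/eqP -> /andP[]|xs /andP[_]] //.
exact: IH.
Qed.

Lemma legs_replace i m c u t :
  perm_eq (legs u) (iota 0 c) ->
  all [pred p | (p.1 == i) ==> (p.2 == c)] (whites t) ->
  perm_eq (legs (replace_white i m u t)) (legs t).
Proof.
move=> pu; elim/rtree_mem_ind: t => //= [j ts IH|ts IH].
  case/andP=> jc wts.
  have IHts : perm_eq (flatten [seq legs x | x <- map (replace_white i m u) ts])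
                 (flatten (map legs ts)).
    rewrite -map_comp; apply: perm_flatten_map_in => t tin; apply: IH => //.
    exact: all_flatten_map tin wts.
  case: eqP jc => /= [_ /eqP ec|_ _] //.
  rewrite legs_plug; apply: perm_trans IHts; apply: flatten_nth.
  by rewrite size_map ec.
move=> wts; rewrite -map_comp; apply: perm_flatten_map_in => t tin; apply: IH => //.
exact: all_flatten_map tin wts.
Qed.

Lemma whites_replace i m c u t :
  perm_eq (legs u) (iota 0 c) ->
  all [pred p | (p.1 == i) ==> (p.2 == c)] (whites t) ->
  perm_eq (whites (replace_white i m u t))
    (flatten [seq if p.1 == i then whites u else [:: (shift i m p.1, p.2)]
             | p <- whites t]).
Proof.
move=> pu; elim/rtree_mem_ind: t => //= [j ts IH|ts IH].
  case/andP=> jc wts; set F := (fun p : nat * nat => _).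
  have IHts : perm_eq (flatten [seq whites x | x <- map (replace_white i m u) ts])
                 (flatten (map F (flatten (map whites ts)))).
    rewrite -map_comp -flatten_flatten.
    apply: perm_flatten_map_in => t tin; apply: IH => //.
    exact: all_flatten_map tin wts.
  case: eqP jc => /= [_ /eqP ec|_ _].
    apply: perm_trans (whites_plug _ _) _; rewrite perm_cat2l.
    by apply: perm_trans IHts; apply: flatten_nth; rewrite size_map ec.
  by rewrite size_map perm_cons.
move=> wts; rewrite -map_comp -flatten_flatten.
apply: perm_flatten_map_in => t tin; apply: IH => //.
exact: all_flatten_map tin wts.
Qed.

Lemma zip_iotaE ks : zip (iota 0 (size ks)) ks = [seq (i, nth 0%N ks i) | i <- iota 0 (size ks)].
Proof.
apply: (@eq_from_nth _ (0, 0)%N) => [|i]; rewrite size_zip ?size_map size_iota minnn // => ilt.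
by rewrite nth_zip ?size_iota // (nth_map 0%N) ?size_iota // nth_iota.
Qed.

Lemma graftP l ks1 c ks2 js (t : tree l (ks1 ++ c :: ks2)) (u : tree c js) :
  is_tree l (ks1 ++ js ++ ks2) (graft (size ks1) (size js) (val t) (val u)).
Proof.
case: t u => [t /= /and3P[lt wt rt]] [u /= /and3P[lu wu ru]].
have allc : all [pred p | (p.1 == size ks1) ==> (p.2 == c)] (whites t).
  rewrite (perm_all _ wt) zip_iotaE all_map; apply/allP => i _ /=.
  by apply/implyP => /eqP ->; rewrite nth_cat ltnn subnn.
have lu' : perm_eq (legs (relabel (addn (size ks1)) u)) (iota 0 c) by rewrite legs_relabel.
rewrite /is_tree /graft legs_reduce whites_reduce reduced_reduce andbT.
rewrite (permPl (legs_replace _ lu' allc)) lt /=.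
rewrite (permPl (whites_replace _ lu' allc)) whites_relabel.
set i := size ks1; set m := size js; set F := (fun p : nat * nat => if _ then _ else _).
rewrite (permPl (perm_flatten (perm_map F wt))).
rewrite !size_cat /= !iotaD !add0n /= !zip_cat ?size_iota // map_cat flatten_cat /=.
rewrite {2}/F /= eqxx -/i -/m.
apply: perm_cat.
  have -> // : flatten (map F (zip (iota 0 i) ks1)) = zip (iota 0 i) ks1.
  rewrite zip_iotaE -map_comp -[RHS]flatten_seq1 -map_comp; congr flatten.
  apply/eq_in_map => j; rewrite mem_iota /= add0n /F /= /shift => jlt.
  by rewrite jlt ltn_eqF.
apply: perm_cat.
  apply: perm_trans (perm_map _ wu) _.
  have -> // : [seq ((i + p.1)%N, p.2) | p <- zip (iota 0 m) js] = zip (iota i m) js.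
  rewrite -[in RHS](addn0 i) iotaDl; elim: (js) (iota 0 m) => [|j js' IH] [|a s] //=.
  by rewrite IH.
have Fgt j k : (i < j)%N -> F (j, k) = [:: ((j + m).-1, k)].
  by move=> ij; rewrite /F /shift /= gtn_eqF // ltnNge ltnW.
suff gen ks j : (i < j)%N ->
    flatten (map F (zip (iota j (size ks)) ks)) = zip (iota (j + m).-1 (size ks)) ks.
  by rewrite gen.
elim: ks j => //= k ks IH j ij; rewrite IH ?(leq_trans ij) // Fgt //=.
by case: j ij.
Qed.

Lemma relabelP l ks ks' (s : relabelling ks ks') (t : tree l ks) :
  is_tree l ks' (relabel s (val t)).
Proof.
case: t => [t /= /and3P[lt wt rt]].
rewrite /is_tree legs_relabel lt reduced_relabel rt andbT /= whites_relabel.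
apply: perm_trans (perm_map _ wt) _; rewrite !zip_iotaE.
apply: perm_trans (perm_map _ (relab_bij s)); rewrite -!map_comp.
rewrite (_ : map _ _ = [seq (s i, nth 0%N ks' (s i)) | i <- iota 0 (size ks)]) //.
by apply/eq_in_map => i; rewrite mem_iota /= add0n => ilt; rewrite relab_col.
Qed.

Lemma corollaP c : is_tree c [:: c] (corolla c).
Proof.
rewrite /is_tree /= size_map size_iota -!map_comp /=.
have -> : flatten [seq [:: j] | j <- iota 0 c] = iota 0 c by rewrite flatten_seq1.
rewrite perm_refl /= all_map /=; apply/andP; split; last exact/allP.
by elim: (iota 0 c).
Qed.

End TreeClosure.

Definition tree_comp l ks1 c ks2 js (t : tree l (ks1 ++ c :: ks2)) (u : tree c js) :
  tree l (ks1 ++ js ++ ks2) := Sub _ (graftP t u).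

Definition tree_relabel l ks ks' (s : relabelling ks ks') (t : tree l ks) :
  tree l ks' := Sub _ (relabelP s t).

Definition tree_corolla c : tree c [:: c] := Sub _ (corollaP c).

Definition tree_operad : operad_data := {|
  opd_car l ks := {freeg (tree l ks)};
  opd_id c := << tree_corolla c >>;
  opd_comp l ks1 c ks2 js x y :=
    fglift (fun t => fglift (fun u => << @tree_comp l ks1 c ks2 js t u >>) y) x;
  opd_act l ks ks' s x := fglift (fun t => << tree_relabel s t >>) x
|}.

(* The sets of morphisms are types with a zmodType class, rather than a function to
   zmodType, so that the families indexed by all categories still form a
   zmodType: the universe of the sets of morphisms has to be smaller. *)
Record zgraph := ZGraph {
  zg_obj :> Type;
  mor : zg_obj -> zg_obj -> Type;
  mor_zmod : forall a b, GRing.Zmodule (mor a b)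
}.

HB.instance Definition _ (G : zgraph) (a b : G) := mor_zmod a b.

Definition hcast (G : zgraph) (a a' b b' : G) (ea : a = a') (eb : b = b')
    (f : mor a b) : mor a' b' :=
  ecast x (mor x b') ea (ecast y (mor a y) eb f).

(* Composition is written in the usual order: compm g f is g after f.  Strictness is
   equality of objects, and the corresponding equalities of morphisms hold up to
   transport along it. *)
Record symcat := SymCat {
  sc_graph :> zgraph;
  idm : forall a : sc_graph, mor a a;
  compm : forall a b c : sc_graph, mor b c -> mor a b -> mor a c;
  unito : sc_graph;
  tenso : sc_graph -> sc_graph -> sc_graph;
  tensm : forall a a' b b' : sc_graph,
    mor a a' -> mor b b' -> mor (tenso a b) (tenso a' b');
  braid : forall a b : sc_graph, mor (tenso a b) (tenso b a);

  compmA : forall (a b c d : sc_graph) (h : mor c d) (g : mor b c) (f : mor a b),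
    compm h (compm g f) = compm (compm h g) f;
  comp1m : forall (a b : sc_graph) (f : mor a b), compm (idm b) f = f;
  compm1 : forall (a b : sc_graph) (f : mor a b), compm f (idm a) = f;
  compmDl : forall (a b c : sc_graph) (g g' : mor b c) (f : mor a b),
    compm (g + g') f = compm g f + compm g' f;
  compmDr : forall (a b c : sc_graph) (g : mor b c) (f f' : mor a b),
    compm g (f + f') = compm g f + compm g f';

  tensm_id : forall a b : sc_graph, tensm (idm a) (idm b) = idm (tenso a b);
  tensm_comp : forall (a b c a' b' c' : sc_graph)
      (g : mor b c) (f : mor a b) (g' : mor b' c') (f' : mor a' b'),
    tensm (compm g f) (compm g' f') = compm (tensm g g') (tensm f f');
  tensmDl : forall (a a' b b' : sc_graph) (f f' : mor a a') (g : mor b b'),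
    tensm (f + f') g = tensm f g + tensm f' g;
  tensmDr : forall (a a' b b' : sc_graph) (f : mor a a') (g g' : mor b b'),
    tensm f (g + g') = tensm f g + tensm f g';

  tensoA : forall a b c : sc_graph, tenso a (tenso b c) = tenso (tenso a b) c;
  tenso1l : forall a : sc_graph, tenso unito a = a;
  tenso1r : forall a : sc_graph, tenso a unito = a;
  tensmA : forall (a a' b b' c c' : sc_graph)
      (f : mor a a') (g : mor b b') (h : mor c c'),
    hcast (tensoA a b c) (tensoA a' b' c') (tensm f (tensm g h)) =
    tensm (tensm f g) h;
  tensm1l : forall (a b : sc_graph) (f : mor a b),
    hcast (tenso1l a) (tenso1l b) (tensm (idm unito) f) = f;
  tensm1r : forall (a b : sc_graph) (f : mor a b),
    hcast (tenso1r a) (tenso1r b) (tensm f (idm unito)) = f;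

  braid_nat : forall (a a' b b' : sc_graph) (f : mor a a') (g : mor b b'),
    compm (braid a' b') (tensm f g) = compm (tensm g f) (braid a b);
  braidK : forall a b : sc_graph, compm (braid b a) (braid a b) = idm (tenso a b);
  braid_hexagon : forall a b c : sc_graph,
    hcast (tensoA a b c) erefl (braid a (tenso b c)) =
    compm (hcast (tensoA b a c) (tensoA b c a) (tensm (idm b) (braid a c)))
          (tensm (braid a b) (idm c))
}.

Arguments idm {s} a.
Arguments compm {s a b c} g f.
Arguments unito {s}.
Arguments tenso {s} a b.
Arguments tensm {s a a' b b'} f g.
Arguments braid {s} a b.

Record symcat_pt := SymCatPt {
  sp_cat :> symcat;
  mon : sp_cat;
  mon_mul : mor (tenso mon mon) mon;
  mon_one : mor unito mon;
  mon_mulA : hcast (tensoA mon mon mon) erefl (compm mon_mul (tensm (idm mon) mon_mul)) =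
    compm mon_mul (tensm mon_mul (idm mon));
  mon_mul1l : hcast (tenso1l mon) erefl (compm mon_mul (tensm mon_one (idm mon))) = idm mon;
  mon_mul1r : hcast (tenso1r mon) erefl (compm mon_mul (tensm (idm mon) mon_one)) = idm mon
}.

Arguments mon : clear implicits.
Arguments mon_mul : clear implicits.
Arguments mon_one : clear implicits.

Record symcat_pt_functor (V W : symcat_pt) := SymCatPtFunctor {
  fobj :> V -> W;
  fhom : forall a b : V, {additive mor a b -> mor (fobj a) (fobj b)};
  fhom_id : forall a : V, fhom a a (idm a) = idm (fobj a);
  fhom_comp : forall (a b c : V) (g : mor b c) (f : mor a b),
    fhom a c (compm g f) = compm (fhom b c g) (fhom a b f);
  fobj_unit : fobj unito = unito;
  fobj_tens : forall a b : V, fobj (tenso a b) = tenso (fobj a) (fobj b);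
  fhom_tens : forall (a a' b b' : V) (f : mor a a') (g : mor b b'),
    hcast (fobj_tens a b) (fobj_tens a' b') (fhom _ _ (tensm f g)) =
    tensm (fhom _ _ f) (fhom _ _ g);
  fhom_braid : forall a b : V,
    hcast (fobj_tens a b) (fobj_tens b a) (fhom _ _ (braid a b)) =
    braid (fobj a) (fobj b);
  fobj_mon : fobj (mon V) = mon W;
  fhom_mul : hcast (etrans (fobj_tens _ _) (congr2 tenso fobj_mon fobj_mon)) fobj_mon
      (fhom _ _ (mon_mul V)) = mon_mul W;
  fhom_one : hcast fobj_unit fobj_mon (fhom _ _ (mon_one V)) = mon_one W
}.

Fixpoint mpow (V : symcat_pt) (k : nat) : V :=
  if k is k'.+1 then tenso (mon V) (mpow V k') else unito.

Notation opn V k := (mor (mpow V k) (mon V)).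

Definition inputs (V : symcat_pt) (ks : seq nat) := forall i : 'I_(size ks), opn V (nth 0%N ks i).

Section Functor.
Variables (V W : symcat_pt) (F : symcat_pt_functor V W).

Lemma fobj_mpow k : F (mpow V k) = mpow W k.
Proof.
by elim: k => [|k IH] /=; [exact: fobj_unit | rewrite fobj_tens fobj_mon IH].
Qed.

Definition fopn k (f : opn V k) : opn W k :=
  hcast (fobj_mpow k) (fobj_mon F) (fhom F _ _ f).

Definition finputs ks (fs : inputs V ks) : inputs W ks := fun i => fopn (fs i).
End Functor.

(* A linear map out of a tensor product of abelian groups is given as a map that is
   additive in each argument. *)
Definition multiadditive (V : symcat_pt) ks l (a : inputs V ks -> opn V l) :=
  forall (i : 'I_(size ks)) (f g h : inputs V ks),
    (forall j, j != i -> f j = h j /\ g j = h j) -> h i = f i + g i ->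
    a h = a f + a g.

Record natop (l : nat) (ks : seq nat) := NatOp {
  natop_fun :> forall V : symcat_pt, inputs V ks -> opn V l;
  natop_additive : forall V, multiadditive (@natop_fun V);
  natop_natural : forall (V W : symcat_pt) (F : symcat_pt_functor V W) (fs : inputs V ks),
    fopn F (natop_fun fs) = natop_fun (finputs F fs)
}.

HB.instance Definition _ l ks := gen_eqMixin (natop l ks).
HB.instance Definition _ l ks := gen_choiceMixin (natop l ks).

Lemma natopP l ks (a b : natop l ks) : (forall V fs, a V fs = b V fs) -> a = b.
Proof.
case: a b => [a aA aN] [b bA bN] /= ab.
have ab' : a = b by apply: functional_extensionality_dep => V; apply/funext => fs.
by subst b; congr NatOp; apply: Prop_irrelevance.
Qed.

(* Retyping of an operation whose arity p is equal to q; the value 0 is never used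
   when the arities agree. *)
Definition recast (V : symcat_pt) (p q : nat) (f : opn V p) : opn V q :=
  match p =P q with
  | ReflectT e => ecast r (opn V r) e f
  | ReflectF _ => 0
  end.

(* The i-th input, known to be of arity p; again the value 0 is only reached for
   positions or arities out of range. *)
Definition input (V : symcat_pt) ks (fs : inputs V ks) (i p : nat) : opn V p :=
  if insub i is Some j then recast p (fs j) else 0.

Definition inner_inputs (V : symcat_pt) ks1 js ks2 (fs : inputs V (ks1 ++ js ++ ks2)) :
    inputs V js :=
  fun q => input fs (size ks1 + q) (nth 0%N js q).

Definition outer_inputs (V : symcat_pt) ks1 c js ks2 (fs : inputs V (ks1 ++ js ++ ks2))
    (f : opn V c) : inputs V (ks1 ++ c :: ks2) :=
  fun p => if p == size ks1 :> nat then recast _ f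
           else input fs (shift (size ks1) (size js) p) _.

Definition relabel_inputs (V : symcat_pt) ks ks' (s : relabelling ks ks')
    (fs : inputs V ks') : inputs V ks :=
  fun i => input fs (s i) (nth 0%N ks i).

Section NatOpClosure.
Variables (V W : symcat_pt) (F : symcat_pt_functor V W).

Lemma hcast0 (G : zgraph) (a a' b b' : G) (ea : a = a') (eb : b = b') :
  hcast ea eb (0 : mor a b) = 0.
Proof. by case: a' / ea; case: b' / eb. Qed.

Lemma hcastD (G : zgraph) (a a' b b' : G) (ea : a = a') (eb : b = b') (f g : mor a b) :
  hcast ea eb (f + g) = hcast ea eb f + hcast ea eb g.
Proof. by case: a' / ea; case: b' / eb. Qed.

Lemma hcastN (G : zgraph) (a a' b b' : G) (ea : a = a') (eb : b = b') (f : mor a b) :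
  hcast ea eb (- f) = - hcast ea eb f.
Proof. by case: a' / ea; case: b' / eb. Qed.

Lemma fopn0 k : fopn F (0 : opn V k) = 0.
Proof. by rewrite /fopn raddf0 hcast0. Qed.

Lemma fopnD k (f g : opn V k) : fopn F (f + g) = fopn F f + fopn F g.
Proof. by rewrite /fopn raddfD hcastD. Qed.

Lemma fopnN k (f : opn V k) : fopn F (- f) = - fopn F f.
Proof. by rewrite /fopn raddfN hcastN. Qed.

Lemma recastE (U : symcat_pt) p q (e : p = q) (f : opn U p) :
  recast q f = ecast r (opn U r) e f.
Proof.
by rewrite /recast; case: eqP => // e'; rewrite (Prop_irrelevance e' e).
Qed.

Lemma recastD (U : symcat_pt) p q (f g : opn U p) :
  recast q (f + g) = recast q f + recast q g.
Proof. by rewrite /recast; case: eqP => [e|_]; [case: q / e | rewrite addr0]. Qed.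

Lemma fopn_recast p q (f : opn V p) : fopn F (recast q f) = recast q (fopn F f).
Proof. by rewrite /recast; case: eqP => [e|_]; [case: q / e | exact: fopn0]. Qed.

Lemma fopn_input ks (fs : inputs V ks) i p :
  fopn F (input fs i p) = input (finputs F fs) i p.
Proof. by rewrite /input; case: insub => [j|]; rewrite ?fopn_recast ?fopn0. Qed.

Lemma input_eq ks (f h : inputs V ks) (i : 'I_(size ks)) (k p : nat) :
  (forall j, j != i -> f j = h j) -> k != i -> input f k p = input h k p.
Proof.
move=> fh ki; rewrite /input; case: insubP => //= j _ jk; rewrite fh //.
by apply: contraNneq ki => <-; rewrite -jk.
Qed.

Lemma inputD ks (f g h : inputs V ks) (i : 'I_(size ks)) p :
  h i = f i + g i -> input h i p = input f i p + input g i p.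
Proof. by move=> hi; rewrite /input valK hi recastD. Qed.

End NatOpClosure.

#[local] Obligation Tactic := idtac.

Section NatOpZmod.
Variables (l : nat) (ks : seq nat).
Implicit Types a b : natop l ks.

Program Definition natop_zero : natop l ks := @NatOp l ks (fun V _ => 0) _ _.
Next Obligation. by move=> V i f g h _ _; rewrite addr0. Qed.
Next Obligation. by move=> V W F fs; rewrite fopn0. Qed.

Program Definition natop_opp a : natop l ks := @NatOp l ks (fun V fs => - a V fs) _ _.
Next Obligation.
by move=> a V i f g h fgh hi; rewrite (natop_additive _ fgh hi) opprD.
Qed.
Next Obligation. by move=> a V W F fs; rewrite fopnN natop_natural. Qed.

Program Definition natop_add a b : natop l ks :=
  @NatOp l ks (fun V fs => a V fs + b V fs) _ _.
Next Obligation.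
by move=> a b V i f g h fgh hi; rewrite !(natop_additive _ fgh hi) addrACA.
Qed.
Next Obligation. by move=> a b V W F fs; rewrite fopnD !natop_natural. Qed.

Fact natop_addA : associative natop_add.
Proof. by move=> a b c; apply: natopP => V fs; rewrite /= addrA. Qed.
Fact natop_addC : commutative natop_add.
Proof. by move=> a b; apply: natopP => V fs; rewrite /= addrC. Qed.
Fact natop_add0 : left_id natop_zero natop_add.
Proof. by move=> a; apply: natopP => V fs; rewrite /= add0r. Qed.
Fact natop_addN : left_inverse natop_zero natop_opp natop_add.
Proof. by move=> a; apply: natopP => V fs; rewrite /= addNr. Qed.

HB.instance Definition _ := GRing.isZmodule.Build (natop l ks)
  natop_addA natop_addC natop_add0 natop_addN.
End NatOpZmod.

Program Definition natop_id (c : nat) : natop c [:: c] :=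
  @NatOp c [:: c] (fun V fs => fs ord0) _ _.
Next Obligation. by move=> c V i f g h _; rewrite ord1. Qed.
Next Obligation. by []. Qed.

Program Definition natop_comp l ks1 c ks2 js (a : natop l (ks1 ++ c :: ks2))
    (b : natop c js) : natop l (ks1 ++ js ++ ks2) :=
  @NatOp l (ks1 ++ js ++ ks2)
    (fun V fs => a V (outer_inputs fs (b V (inner_inputs fs)))) _ _.
Next Obligation.
move=> l ks1 c ks2 js a b V i f g h fgh hi.
have fh j : j != i -> f j = h j by case/fgh.
have gh j : j != i -> g j = h j by case/fgh.
have i1lt : (size ks1 < size (ks1 ++ c :: ks2))%N.
  by rewrite size_cat /= -addSnnS leq_addr.
have outer_eq (f0 : inputs V (ks1 ++ js ++ ks2)) (u : opn V c)
      (p : 'I_(size (ks1 ++ c :: ks2))) :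
    (forall j, j != i -> f0 j = h j) -> p != size ks1 :> nat ->
    shift (size ks1) (size js) p != i ->
    outer_inputs f0 u p = outer_inputs h u p.
  by move=> f0h pN si; rewrite /outer_inputs (negPf pN); apply: input_eq si.
have [/andP[le_i lt_i]|Ni] := boolP ((size ks1 <= i) && (i < size ks1 + size js))%N.
  have qlt : (i - size ks1 < size js)%N by rewrite ltn_subLR.
  have sh p : p != size ks1 -> shift (size ks1) (size js) p != i.
    rewrite /shift; case: ltnP => [lt_p _|le_p pN].
      by rewrite ltn_eqF // (leq_trans lt_p).
    have lt_p : (size ks1 < p)%N by rewrite ltn_neqAle eq_sym pN.
    rewrite gtn_eqF //; apply: leq_trans lt_i _.
    by case: p {pN le_p} lt_p => // p; rewrite ltnS addSn leq_add2r.
  have inner_h : b V (inner_inputs h) = b V (inner_inputs f) + b V (inner_inputs g).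
    apply: (@natop_additive _ _ b V (Ordinal qlt)) => [q qN|].
      have qN' : (size ks1 + q)%N != i.
        apply: contraNneq qN => qi; apply/eqP/val_inj => /=.
        by rewrite -qi addKn.
      by split; apply: input_eq qN'.
    by rewrite /inner_inputs /= subnKC // (inputD _ hi).
  apply: (@natop_additive _ _ a V (Ordinal i1lt)) => [p pN|].
    have pN' : p != size ks1 :> nat by rewrite -val_eqE in pN.
    split.
      by rewrite outer_eq ?sh // /outer_inputs (negPf pN').
    by rewrite outer_eq ?sh // /outer_inputs (negPf pN').
  by rewrite /outer_inputs /= eqxx inner_h recastD.
have inner_eq (f0 : inputs V (ks1 ++ js ++ ks2)) :
    (forall j, j != i -> f0 j = h j) -> inner_inputs f0 = inner_inputs h.
  move=> f0h; apply: functional_extensionality_dep => q; apply: input_eq f0h _.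
  by apply: contraNneq Ni => <-; rewrite leq_addr ltn_add2l ltn_ord.
rewrite (inner_eq f fh) (inner_eq g gh); set u := b V _.
pose p0 : nat := if (i < size ks1)%N then i : nat else (i - size js).+1.
have i_ge : (size ks1 <= i)%N -> (size ks1 + size js <= i)%N.
  by move=> le_i; move: Ni; rewrite le_i /= -leqNgt.
have ilt : (i < size js + (size ks1 + size ks2))%N.
  by have := ltn_ord i; move: (nat_of_ord i) => n; rewrite !size_cat addnCA.
have eqsz : size (ks1 ++ c :: ks2) = (size ks1 + size ks2).+1.
  by rewrite size_cat /= addnS.
have p0lt : (p0 < size (ks1 ++ c :: ks2))%N.
  rewrite eqsz /p0; case: (ltnP i) => [lt_i|/i_ge ge_i].
    by rewrite ltnS (leq_trans (ltnW lt_i)) ?leq_addr.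
  by rewrite ltnS ltn_subLR ?(leq_trans _ ge_i) ?leq_addl.
have p0N : p0 != size ks1.
  rewrite /p0; case: (ltnP i) => [lt_i|/i_ge ge_i]; first by rewrite ltn_eqF.
  by rewrite gtn_eqF // ltnS leq_subRL ?(leq_trans _ ge_i) ?leq_addl // addnC.
have sh_p0 : shift (size ks1) (size js) p0 = i.
  rewrite /shift /p0; case: (ltnP i) => [->//|/i_ge ge_i].
  rewrite ltnNge leqW /= ?addSn /= ?subnK ?(leq_trans _ ge_i) ?leq_addl //.
  by rewrite leq_subRL ?(leq_trans _ ge_i) ?leq_addl // addnC.
have sh_inj p : p != size ks1 -> shift (size ks1) (size js) p = i -> p = p0.
  rewrite /shift /p0; case: (ltnP p) => [lt_p _ <-|le_p pN]; first by rewrite lt_p.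
  have : (size ks1 < p)%N by rewrite ltn_neqAle eq_sym pN.
  case: p {pN le_p} => // p; rewrite ltnS addSn /= => le_p <-.
  by rewrite ltnNge (leq_trans le_p) ?leq_addr //= addnK.
apply: (@natop_additive _ _ a V (Ordinal p0lt)) => [p pN|].
  have [pE|pN'] := eqVneq (p : nat) (size ks1).
    by rewrite /outer_inputs pE eqxx.
  have sN : shift (size ks1) (size js) p != i.
    by apply: contraNneq pN => /(sh_inj _ pN') pE; apply/eqP/val_inj.
  by split; apply: outer_eq.
by rewrite /outer_inputs /= (negPf p0N) sh_p0 (inputD _ hi).
Qed.
Next Obligation.
move=> l ks1 c ks2 js a b V W F fs; rewrite natop_natural; congr (a W).
apply: functional_extensionality_dep => p; rewrite /finputs /outer_inputs.
case: eqP => _; last exact: fopn_input.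
rewrite fopn_recast natop_natural; congr (recast _ (b W _)).
by apply: functional_extensionality_dep => q; apply: fopn_input.
Qed.

Program Definition natop_act l ks ks' (s : relabelling ks ks') (a : natop l ks) :
    natop l ks' :=
  @NatOp l ks' (fun V fs => a V (relabel_inputs s fs)) _ _.
Next Obligation.
move=> l ks ks' s a V i f g h fgh hi.
have fh j : j != i -> f j = h j by case/fgh.
have gh j : j != i -> g j = h j by case/fgh.
have : (i : nat) \in [seq s i | i <- iota 0 (size ks)].
  by rewrite (perm_mem (relab_bij s)) mem_iota /=.
case/mapP => j; rewrite mem_iota /= add0n => jlt ij.
have s_uniq : uniq [seq s i | i <- iota 0 (size ks)].
  by rewrite (perm_uniq (relab_bij s)) iota_uniq.
apply: (@natop_additive _ _ a V (Ordinal jlt)) => [p pN|].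
  have sN : s p != i.
    apply: contraNneq pN; rewrite ij => sp; apply/eqP/val_inj => /=.
    have /uniqP := s_uniq => /(_ 0%N p j).
    rewrite !inE size_map size_iota !(nth_map 0%N) ?size_iota // !nth_iota //.
    by rewrite !add0n; apply.
  by split; apply: input_eq sN.
by rewrite /relabel_inputs /= -ij (inputD _ hi).
Qed.
Next Obligation.
move=> l ks ks' s a V W F fs; rewrite natop_natural; congr (a W).
by apply: functional_extensionality_dep => q; apply: fopn_input.
Qed.

Definition natop_operad : operad_data := {|
  opd_car l ks := natop l ks;
  opd_id := natop_id;
  opd_comp := natop_comp;
  opd_act := natop_act
|}.

Section Evaluation.
Variable V : symcat_pt.

Lemma mpow_cat (T : Type) (s1 s2 : seq T) :
  tenso (mpow V (size s1)) (mpow V (size s2)) = mpow V (size (s1 ++ s2)).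
Proof. by elim: s1 => [|x s1 IH] /=; rewrite ?tenso1l // -IH tensoA. Qed.

Fixpoint iter_mul (k : nat) : opn V k :=
  if k is k'.+1 then compm (mon_mul V) (tensm (idm (mon V)) (iter_mul k'))
  else mon_one V.

Section Forest.
Variable ev : forall t : rtree, opn V (size (legs t)).

Fixpoint eval_forest (ts : seq rtree) :
    mor (mpow V (size (flatten (map legs ts)))) (mpow V (size ts)) :=
  match ts with
  | [::] => idm unito
  | t :: ts' =>
      hcast (mpow_cat (legs t) (flatten (map legs ts'))) erefl
        (tensm (ev t) (eval_forest ts'))
  end.
End Forest.

(* Value of a tree when its legs are taken in planar order. *)
Fixpoint eval_planar ks (fs : inputs V ks) (t : rtree) : opn V (size (legs t)) :=
  match t with
  | Leg _ => hcast (esym (tenso1r (mon V))) erefl (idm (mon V))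
  | White i ts => compm (input fs i (size ts)) (eval_forest (eval_planar fs) ts)
  | Black ts => compm (iter_mul (size ts)) (eval_forest (eval_planar fs) ts)
  | Special => mon_one V
  end.

(* x_0 # ... # x_n |-> x_j # x_0 # ... # x_n (with x_j omitted in the tail), where #
   stands for the tensor product. *)
Fixpoint pull (n j : nat) : mor (mpow V n.+1) (mpow V n.+1) :=
  match n, j with
  | n'.+1, j'.+1 =>
      compm (hcast (esym (tensoA _ _ _)) (esym (tensoA _ _ _))
               (tensm (braid (mon V) (mon V)) (idm (mpow V n'))))
            (tensm (idm (mon V)) (pull n' j'))
  | _, _ => idm _
  end.

(* x_0 # ... # x_(n-1) |-> x_(w_0) # ... # x_(w_(n-1)), for w a permutation of
   0, ..., n-1. *)
Fixpoint permute (n : nat) (w : seq nat) : mor (mpow V n) (mpow V n) :=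
  match n, w with
  | n'.+1, j :: w' => compm (tensm (idm (mon V)) (permute n' (map (unbump j) w'))) (pull n' j)
  | _, _ => idm _
  end.

Definition tree_eval l ks (t : tree l ks) (fs : inputs V ks) : opn V l :=
  compm (recast l (eval_planar fs (val t)) : mor (mpow V l) (mon V))
        (permute l (legs (val t))).
End Evaluation.

(* Main.v *)
From HB Require Import structures.
Require Import Defs.
From mathcomp Require Import all_boot all_algebra freeg.
From mathcomp Require Import boolp zify.

(* Let U be the category with objects the natural numbers, where a morphism m -> n is an
   integral combination of forests of n reduced trees with legs 0, ..., m-1 and arbitrarily
   labelled white vertices, and composition is substitution. The object 1 of U is a monoid,
   and coherence for symmetries makes U universal: given operations phi i p : M^p -> M in
   (W, M), evaluation of trees is a functor U -> W that sends the corolla of arity p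
   labelled i to phi i p. By naturality, an operation is determined by its value at the
   corollas of U, which is a combination of trees. Functors U -> U that multiply one corolla
   by 2 or by 0 show, by multilinearity, that the trees with a nonzero coefficient have
   exactly one white vertex for each input. Hence evaluation of trees is an isomorphism onto
   natural operations. Composites and relabellings are compared at the corollas of U, and
   the operad axioms for trees follow from those for natural operations. *)

Set Implicit Arguments.
Unset Strict Implicit.
Unset Printing Implicit Defensive.
Import GRing.Theory Num.Theory.
Local Open Scope ring_scope.

(** * Arrows up to transport, and coherence for symmetries *)

(** Strictness makes every structural law an equality between morphisms of equal but not convertible
    types. Computations therefore take place on arrows, which carry their endpoints and absorb
    transport; [Arr_inj] returns to morphisms. The obstacle to functoriality of evaluation is the
    order of the factors: a tree is evaluated in planar order, while its legs are named, so
    composing two values interposes a symmetry that permutes whole blocks of factors and another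
    that permutes single ones. Indexing symmetries by duplicate-free words, rather than by
    permutations of positions, lets them be restricted, concatenated and composed without
    renumbering; the matter then rests on [asig_nat], [asig_flatten] and [asig_comp]. The constants
    2 and 0 work because a tree with k vertices of a given label and arity is multiplied by 2 to the
    k, respectively 0 to the k, while the value of the operation is doubled, respectively unchanged.
    As the integers have no zero divisors, k is 1 in the first case and 0 in the second. *)

Section Arrows.
Variable W : symcat.

(** Packing the endpoints with the morphism makes [hcast] invisible, so that strict associativity
    and unitality of the tensor product become plain equalities ([atensA], [atens1l], [atens1r]). *)
Record arrow := Arr { adom : W; acod : W; ahom : mor adom acod }.

Lemma Arr_hcast (a a' b b' : W) (ea : a = a') (eb : b = b') (f : mor a b) :
  Arr (hcast ea eb f) = Arr f.
Proof. by case: a' / ea; case: b' / eb. Qed.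

Lemma ArrE (A : arrow) : Arr (ahom A) = A. Proof. by case: A. Qed.

Lemma Arr_hcastE (A B : arrow) : A = B ->
  exists ea eb, hcast ea eb (ahom A) = ahom B.
Proof. by move=> ->; exists erefl, erefl. Qed.

Lemma hcast_id (G : zgraph) (a b : G) ea eb (f : mor a b) : hcast ea eb f = f.
Proof. by rewrite (Prop_irrelevance ea erefl) (Prop_irrelevance eb erefl). Qed.

(** Equal arrows differ by a transport along loops, which is trivial by proof irrelevance. *)
Lemma Arr_inj (a b : W) (f g : mor a b) : Arr f = Arr g -> f = g.
Proof. by move=> /Arr_hcastE[ea [eb /= <-]]; rewrite hcast_id. Qed.

Lemma comp0m (a b c : W) (f : mor a b) : compm (0 : mor b c) f = 0.
Proof. by apply: (addrI (compm 0 f)); rewrite -compmDl !addr0. Qed.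

Lemma compm0 (a b c : W) (g : mor b c) : compm g (0 : mor a b) = 0.
Proof. by apply: (addrI (compm g 0)); rewrite -compmDr !addr0. Qed.

(* Composites of non-composable arrows are zero, which makes [acompA] unconditional. *)
Definition acomp (A B : arrow) : arrow :=
  Arr (match pselect (acod B = adom A) with
       | left e => compm (ahom A) (hcast erefl e (ahom B))
       | right _ => 0
       end).
Definition atens (A B : arrow) : arrow := Arr (tensm (ahom A) (ahom B)).
Definition aid a : arrow := Arr (idm a).
Definition abraid a b : arrow := Arr (braid a b).

Lemma acompE a b c (g : mor b c) (f : mor a b) : acomp (Arr g) (Arr f) = Arr (compm g f).
Proof. by rewrite /acomp; case: pselect => [e|[]//]; congr (Arr (compm g _)); exact: hcast_id. Qed.

Lemma acomp_junk A B : acod B <> adom A -> acomp A B = Arr (0 : mor (adom B) (acod A)).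
Proof. by rewrite /acomp => AB; case: pselect. Qed.

Lemma acomp0 (A : arrow) a b : acomp A (Arr (0 : mor a b)) = Arr (0 : mor a (acod A)).
Proof.
rewrite /acomp; case: pselect => //= e; case: A e => ? c g /= e.
by case: _ / e g => g /=; rewrite compm0.
Qed.

Lemma a0comp (A : arrow) b c : acomp (Arr (0 : mor b c)) A = Arr (0 : mor (adom A) c).
Proof. by rewrite /acomp; case: pselect => //= e; rewrite comp0m. Qed.

Lemma acompA A B C : acomp A (acomp B C) = acomp (acomp A B) C.
Proof.
have [AB|nAB] := pselect (acod B = adom A); last first.
  by rewrite (acomp_junk nAB) (acomp_junk (A := A)) // a0comp.
have [BC|nBC] := pselect (acod C = adom B); last first.
  by rewrite (acomp_junk nBC) (acomp_junk (B := C)) // acomp0.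
case: A B C AB BC => [? d h] [b c g] [a ? f] /= AB BC.
case: _ / AB h => h; case: _ / BC g => g.
by rewrite !acompE compmA.
Qed.

Lemma a1comp A b : acod A = b -> acomp (aid b) A = A.
Proof. by case: A => a ? f /= <-; rewrite acompE comp1m. Qed.

Lemma acomp1 A a : adom A = a -> acomp A (aid a) = A.
Proof. by case: A => ? b f /= <-; rewrite acompE compm1. Qed.

Lemma atens_comp A B A' B' : acod B = adom A -> acod B' = adom A' ->
  atens (acomp A B) (acomp A' B') = acomp (atens A A') (atens B B').
Proof.
case: A B A' B' => [? c g] [a b f] [? c' g'] [a' b' f'] /= e e'.
case: _ / e g => g; case: _ / e' g' => g'.
by rewrite !acompE /atens /= tensm_comp.
Qed.

Lemma atens_id a b : atens (aid a) (aid b) = aid (tenso a b).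
Proof. by rewrite /atens /= tensm_id. Qed.

Lemma atensA A B C : atens A (atens B C) = atens (atens A B) C.
Proof. by rewrite /atens /= -tensmA Arr_hcast. Qed.

Lemma atens1l A : atens (aid unito) A = A.
Proof. by rewrite -[RHS]ArrE -[ahom A]tensm1l Arr_hcast. Qed.

Lemma atens1r A : atens A (aid unito) = A.
Proof. by rewrite -[RHS]ArrE -[ahom A]tensm1r Arr_hcast. Qed.

Lemma abraid_nat A B :
  acomp (abraid (acod A) (acod B)) (atens A B) =
  acomp (atens B A) (abraid (adom A) (adom B)).
Proof. by rewrite !acompE braid_nat. Qed.

Lemma abraidK a b : acomp (abraid b a) (abraid a b) = aid (tenso a b).
Proof. by rewrite acompE braidK. Qed.

Lemma abraid_tensr a b c : abraid a (tenso b c) =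
  acomp (atens (aid b) (abraid a c)) (atens (abraid a b) (aid c)).
Proof.
have /(congr1 (@Arr _ _)) := braid_hexagon a b c.
by rewrite Arr_hcast -acompE Arr_hcast.
Qed.

Lemma abraid_inj a b A B : acod A = tenso a b -> acod B = tenso a b ->
  acomp (abraid a b) A = acomp (abraid a b) B -> A = B.
Proof.
move=> cA cB /(congr1 (acomp (abraid b a))).
by rewrite !acompA abraidK !a1comp.
Qed.

(** The hexagon with two unit objects makes this symmetry idempotent, and an invertible idempotent
    is the identity. *)
Lemma abraid_unitr a : abraid a unito = aid a.
Proof.
apply: (@abraid_inj a unito); rewrite /= ?tenso1l ?tenso1r //.
have e := abraid_tensr a unito unito; rewrite !atens1l !atens1r tenso1r in e.
by rewrite -e acomp1 //= tenso1r.
Qed.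

(** The second hexagon follows from the first, since both sides are right inverse to the symmetry in
    the other direction. *)
Lemma abraid_tensl a b c : abraid (tenso a b) c =
  acomp (atens (abraid a c) (aid b)) (atens (aid a) (abraid b c)).
Proof.
apply: (@abraid_inj c (tenso a b)); rewrite /= ?tensoA //.
rewrite abraidK abraid_tensr -acompA [X in acomp _ X]acompA.
rewrite -atens_comp // abraidK a1comp // atens_id /=.
rewrite a1comp /= ?tensoA // -atens_comp // abraidK a1comp //.
by rewrite atens_id tensoA.
Qed.

Lemma abraid_unitl a : abraid unito a = aid a.
Proof.
have e := abraidK a unito; rewrite abraid_unitr tenso1r in e.
by rewrite -e acomp1 //= tenso1l.
Qed.

Lemma atens_idl x A B : acod B = adom A ->
  atens (aid x) (acomp A B) = acomp (atens (aid x) A) (atens (aid x) B).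
Proof. by move=> AB; rewrite -atens_comp // a1comp. Qed.

Lemma atens_idr x A B : acod B = adom A ->
  atens (acomp A B) (aid x) = acomp (atens A (aid x)) (atens B (aid x)).
Proof. by move=> AB; rewrite -atens_comp // a1comp. Qed.

Lemma atens_lr A B a b : adom A = a -> acod B = b ->
  acomp (atens A (aid b)) (atens (aid a) B) = atens A B.
Proof. by move=> <- <-; rewrite -atens_comp // a1comp // acomp1. Qed.

Lemma atens_rl A B a b : acod A = a -> adom B = b ->
  acomp (atens (aid a) B) (atens A (aid b)) = atens A B.
Proof. by move=> <- <-; rewrite -atens_comp // a1comp // acomp1. Qed.

(** Inductive step of [asig_pull]: a factor [x] is put in front of both words. [Q] and [R] stand for
    the symmetries with and without the factor [j]. *)
Lemma asig_pull_step (x j t1 t2 s s' : W) Q R :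
  acod Q = tenso t1 (tenso j t2) ->
  adom R = tenso s s' -> acod R = tenso t1 t2 ->
  acomp (atens (abraid t1 j) (aid t2)) Q =
  acomp (atens (aid j) R) (atens (abraid s j) (aid s')) ->
  acomp (atens (abraid (tenso x t1) j) (aid t2)) (atens (aid x) Q) =
  acomp (atens (aid (tenso j x)) R) (atens (abraid (tenso x s) j) (aid s')).
Proof.
move=> cQ dR cR e.
rewrite abraid_tensl atens_idr /= ?tensoA // -acompA -(atensA (aid x)).
rewrite -atens_idl /= ?cQ ?tensoA // e atens_idl /= ?dR ?tensoA // acompA.
rewrite -atensA atens_id (atensA (aid x)) atens_id atens_lr //.
rewrite -(atens_rl (a := tenso j x) (b := tenso s s')) // -acompA; congr acomp.
rewrite -atens_id !atensA -atens_idr /= ?tensoA // abraid_tensl.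
by [].
Qed.

(** On the left [x] and [j] cross twice; naturality brings the two crossings together and [abraidK]
    cancels them. *)
Lemma abraid_swap3 (x s j : W) :
  acomp (abraid (tenso x s) j) (abraid (tenso s j) x) =
  acomp (atens (aid j) (abraid s x)) (atens (abraid s j) (aid x)).
Proof.
rewrite -abraid_tensr !abraid_tensl -acompA [X in acomp _ X]acompA -abraid_tensr.
have := abraid_nat (aid s) (abraid x j); rewrite /= => e.
by rewrite acompA -e -acompA -atens_idl // abraidK atens_id acomp1 //= tensoA.
Qed.

(** The same cancellation with a further factor [p], as it occurs in [asig_pull] when the head of
    the target word stands to the right of [j]. *)
Lemma abraid_swap (x s j p : W) :
  acomp (atens (abraid (tenso x s) j) (aid p)) (abraid (tenso s (tenso j p)) x) =
  acomp (atens (aid j) (abraid (tenso s p) x))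
        (atens (abraid s j) (aid (tenso p x))).
Proof.
rewrite tensoA 2!(abraid_tensl _ p) atens_idl /= ?tensoA //.
rewrite acompA -atens_idr /= ?tensoA // abraid_swap3 atens_idr /= ?tensoA //.
rewrite -!acompA -!atensA atens_id; congr acomp.
rewrite (atensA (aid j)) atens_id atens_rl /= ?tensoA //.
by rewrite -(atens_id s j) -atensA (atensA (aid s)) atens_id atens_lr /= ?tensoA.
Qed.

Section Coherence.
Variable a : nat -> W.

Definition tobj (s : seq nat) : W := foldr (fun j => tenso (a j)) unito s.

Lemma tobj_cat s t : tobj (s ++ t) = tenso (tobj s) (tobj t).
Proof. by elim: s => [|j s IH] /=; rewrite ?tenso1l // IH tensoA. Qed.

(* The symmetry from the tensor product along s to the one along t. It is meaningful
   when s is duplicate-free and t is a permutation of s. *)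
Fixpoint asig (s t : seq nat) : arrow :=
  if t is j :: t' then
    acomp (atens (aid (a j)) (asig (rem j s) t'))
          (atens (abraid (tobj (take (index j s) s)) (a j))
                 (aid (tobj (drop (index j s).+1 s))))
  else aid unito.

Lemma rem_split j (s1 s2 : seq nat) : j \notin s1 -> rem j (s1 ++ j :: s2) = s1 ++ s2.
Proof.
elim: s1 => [|x s1 IH] /=; first by rewrite eqxx.
by rewrite inE negb_or eq_sym => /andP[/negPf -> /IH ->].
Qed.

Lemma asig_split s1 j s2 t : j \notin s1 -> asig (s1 ++ j :: s2) (j :: t) =
  acomp (atens (aid (a j)) (asig (s1 ++ s2) t))
        (atens (abraid (tobj s1) (a j)) (aid (tobj s2))).
Proof.
move=> js1 /=; rewrite rem_split //.
have -> : index j (s1 ++ j :: s2) = size s1.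
  by rewrite index_cat (negPf js1) /= eqxx addn0.
by rewrite take_size_cat // -cat1s catA drop_size_cat // size_cat addn1.
Qed.

Lemma perm_cons_split (j : nat) (t s : seq nat) : perm_eq s (j :: t) -> uniq s ->
  exists s1 s2 : seq nat, [/\ s = s1 ++ j :: s2, j \notin s1, j \notin s2,
                    uniq (s1 ++ s2) & perm_eq (s1 ++ s2) t].
Proof.
move=> st us; have js : j \in s by rewrite (perm_mem st) mem_head.
case/splitPr: js st us => s1 s2 st us; exists s1, s2.
move: us; rewrite -cat1s uniq_catCA /= mem_cat negb_or -andbA => /and3P[j1 j2 us].
by split => //; rewrite -(perm_cons j) -(permPr st) -cat1s perm_catCA.
Qed.

Lemma adom_asig s t : perm_eq s t -> uniq s -> adom (asig s t) = tobj s.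
Proof.
case: t => [|j t] st us; first by move/perm_nilP: st => ->.
have [s1 [s2 [-> j1 _ _ _]]] := perm_cons_split st us.
by rewrite asig_split //= tobj_cat /= tensoA.
Qed.

Lemma acod_asig s t : acod (asig s t) = tobj t.
Proof. by elim: t s => //= j t IH s; rewrite IH. Qed.

Lemma asig_id s : asig s s = aid (tobj s).
Proof.
elim: s => // j s IH; rewrite (asig_split (s1 := [::])) //= IH.
have -> : abraid unito (a j) = aid (a j).
  have := abraidK (a j) unito; rewrite abraid_unitr acomp1 ?tenso1r //=.
  by rewrite tenso1l.
by rewrite !atens_id a1comp.
Qed.

Lemma asig_tens s t s' t' : perm_eq s t -> uniq s ->
  uniq (s ++ s') -> perm_eq s' t' ->
  asig (s ++ s') (t ++ t') = atens (asig s t) (asig s' t').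
Proof.
move=> + + + st'; elim: t s => [|j t IH] s.
  by move=> /perm_nilP -> _ _; rewrite atens1l.
move=> st us uss; have [s1 [s2 [es j1 j2 us' st2]]] := perm_cons_split st us.
have uss' : uniq ((s1 ++ s2) ++ s').
  apply: subseq_uniq uss; rewrite es -!catA.
  by apply: cat_subseq => //; apply: subseq_cons.
rewrite es -catA !cat_cons !asig_split // catA IH //.
rewrite atensA -[asig s' t' in RHS](acomp1 (a := tobj s')); last first.
  by apply: adom_asig => //; move: uss; rewrite cat_uniq => /and3P[].
rewrite atens_comp.
- by rewrite tobj_cat -atens_id atensA.
- rewrite /= adom_asig // tobj_cat tensoA.
  by [].
- rewrite /= adom_asig //; move: uss; rewrite cat_uniq => /and3P[] //.
Qed.

(* Induction on t1, according to the side of j on which the head of t1 lies in s. *)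
Lemma asig_pull s1 s2 t1 t2 j :
  perm_eq (s1 ++ s2) (t1 ++ t2) -> uniq (s1 ++ j :: s2) ->
  acomp (atens (abraid (tobj t1) (a j)) (aid (tobj t2)))
        (asig (s1 ++ j :: s2) (t1 ++ j :: t2)) =
  acomp (atens (aid (a j)) (asig (s1 ++ s2) (t1 ++ t2)))
        (atens (abraid (tobj s1) (a j)) (aid (tobj s2))).
Proof.
elim: t1 s1 s2 => [|x t1 IH] s1 s2 st us.
  have j1 : j \notin s1.
    by move: us; rewrite -cat1s uniq_catCA /= mem_cat negb_or => /andP[/andP[]].
  rewrite [X in acomp _ X](asig_split _ _ j1) /= abraid_unitl atens_id a1comp //=.
  by rewrite acod_asig.
have us12 : uniq (s1 ++ s2).
  by move: us; rewrite -cat1s uniq_catCA /= => /andP[].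
have split_s u1 u2 : s1 ++ s2 = u1 ++ x :: u2 ->
    [/\ x \notin u1, uniq (u1 ++ u2) & perm_eq (u1 ++ u2) (t1 ++ t2)].
  move=> es; move: us12 st; rewrite es -cat1s uniq_catCA cat1s cons_uniq.
  by rewrite mem_cat negb_or -andbA perm_catCA perm_cons => /and3P[].
have step u1 u2 s s' : s1 ++ s2 = u1 ++ x :: u2 -> s ++ s' = u1 ++ u2 ->
    uniq (s ++ j :: s') ->
    acomp (atens (abraid (tenso (a x) (tobj t1)) (a j)) (aid (tobj t2)))
          (atens (aid (a x)) (asig (s ++ j :: s') (t1 ++ j :: t2))) =
    acomp (atens (aid (tenso (a j) (a x))) (asig (u1 ++ u2) (t1 ++ t2)))
          (atens (abraid (tenso (a x) (tobj s)) (a j)) (aid (tobj s'))).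
  move=> /split_s[x1 us' st'] e us2; apply: asig_pull_step.
  - by rewrite acod_asig tobj_cat.
  - by rewrite adom_asig // -e tobj_cat.
  - by rewrite acod_asig tobj_cat.
  - by rewrite -e; apply: IH; rewrite // e.
have RHSE u1 u2 : s1 ++ s2 = u1 ++ x :: u2 ->
    acomp (atens (aid (a j)) (asig (s1 ++ s2) (x :: t1 ++ t2)))
      (atens (abraid (tobj s1) (a j)) (aid (tobj s2))) =
    acomp (atens (aid (tenso (a j) (a x))) (asig (u1 ++ u2) (t1 ++ t2)))
      (acomp (atens (aid (a j)) (atens (abraid (tobj u1) (a x)) (aid (tobj u2))))
        (atens (abraid (tobj s1) (a j)) (aid (tobj s2)))).
  move=> es; have [x1 us' st'] := split_s _ _ es.
  rewrite es asig_split // atens_idl; last by rewrite /= adom_asig // tobj_cat tensoA.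
  by rewrite atensA atens_id -acompA.
have : x \in s1 ++ s2 by rewrite (perm_mem st) mem_head.
rewrite !cat_cons mem_cat => /orP[] xs.
  case/splitPr: xs RHSE step split_s us => p q RHSE step split_s us.
  have es : (p ++ x :: q) ++ s2 = p ++ x :: (q ++ s2) by rewrite -catA.
  have [x1 us' st'] := split_s _ _ es.
  rewrite (RHSE _ _ es) -catA cat_cons asig_split // acompA catA.
  rewrite (step _ _ (p ++ q) s2 es) ?catA //; last first.
    by move: us; rewrite -catA cat_cons -cat1s uniq_catCA cat1s cons_uniq catA => /andP[].
  rewrite -acompA; congr acomp.
  (* [x] stands to the left of [j]: by naturality, moving [x] to the front commutes with carrying
     [j] across all of [s1]. *)
  have := abraid_nat (atens (abraid (tobj p) (a x)) (aid (tobj q))) (aid (a j)).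
  move/(congr1 (atens^~ (aid (tobj s2)))); rewrite !atens_idr /= ?tensoA //.
  rewrite !tobj_cat /= -!atensA !atens_id !tensoA => ->.
  done.
case/splitPr: xs RHSE step split_s us => p q RHSE step split_s us.
have es : s1 ++ p ++ x :: q = (s1 ++ p) ++ x :: q by rewrite -catA.
have [x1 us' st'] := split_s _ _ es.
rewrite (RHSE _ _ es) -cat_cons catA asig_split; last first.
  move: us; rewrite -cat_cons catA uniq_catC cat_cons.
  by rewrite cons_uniq mem_cat negb_or => /andP[/andP[]].
rewrite -catA cat_cons acompA (step _ _ s1 (p ++ q) es) ?catA //; last first.
  move: us; rewrite -cat_cons catA uniq_catC cat_cons cons_uniq => /andP[_].
  by rewrite uniq_catC -catA.
rewrite -acompA; congr acomp.
(* [x] stands to the right of [j]: here the two factors cross twice, and the crossings cancel. *)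
have /(congr1 (atens^~ (aid (tobj q)))) := abraid_swap (a x) (tobj s1) (a j) (tobj p).
rewrite !atens_idr /= ?tensoA // !tobj_cat /= -!atensA !atens_id !tensoA => ->.
done.
Qed.

(** Coherence: [asig_pull] carries the extraction of the head of [u] across [asig s t], which leaves
    the same claim for words without that letter. *)
Lemma asig_comp s t u : uniq s -> perm_eq s t -> perm_eq t u ->
  acomp (asig t u) (asig s t) = asig s u.
Proof.
elim: u s t => [|j u IH] s t us st tu.
  by move: st; rewrite (perm_nilP tu) => st; rewrite (perm_nilP st) /= a1comp.
have ut : uniq t by rewrite -(perm_uniq st).
have [t1 [t2 [et j1 j2 ut' tu']]] := perm_cons_split tu ut.
have [s1 [s2 [es k1 k2 us' su']]] := perm_cons_split (perm_trans st tu) us.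
have st' : perm_eq (s1 ++ s2) (t1 ++ t2) by rewrite (permPl su') perm_sym.
rewrite et es !asig_split // -acompA asig_pull //; last by rewrite -es.
rewrite acompA -atens_idl ?IH //.
by rewrite acod_asig adom_asig.
Qed.

Lemma asig_braid s t : uniq (s ++ t) ->
  asig (s ++ t) (t ++ s) = abraid (tobj s) (tobj t).
Proof.
elim: t s => [|j t IH] s ust; first by rewrite cats0 asig_id abraid_unitr.
move: (ust); rewrite -cat1s uniq_catCA cat1s cons_uniq mem_cat negb_or => /andP[/andP[js jt] u].
by rewrite cat_cons asig_split // IH // [RHS]abraid_tensr.
Qed.
End Coherence.

Fixpoint atens_fam (s : seq nat) (f : nat -> arrow) : arrow :=
  if s is j :: s' then atens (f j) (atens_fam s' f) else aid unito.

Lemma adom_atens_fam s f : adom (atens_fam s f) = tobj (fun j => adom (f j)) s.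
Proof. by elim: s => //= j s ->. Qed.

Lemma acod_atens_fam s f : acod (atens_fam s f) = tobj (fun j => acod (f j)) s.
Proof. by elim: s => //= j s ->. Qed.

Lemma atens_fam_cat s t f : atens_fam (s ++ t) f = atens (atens_fam s f) (atens_fam t f).
Proof. by elim: s => [|j s IH] /=; rewrite ?atens1l // IH atensA. Qed.

Lemma asig_nat s t f : uniq s -> perm_eq s t ->
  acomp (asig (fun j => acod (f j)) s t) (atens_fam s f) =
  acomp (atens_fam t f) (asig (fun j => adom (f j)) s t).
Proof.
elim: t s => [|j t IH] s us st; first by move: (perm_nilP st) => ->.
have [s1 [s2 [es j1 j2 us' st']]] := perm_cons_split st us.
rewrite es !asig_split // atens_fam_cat /=.
rewrite -acompA atensA -atens_comp; last 2 first.
- by rewrite /= acod_atens_fam.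
- by rewrite /= acod_atens_fam.
rewrite -acod_atens_fam abraid_nat (a1comp (acod_atens_fam _ _)).
rewrite -{1}(acomp1 (erefl (adom (atens_fam s2 f)))) atens_comp //.
rewrite -atensA -atens_fam_cat acompA -atens_comp //; last first.
  by rewrite acod_atens_fam adom_asig.
rewrite IH // a1comp // -[X in atens X _](acomp1 (erefl (adom (f j)))) atens_comp //; last first.
  by rewrite acod_asig adom_atens_fam.
by rewrite -acompA !adom_atens_fam.
Qed.

(** Moving the block [L j] to the front is a symmetry of single letters by [asig_braid], so
    [asig_comp] merges it with the symmetry of the remaining blocks. *)
Lemma asig_flatten (M : W) (L : nat -> seq nat) s t :
  uniq (flatten (map L s)) -> uniq s -> perm_eq s t ->
  asig (fun j => tobj (fun=> M) (L j)) s t =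
  asig (fun=> M) (flatten (map L s)) (flatten (map L t)).
Proof.
have tE r : tobj (fun j => tobj (fun=> M) (L j)) r = tobj (fun=> M) (flatten (map L r)).
  by elim: r => //= j r ->; rewrite tobj_cat.
elim: t s => [|j t IH] s uL us st; first by move: (perm_nilP st) => ->.
have [s1 [s2 [es j1 j2 us' st']]] := perm_cons_split st us.
move: uL; rewrite es !map_cat !map_cons flatten_cat ![flatten (_ :: _)]/=; set A := flatten _; set B := flatten _.
move=> uL.
have uL' : uniq (L j ++ (A ++ B)) by rewrite uniq_catCA.
have uAB : uniq (A ++ B) by move: uL'; rewrite cat_uniq => /and3P[].
have pAB : perm_eq (A ++ B) (flatten (map L t)).
  by rewrite -flatten_cat -map_cat; apply/perm_flatten/perm_map.
have uj : uniq (L j) by move: uL'; rewrite cat_uniq => /and3P[].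
rewrite asig_split // IH //; last by rewrite map_cat flatten_cat.
rewrite !tE map_cat flatten_cat -/A -/B -asig_id -(asig_id _ B) -asig_braid; last first.
  by apply: subseq_uniq uL; rewrite catA prefix_subseq.
rewrite -!asig_tens //; last by rewrite -catA.
rewrite -!catA asig_comp //; first by rewrite perm_catCA.
- by rewrite perm_cat2l.
- by rewrite perm_catC.
- by apply: subseq_uniq uL; rewrite catA prefix_subseq.
Qed.

Lemma asig_map (M : W) (h : nat -> nat) s t : uniq s -> perm_eq s t ->
  {in s &, injective h} ->
  asig (fun=> M) (map h s) (map h t) = asig (fun=> M) s t.
Proof.
have tE r : tobj (fun=> M) (map h r) = tobj (fun=> M) r by elim: r => //= j r ->.
elim: t s => [|j t IH] s us st hI; first by move: (perm_nilP st) => ->.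
have [s1 [s2 [es j1 j2 us' st']]] := perm_cons_split st us.
rewrite es map_cat !map_cons !asig_split //; last first.
  apply/mapP => -[k k1 /hI]; rewrite es !mem_cat !inE eqxx k1 orbT => /(_ isT isT) jk.
  by rewrite jk k1 in j1.
rewrite !tE -map_cat IH // => x y; rewrite !mem_cat => xs ys; apply: hI.
  by rewrite es mem_cat inE; case/orP: xs => ->; rewrite ?orbT.
by rewrite es mem_cat inE; case/orP: ys => ->; rewrite ?orbT.
Qed.
End Arrows.

(** * Evaluation of forests of trees *)

Section Permute.
Variable V : symcat_pt.
Notation M := (mon V).

Lemma tobj_const s : tobj (fun=> M) s = mpow V (size s).
Proof. by elim: s => //= _ s ->. Qed.

Lemma mpowD m n : mpow V (m + n) = tenso (mpow V m) (mpow V n).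
Proof. by elim: m => [|m IH] /=; rewrite ?tenso1l // -tensoA -IH. Qed.

(** The adjacent transpositions in [pull] assemble, by the second hexagon, into one symmetry past
    [j] factors. *)
Lemma Arr_pull n j : (j <= n)%N ->
  Arr (pull V n j) = atens (abraid (mpow V j) M) (aid (mpow V (n - j))).
Proof.
elim: n j => [|n IH] [|j] //= jn.
- by rewrite abraid_unitl atens_id.
- by rewrite abraid_unitl atens_id.
rewrite -acompE Arr_hcast -[Arr (tensm (idm M) _)]/(atens (aid M) (Arr (pull V n j))).
rewrite -[Arr (tensm (braid M M) _)]/(atens (abraid M M) (aid (mpow V n))).
rewrite IH // subSS abraid_tensl atens_idr /= ?tensoA // -!atensA; congr acomp.
rewrite atens_id; congr (atens _ (aid _)).
by rewrite -mpowD subnKC.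
Qed.

(** [permute] works with positions, which [unbump] renumbers each time a factor is extracted; [asig]
    works with letters, which keep their names. *)
Lemma Arr_permute n s t : uniq s -> perm_eq s t -> size s = n ->
  Arr (permute V n (map (index^~ s) t)) = asig (fun=> M) s t.
Proof.
elim: n s t => [|n IH] s t us st sz.
  move: (size0nil sz) st us => -> /[1!perm_sym] /perm_nilP -> _ //.
case: t st => [|j t] st; first by move: (perm_nilP st) sz => ->.
have [s1 [s2 [es j1 j2 us' st']]] := perm_cons_split st us.
have sz' : n = (size s1 + size s2)%N.
  by move: sz; rewrite es size_cat /= addnS => -[].
rewrite es asig_split // [permute _ _ _]/= -acompE.
have -> : index j (s1 ++ j :: s2) = size s1.
  by rewrite index_cat (negPf j1) /= eqxx addn0.
rewrite Arr_pull ?sz' ?leq_addr // addKn !tobj_const; congr acomp.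
rewrite -[Arr (tensm _ _)]/(atens (aid M) (Arr (permute V _ _))).
congr atens; rewrite -sz' -(IH (s1 ++ s2)) ?size_cat //; congr (Arr (permute _ _ _)).
rewrite -map_comp; apply/eq_in_map => x xt /=.
rewrite !index_cat; case: ifP => xs1.
  by rewrite /unbump ltnNge ltnW ?index_mem // subn0.
rewrite /= [j == x]eq_sym ifN; last first.
  apply: contraNneq j2 => <-; move: xt; rewrite -(perm_mem st') mem_cat xs1 //.
by rewrite /unbump addnS ltnS leq_addr subn1.
Qed.

Definition amul (A B : arrow V) := acomp (Arr (mon_mul V)) (atens A B).
Definition amul_seq (As : seq (arrow V)) := foldr amul (Arr (mon_one V)) As.
Definition atens_seq (As : seq (arrow V)) := foldr (@atens V) (aid unito) As.

Lemma acod_amul_seq As : acod (amul_seq As) = M. Proof. by case: As. Qed.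

Lemma amul_comp A B A' B' : acod B = adom A -> acod B' = adom A' ->
  amul (acomp A B) (acomp A' B') = acomp (amul A A') (atens B B').
Proof. by move=> e e'; rewrite /amul atens_comp // acompA. Qed.

Lemma amulA A B C : acod A = M -> acod B = M -> acod C = M ->
  amul A (amul B C) = amul (amul A B) C.
Proof.
move=> cA cB cC; rewrite /amul.
rewrite -{1}(a1comp cA) atens_comp //; last by rewrite /= cB cC.
rewrite -[in RHS](a1comp cC) atens_comp //; last by rewrite /= cA cB.
rewrite !acompA atensA; congr acomp.
by have /(congr1 (@Arr _ _ _)) := mon_mulA V; rewrite Arr_hcast -!acompE.
Qed.

Lemma amul1l A : acod A = M -> amul (Arr (mon_one V)) A = A.
Proof.
move=> cA; rewrite /amul -[in LHS](a1comp cA).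
rewrite -[Arr (mon_one V)](acomp1 (erefl _)) /= atens_comp // atens1l acompA.
have /(congr1 (@Arr _ _ _)) := mon_mul1l V; rewrite Arr_hcast -acompE => e.
by rewrite [acomp (Arr (mon_mul V)) _]e a1comp.
Qed.

Lemma amul1r A : acod A = M -> amul A (Arr (mon_one V)) = A.
Proof.
move=> cA; rewrite /amul -[in LHS](a1comp cA).
rewrite -[Arr (mon_one V)](acomp1 (erefl _)) /= atens_comp // atens1r acompA.
have /(congr1 (@Arr _ _ _)) := mon_mul1r V; rewrite Arr_hcast -acompE => e.
by rewrite [acomp (Arr (mon_mul V)) _]e a1comp.
Qed.

(** Indices out of range yield [aid M], which has codomain [M], so the condition concerns the
    entries of [As] alone. *)
Definition codM (As : seq (arrow V)) := forall i, acod (nth (aid M) As i) = M.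

Lemma codM_cons A As : codM (A :: As) <-> acod A = M /\ codM As.
Proof.
split=> [c|[cA c] [|i]] //; last exact: c.
by split=> [|i]; [apply: (c 0%N) | apply: (c i.+1)].
Qed.

Lemma amul_seq_cat As Bs : codM As -> amul_seq (As ++ Bs) = amul (amul_seq As) (amul_seq Bs).
Proof.
elim: As => [_|A As IH /codM_cons[cA cAs]] /=; first by rewrite amul1l // acod_amul_seq.
by rewrite IH // amulA // acod_amul_seq.
Qed.

Lemma atens_seq_cat As Bs : atens_seq (As ++ Bs) = atens (atens_seq As) (atens_seq Bs).
Proof. by elim: As => [|A As IH] /=; rewrite ?atens1l // IH atensA. Qed.

Lemma iter_mulE n As : codM As -> size As = n ->
  acomp (Arr (iter_mul V n)) (atens_seq As) = amul_seq As.
Proof.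
move=> + <-; elim: As => [_|A As IH /codM_cons[cA cAs]] /=; first by rewrite acomp1.
rewrite -acompE -acompA -IH // /amul.
rewrite -[Arr (tensm _ _)]/(atens (aid M) (Arr (iter_mul V (size As)))).
rewrite -atens_comp ?a1comp //=.
by elim: As cAs {IH} => //= B As IH /codM_cons[-> /IH ->].
Qed.
End Permute.

Section Sub.
Implicit Types (h k : nat -> rtree) (t : rtree) (ts : seq rtree).

(** Substitution and reduction in one pass: [mk_black] merges the black vertices and drops the units
    that meet a black vertex after substitution. *)
Fixpoint tsubst h t :=
  match t with
  | Leg j => h j
  | White i ts => White i (map (tsubst h) ts)
  | Black ts => mk_black (map (tsubst h) ts)
  | Special => Special
  end.

Lemma legs_tsubst h t : legs (tsubst h t) = flatten [seq legs (h j) | j <- legs t].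
Proof.
elim/rtree_mem_ind: t => //= [j|i ts IH|ts IH]; rewrite ?cats0 //.
  by rewrite -map_comp -flatten_flatten; congr flatten; apply/eq_in_map.
rewrite (@mk_blackE _ legs) // -map_comp -flatten_flatten; congr flatten; exact/eq_in_map.
Qed.

Definition legsf ts := flatten (map legs ts).

Lemma legsf_tsubst h ts : legsf (map (tsubst h) ts) = flatten [seq legs (h j) | j <- legsf ts].
Proof.
by rewrite /legsf -map_comp -flatten_flatten; congr flatten; apply: eq_map => t; rewrite /= legs_tsubst.
Qed.

Lemma legsf_Leg (s : seq nat) : legsf (map Leg s) = s.
Proof. by rewrite /legsf -map_comp flatten_seq1. Qed.

Lemma legsf_cons t ts : legsf (t :: ts) = legs t ++ legsf ts. Proof. by []. Qed.
End Sub.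

Section Eval.
Variable V : symcat_pt.
Notation M := (mon V).
Variable phi : forall i p : nat, opn V p.

(** [phi] depends on label and arity because in a forest one label may occur at vertices of several
    arities. Legs are read in planar order, so no symmetry enters yet. *)
Fixpoint aeval (t : rtree) : arrow V :=
  match t with
  | Leg _ => aid M
  | White i ts => acomp (Arr (phi i (size ts))) (atens_seq (map aeval ts))
  | Black ts => amul_seq (map aeval ts)
  | Special => Arr (mon_one V)
  end.
Definition aeval_forest ts := atens_seq (map aeval ts).

Lemma acod_aeval t : acod (aeval t) = M.
Proof. by case: t => //= ts; rewrite acod_amul_seq. Qed.

Lemma acod_aeval_forest ts : acod (aeval_forest ts) = mpow V (size ts).
Proof. by elim: ts => //= t ts IH; rewrite /aeval_forest /= acod_aeval -IH. Qed.

Lemma adom_aforest_in ts :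
  {in ts, forall t, adom (aeval t) = mpow V (size (legs t))} ->
  adom (aeval_forest ts) = mpow V (size (legsf ts)).
Proof.
elim: ts => //= t ts IH dt; rewrite size_cat /aeval_forest /= dt ?mem_head //.
rewrite [adom _]IH => [|u us]; last by rewrite dt // inE us orbT.
by rewrite mpowD.
Qed.

Lemma adom_aeval t : adom (aeval t) = mpow V (size (legs t)).
Proof.
elim/rtree_mem_ind: t => //= [_|i ts|ts IH]; first by rewrite tenso1r.
  exact: adom_aforest_in.
rewrite -[RHS]adom_aforest_in // /aeval_forest.
by elim: (ts) => //= t us ->.
Qed.

Lemma adom_aeval_forest ts : adom (aeval_forest ts) = mpow V (size (legsf ts)).
Proof. by apply: adom_aforest_in => t _; apply: adom_aeval. Qed.

Lemma codM_aeval ts : codM (map aeval ts).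
Proof.
move=> i; case: (ltnP i (size ts)) => it; last by rewrite nth_default ?size_map.
by rewrite (nth_map Special) // acod_aeval.
Qed.

Lemma aeval_forest_cat ts us : aeval_forest (ts ++ us) = atens (aeval_forest ts) (aeval_forest us).
Proof. by rewrite /aeval_forest map_cat atens_seq_cat. Qed.

(** Reduction does not change the value: contracting an edge between black vertices is associativity
    in [M], and removing a special vertex is unitality. *)
Lemma aeval_mk_black ts : aeval (mk_black ts) = amul_seq (map aeval ts).
Proof.
have -> : amul_seq (map aeval ts) = amul_seq (map aeval (flatten (map black_inputs ts))).
  elim: ts => //= t ts IH; rewrite map_cat amul_seq_cat ?IH; last exact: codM_aeval.
  by congr amul; case: t => //= *; rewrite amul1r ?acod_aeval.
rewrite /mk_black; case: flatten => [|t [|u us]] //=.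
by rewrite amul1r ?acod_aeval.
Qed.

(** In planar order substitution is composition without any symmetry, for an arbitrary family [h]
    and even with repeated legs. *)
Lemma aeval_tsubst h t : aeval (tsubst h t) = acomp (aeval t) (aeval_forest (map h (legs t))).
Proof.
elim/rtree_mem_ind: t => /= [j|i ts IH|ts IH|].
- by rewrite /aeval_forest /= atens1r a1comp ?acod_aeval.
- rewrite size_map -acompA; congr acomp; rewrite -map_comp.
  elim: ts IH => [|t ts IHts] IH; first by rewrite a1comp.
  rewrite [in RHS]/= map_cat aeval_forest_cat -atens_comp /=; last 2 first.
  + by rewrite acod_aeval_forest adom_aeval size_map.
  + by rewrite acod_aeval_forest -/(aeval_forest ts) adom_aeval_forest size_map.
  by rewrite IH ?mem_head // IHts // => u us; apply: IH; rewrite inE us orbT.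
- rewrite aeval_mk_black -map_comp.
  elim: ts IH => [|t ts IHts] IH; first by rewrite acomp1.
  rewrite [in RHS]/= map_cat aeval_forest_cat -amul_comp /=; last 2 first.
  + by rewrite acod_aeval_forest adom_aeval size_map.
  + rewrite acod_aeval_forest size_map; have := adom_aeval (Black ts); rewrite /= => ->.
    by [].
  by rewrite IH ?mem_head // IHts // => u us; apply: IH; rewrite inE us orbT.
- by rewrite acomp1.
Qed.

Lemma aeval_forest_tsubst h ts :
  aeval_forest (map (tsubst h) ts) = acomp (aeval_forest ts) (aeval_forest (map h (legsf ts))).
Proof.
elim: ts => [|t ts IH]; first by rewrite a1comp.
rewrite legsf_cons map_cat aeval_forest_cat -atens_comp -?aeval_tsubst -?IH //=.
  by rewrite acod_aeval_forest adom_aeval size_map.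
by rewrite acod_aeval_forest -/(aeval_forest ts) adom_aeval_forest size_map.
Qed.

Definition aeval_at m ts := acomp (aeval_forest ts) (asig (fun=> M) (iota 0 m) (legsf ts)).

(** Functoriality of evaluation: the symmetry of [g] passes through the values of the trees of [f]
    by naturality, becomes a symmetry of blocks of legs, hence of legs, and merges with the symmetry
    of [f]. *)
Lemma aeval_at_comp m n g f : perm_eq (legsf g) (iota 0 n) -> size f = n ->
  perm_eq (legsf f) (iota 0 m) ->
  acomp (aeval_at n g) (aeval_at m f) = aeval_at m (map (tsubst (nth Special f)) g).
Proof.
move=> gn fn fm; rewrite /aeval_at.
have fE : f = map (nth Special f) (iota 0 n).
  by rewrite -fn -/(mkseq _ _) mkseq_nth.
set e := fun j => aeval (nth Special f j).
have fforE s : aeval_forest (map (nth Special f) s) = atens_fam s e.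
  by elim: s => //= j s <-.
have ecod : (fun=> M) = (fun j => acod (e j)) by apply/funext => j; rewrite acod_aeval.
have edom : (fun j => adom (e j)) = (fun j => tobj (fun=> M) (legs (nth Special f j))).
  by apply/funext => j; rewrite adom_aeval tobj_const.
rewrite -acompA [X in acomp _ X]acompA {1}fE fforE {1}ecod.
have fmu : uniq (legsf f) by rewrite (perm_uniq fm) iota_uniq.
have feq : flatten [seq legs (nth Special f i) | i <- iota 0 n] = legsf f.
  by rewrite /legsf {2}fE -map_comp.
rewrite asig_nat ?iota_uniq 1?perm_sym // edom asig_flatten ?iota_uniq //; last 2 first.
- by rewrite feq.
- by rewrite perm_sym.
rewrite feq -acompA asig_comp ?iota_uniq //; last 2 first.
- by rewrite perm_sym.
- by rewrite -feq; apply/perm_flatten/perm_map; rewrite perm_sym.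
by rewrite acompA -fforE -aeval_forest_tsubst legsf_tsubst.
Qed.

Lemma aeval_forest_Leg s : aeval_forest (map Leg s) = aid (mpow V (size s)).
Proof. by elim: s => //= j s IH; rewrite /aeval_forest /= -/(aeval_forest _) IH atens_id. Qed.

Lemma aeval_at_id m : aeval_at m (map Leg (iota 0 m)) = aid (mpow V m).
Proof.
by rewrite /aeval_at legsf_Leg asig_id aeval_forest_Leg size_iota tobj_const size_iota a1comp.
Qed.

Lemma aeval_at_tens m n f g : perm_eq (legsf f) (iota 0 m) -> perm_eq (legsf g) (iota 0 n) ->
  atens (aeval_at m f) (aeval_at n g) = aeval_at (m + n) (f ++ map (tsubst (fun j => Leg (m + j))) g).
Proof.
move=> fm gn; rewrite /aeval_at aeval_forest_cat aeval_forest_tsubst.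
have -> s : aeval_forest (map (fun j => Leg (m + j)) s) = aid (mpow V (size s)).
  by elim: s => //= j s IH; rewrite /aeval_forest /= -/(aeval_forest _) IH atens_id.
have -> : legsf (f ++ map (tsubst (fun j => Leg (m + j))) g) = legsf f ++ map (addn m) (legsf g).
  rewrite /legsf map_cat flatten_cat -!/(legsf _) legsf_tsubst; congr (_ ++ _).
  by elim: (legsf g) => //= j s ->.
rewrite acomp1 ?adom_aeval_forest // atens_comp; last 2 first.
- by rewrite acod_asig adom_aeval_forest tobj_const.
- by rewrite acod_asig adom_aeval_forest tobj_const.
have iotaE : iota (0 + m) n = map (addn m) (iota 0 n) by rewrite -iotaDl addn0.
congr acomp; rewrite iotaD asig_tens ?iota_uniq 1?perm_sym //; last 2 first.
- by rewrite -iotaD iota_uniq.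
- by rewrite iotaE perm_map // perm_sym.
rewrite iotaE asig_map ?iota_uniq 1?perm_sym //.
by move=> x y _ _ /addnI.
Qed.

Lemma aeval_at_braid m n : aeval_at (m + n) (map Leg (iota m n ++ iota 0 m)) = abraid (mpow V m) (mpow V n).
Proof.
rewrite /aeval_at legsf_Leg aeval_forest_Leg iotaD add0n asig_braid -?iotaD ?iota_uniq //.
by rewrite !tobj_const !size_iota a1comp //= -tobj_const tobj_cat !tobj_const !size_iota.
Qed.

Lemma aeval_at_corolla i p : aeval_at p [:: White i (map Leg (iota 0 p))] = Arr (phi i p).
Proof.
rewrite /aeval_at /aeval_forest /= atens1r size_map size_iota -/(aeval_forest _) -acompA.
have -> : legsf [:: White i (map Leg (iota 0 p))] = legsf (map Leg (iota 0 p)).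
  by rewrite /legsf /= cats0.
by rewrite -/(aeval_at _ _) aeval_at_id acomp1.
Qed.
End Eval.

Section TreeEval.
Variable V : symcat_pt.

Lemma Arr_recast p q (f : opn V p) : p = q -> Arr (recast q f) = Arr f.
Proof. by move=> e; rewrite (recastE e); case: q / e. Qed.

Lemma Arr_forest (ev : forall t, opn V (size (legs t))) ts :
  Arr (eval_forest ev ts) = atens_seq (map (fun t => Arr (ev t)) ts).
Proof. by elim: ts => //= t ts IH; rewrite Arr_hcast -IH. Qed.

Lemma Arr_planar ks (fs : inputs V ks) t : Arr (eval_planar fs t) = aeval (input fs) t.
Proof.
elim/rtree_mem_ind: t => //= [j|i ts IH|ts IH]; first by rewrite Arr_hcast.
  by rewrite -acompE Arr_forest; congr (acomp _ (atens_seq _)); apply/eq_in_map.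
rewrite -acompE Arr_forest.
have -> : [seq Arr (eval_planar fs t) | t <- ts] = map (aeval (input fs)) ts by apply/eq_in_map.
by rewrite iter_mulE ?size_map //; apply: codM_aeval.
Qed.

Lemma legs_tree l ks (t : tree l ks) : perm_eq (legs (val t)) (iota 0 l).
Proof. by case: t => t /= /and3P[]. Qed.

Lemma Arr_tree_eval l ks (t : tree l ks) (fs : inputs V ks) :
  Arr (tree_eval t fs) = aeval_at (input fs) l [:: val t].
Proof.
have pl := legs_tree t; have sl : size (legs (val t)) = l by rewrite (perm_size pl) size_iota.
rewrite /tree_eval -acompE Arr_recast // Arr_planar /aeval_at /aeval_forest /= atens1r.
(* A leg label is its own position in [iota 0 l], which gives the word the form required by
   [Arr_permute]. *)
rewrite [in permute _ _ _](_ : legs (sval t) = map (index^~ (iota 0 l)) (legs (val t))).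
  rewrite Arr_permute ?iota_uniq ?size_iota 1?perm_sym //.
  by rewrite /legsf /= cats0.
rewrite -[LHS]map_id; apply/eq_in_map => x.
rewrite (perm_mem pl) mem_iota /= add0n => xl.
by rewrite -{2}[x]add0n -(nth_iota 0 0 xl) index_uniq ?size_iota ?iota_uniq.
Qed.
End TreeEval.

(** * Substitution of trees and composition of forests *)

HB.instance Definition _ (K : choiceType) (M : lmodType int) (f : K -> M) :=
  GRing.isZmodMorphism.Build {freeg K} M (fglift f) (lift_is_additive f).

(** * Bilinear extension to free abelian groups *)

Section FreeAbelian.

Lemma freeg_ind (K : choiceType) (P : {freeg K} -> Prop) :
  P 0 -> (forall a, P << a >>) -> (forall x y, P x -> P y -> P (x - y)) ->
  forall x, P x.
Proof.
move=> P0 PU PB; have PN x : P x -> P (- x) by rewrite -sub0r; apply: PB.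
have PD x y : P x -> P y -> P (x + y) by move=> Px /PN; rewrite -{2}[y]opprK; apply: PB.
move=> x; rewrite -[x]freeg_sumE; elim/big_ind: _ => // a _.
have Pn n : P (<< a >> *+ n) by elim: n => [|n IH]; rewrite ?mulr0n // mulrS; apply: PD.
rewrite -[coeff a x]intz -freegU_mulz; case: (coeff a x) => n; first by rewrite -pmulrn.
by rewrite NegzE mulrNz -pmulrn; apply: PN.
Qed.

Lemma fgliftU (K : choiceType) (M : lmodType int) (f : K -> M) a : fglift f << a >> = f a.
Proof. by rewrite liftU scale1r. Qed.

Variables (A B C : choiceType) (op : A -> B -> C).

(** The body copies [opd_comp] of [tree_operad], so that one converts to the other. *)
Definition freeg_bilin (x : {freeg A}) (y : {freeg B}) : {freeg C} :=
  fglift (fun a => fglift (fun b => << op a b >>) y) x.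

Lemma fg2U a b : freeg_bilin << a >> << b >> = << op a b >>.
Proof. by rewrite /freeg_bilin !fgliftU. Qed.
Lemma fg20l y : freeg_bilin 0 y = 0. Proof. exact: raddf0. Qed.
Lemma fg2Bl x x' y : freeg_bilin (x - x') y = freeg_bilin x y - freeg_bilin x' y. Proof. exact: raddfB. Qed.
Lemma fg2Dl x x' y : freeg_bilin (x + x') y = freeg_bilin x y + freeg_bilin x' y. Proof. exact: raddfD. Qed.

Lemma fg20r x : freeg_bilin x 0 = 0.
Proof.
elim/freeg_ind: x => [|a|x y IHx IHy]; rewrite ?fg20l //; first by rewrite /freeg_bilin fgliftU raddf0.
by rewrite fg2Bl IHx IHy subr0.
Qed.

Lemma fg2Br x y y' : freeg_bilin x (y - y') = freeg_bilin x y - freeg_bilin x y'.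
Proof.
elim/freeg_ind: x => [|a|x x' IHx IHx']; rewrite ?fg20l ?subr0 //.
  by rewrite /freeg_bilin !fgliftU raddfB.
by rewrite !fg2Bl IHx IHx' !opprB addrACA [RHS]addrACA [X in _ + X = _]addrC.
Qed.

Lemma fg2Dr x y y' : freeg_bilin x (y + y') = freeg_bilin x y + freeg_bilin x y'.
Proof. by rewrite -{1}[y']opprK fg2Br -[- y']sub0r fg2Br fg20r sub0r opprK. Qed.
End FreeAbelian.

(** * Associativity and unit laws of substitution in reduced trees *)

Section SubLaws.
Implicit Types (h k : nat -> rtree) (t : rtree) (ts : seq rtree).

Lemma blackable_inputs ts : all reduced_tree ts ->
  all blackable (flatten (map black_inputs ts)) /\
  all reduced_tree (flatten (map black_inputs ts)).
Proof.
elim: ts => //= t ts IH /andP[redt /IH[bt rt]]; rewrite !all_cat bt rt !andbT.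
by case: t redt => //= [i us ->|us /and3P[_ -> ->]].
Qed.

Lemma black_inputs_blackable ts : all blackable ts ->
  flatten (map black_inputs ts) = ts.
Proof. by elim: ts => //= t ts IH /andP[bt /IH ->]; case: t bt. Qed.

Lemma black_inputs_mk_black ts : all reduced_tree ts ->
  black_inputs (mk_black ts) = flatten (map black_inputs ts).
Proof.
move=> /blackable_inputs[bl _]; rewrite /mk_black.
by case: flatten bl => [|t [|t' ts']] //=; case: t.
Qed.

Lemma mk_black_flat ts us :
  flatten (map black_inputs ts) = flatten (map black_inputs us) ->
  mk_black ts = mk_black us.
Proof. by rewrite /mk_black => ->. Qed.

Lemma mk_black1 t : reduced_tree t -> mk_black [:: t] = t.
Proof.
rewrite /mk_black /= cats0; case: t => //= ts /and3P[].
by case: ts => [|? [|? ?]].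
Qed.

Lemma mk_black_id ts : (1 < size ts)%N -> all blackable ts -> mk_black ts = Black ts.
Proof. by move=> + /black_inputs_blackable; rewrite /mk_black => + ->; case: ts => [|? []]. Qed.

Definition reduced_fam h := forall j, reduced_tree (h j).

Lemma red_nth ts : all reduced_tree ts -> reduced_fam (nth Special ts).
Proof.
move=> /allP r j; case: (ltnP j (size ts)) => jl; last by rewrite nth_default.
by apply: r; apply: mem_nth.
Qed.

Lemma reduced_tsubst h t : reduced_fam h -> reduced_tree (tsubst h t).
Proof.
move=> rh; elim/rtree_mem_ind: t => //= [i ts IH|ts IH]; last apply: reduced_mk_black.
  by rewrite all_map; apply/allP.
by rewrite all_map; apply/allP.
Qed.

Lemma all_reduced_tsubst h ts : reduced_fam h -> all reduced_tree (map (tsubst h) ts).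
Proof. by move=> rh; rewrite all_map; apply/allP => t _; apply: reduced_tsubst. Qed.

(** In a reduced tree the inputs of a black vertex are neither black nor special, so a single
    flattening exposes the same list of inputs before and after the substitution. *)
Lemma tsubst_mk_black h ts : reduced_fam h -> all reduced_tree ts ->
  tsubst h (mk_black ts) = mk_black (map (tsubst h) ts).
Proof.
move=> rh rts; have flat us : all reduced_tree us ->
    flatten (map black_inputs (map (tsubst h) us)) =
    flatten (map black_inputs (map (tsubst h) (flatten (map black_inputs us)))).
  elim: us => //= u us IH /andP[ru /IH ->]; rewrite !map_cat flatten_cat; congr (_ ++ _).
  case: u ru => //= *; rewrite ?cats0 // black_inputs_mk_black //.
  exact: all_reduced_tsubst.
rewrite (mk_black_flat (flat ts rts)) {1}/mk_black.
case: flatten => [|t [|t' ts']] //=.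
by rewrite mk_black1 //; apply: reduced_tsubst.
Qed.

Lemma tsubst_tsubst h k t : reduced_fam h -> reduced_fam k -> tsubst h (tsubst k t) = tsubst (fun j => tsubst h (k j)) t.
Proof.
move=> rh rk; elim/rtree_mem_ind: t => //= [i ts IH|ts IH].
  by rewrite -map_comp; congr White; apply/eq_in_map.
rewrite tsubst_mk_black //; last exact: all_reduced_tsubst.
by rewrite -map_comp; congr mk_black; apply/eq_in_map.
Qed.

Lemma tsubst_ext h k t : {in legs t, h =1 k} -> tsubst h t = tsubst k t.
Proof.
elim/rtree_mem_ind: t => //= [j|i ts IH|ts IH] hk; first by apply: hk; apply: mem_head.
  congr White; apply/eq_in_map => t ts_t; apply: IH => // j jt; apply: hk.
  by apply/flatten_mapP; exists t.
congr mk_black; apply/eq_in_map => t ts_t; apply: IH => // j jt; apply: hk.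
by apply/flatten_mapP; exists t.
Qed.

Lemma tsubst_Leg t : reduced_tree t -> tsubst Leg t = t.
Proof.
elim/rtree_mem_ind: t => //= [i ts IH /allP rts|ts IH /and3P[sts bts /allP rts]].
  by congr White; rewrite -[RHS]map_id; apply/eq_in_map => t tin; apply: IH; rewrite ?rts.
rewrite -[RHS]mk_black_id //; congr mk_black; rewrite -[RHS]map_id.
by apply/eq_in_map => t tin; apply: IH; rewrite ?rts.
Qed.

(** This puts reduction under the laws of substitution. *)
Lemma reduce_treeE t : reduce_tree t = tsubst Leg t.
Proof.
elim/rtree_mem_ind: t => //= [i ts IH|ts IH].
  by congr White; apply/eq_in_map.
by congr mk_black; apply/eq_in_map.
Qed.

Lemma nth_tsubst h ts j : nth Special (map (tsubst h) ts) j = tsubst h (nth Special ts j).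
Proof.
case: (ltnP j (size ts)) => jl; first by rewrite (nth_map Special).
by rewrite !nth_default ?size_map.
Qed.

(** Composition of trees reduces once at the end, composition of forests at each substitution; this
    reconciles the two, with no reducedness assumed. *)
Lemma reduce_plug cs t :
  reduce_tree (plug cs t) = tsubst (nth Special (map reduce_tree cs)) t.
Proof.
have -> : map reduce_tree cs = map (tsubst Leg) cs by apply: eq_map => u; apply: reduce_treeE.
rewrite reduce_treeE; elim/rtree_mem_ind: t => //= [j|i ts IH|ts IH].
- by rewrite nth_tsubst.
- by rewrite -map_comp; congr White; apply/eq_in_map.
- by rewrite -map_comp; congr mk_black; apply/eq_in_map.
Qed.
End SubLaws.

(** * The strict symmetric monoidal structure on forests *)

Section Forests.

(** No condition bears on white vertices: labels must be allowed to repeat, since composition and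
    juxtaposition join forests labelled independently. *)
Definition is_forest (m n : nat) (ts : seq rtree) : bool :=
  [&& size ts == n, perm_eq (legsf ts) (iota 0 m) & all reduced_tree ts].

Definition forest (m n : nat) := {ts : seq rtree | is_forest m n ts}.
HB.instance Definition _ m n := Countable.on (forest m n).

Definition fcompose (g f : seq rtree) := map (tsubst (nth Special f)) g.
Definition shleg m j := Leg (m + j).
Definition fjuxt m (f g : seq rtree) := f ++ map (tsubst (shleg m)) g.
Definition fswap m n := map Leg (iota m n ++ iota 0 m).

Lemma legsf_shleg m g : legsf (map (tsubst (shleg m)) g) = map (addn m) (legsf g).
Proof. by rewrite legsf_tsubst; elim: (legsf g) => //= j s ->. Qed.

Lemma fcomposeP b c (g : forest b c) a (f : forest a b) :
  is_forest a c (fcompose (val g) (val f)).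
Proof.
case: g f => [g /= /and3P[/eqP <- lg rg]] [f /= /and3P[/eqP sf lf rf]].
rewrite /is_forest size_map eqxx all_reduced_tsubst ?andbT /=; last exact: red_nth.
rewrite legsf_tsubst; apply: perm_trans lf.
apply: perm_trans (perm_flatten (perm_map _ lg)) _.
have {2}-> : f = map (nth Special f) (iota 0 b) by rewrite -sf -/(mkseq _ _) mkseq_nth.
by rewrite /legsf -map_comp.
Qed.

Lemma fjuxtP m n (f : forest m n) m' n' (g : forest m' n') :
  is_forest (m + m') (n + n') (fjuxt m (val f) (val g)).
Proof.
case: f g => [f /= /and3P[/eqP <- lf rf]] [g /= /and3P[/eqP <- lg rg]].
rewrite /is_forest size_cat size_map eqxx all_cat rf all_reduced_tsubst //= andbT.
rewrite /legsf map_cat flatten_cat -!/(legsf _) legsf_shleg iotaD perm_cat //.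
by rewrite add0n -[X in iota X](addn0 m) iotaDl perm_map.
Qed.

Lemma fidP m : is_forest m m (map Leg (iota 0 m)).
Proof. by rewrite /is_forest size_map size_iota eqxx legsf_Leg perm_refl /= all_map; apply/allP. Qed.

Lemma fswapP m n : is_forest (m + n) (n + m) (fswap m n).
Proof.
rewrite /is_forest size_map size_cat !size_iota eqxx legsf_Leg /= all_map.
rewrite perm_catC -{3}[m]add0n -iotaD perm_refl /=; exact/allP.
Qed.

Definition fcomp_for a b c (g : forest b c) (f : forest a b) : forest a c :=
  Sub _ (fcomposeP g f).
Definition fjuxt_for m n m' n' (f : forest m n) (g : forest m' n') :
  forest (m + m') (n + n') := Sub _ (fjuxtP f g).
Definition fid_for m : forest m m := Sub _ (fidP m).
Definition fswap_for m n : forest (m + n) (n + m) := Sub _ (fswapP m n).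

Section Facts.
Variables (m n : nat) (f : forest m n).
Lemma size_for : size (val f) = n. Proof. by case: f => ? /= /and3P[/eqP]. Qed.
Lemma legs_for : perm_eq (legsf (val f)) (iota 0 m). Proof. by case: f => ? /= /and3P[]. Qed.
Lemma red_for : all reduced_tree (val f). Proof. by case: f => ? /= /and3P[]. Qed.
Lemma rednth_for : reduced_fam (nth Special (val f)). Proof. exact: red_nth red_for. Qed.
Lemma leg_for t j : t \in val f -> j \in legs t -> (j < m)%N.
Proof.
move=> tf jt; have : j \in legsf (val f) by apply/flatten_mapP; exists t.
by rewrite (perm_mem legs_for) mem_iota.
Qed.

Lemma fcompose_ext h k : (forall j, (j < m)%N -> h j = k j) ->
  map (tsubst h) (val f) = map (tsubst k) (val f).
Proof.
by move=> hk; apply/eq_in_map => t tf; apply: tsubst_ext => j jt; apply/hk/(leg_for tf).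
Qed.

Lemma tsubst_for h : (forall j, (j < m)%N -> h j = Leg j) -> map (tsubst h) (val f) = val f.
Proof.
move=> /fcompose_ext ->; rewrite -[RHS]map_id; apply/eq_in_map => t tf.
by apply: tsubst_Leg; apply: (allP red_for).
Qed.
End Facts.

Lemma map_sub_tsubst h k ts : reduced_fam h -> reduced_fam k ->
  map (tsubst h) (map (tsubst k) ts) = map (tsubst (fun j => tsubst h (k j))) ts.
Proof. by move=> rh rk; rewrite -map_comp; apply: eq_map => t; apply: tsubst_tsubst. Qed.

Lemma map_sub_Leg h s : map (tsubst h) (map Leg s) = map h s.
Proof. by rewrite -map_comp. Qed.

Lemma map_nth_seg (X Y Z : seq rtree) m n : size X = m -> size Y = n ->
  map (nth Special (X ++ Y ++ Z)) (iota m n) = Y.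
Proof.
move=> <- <-; rewrite -[size X]addn0 iotaDl -map_comp.
rewrite -[RHS](mkseq_nth Special); apply/eq_in_map => j; rewrite mem_iota /= add0n => jY.
by rewrite nth_cat ltnNge leq_addr /= addKn nth_cat jY.
Qed.

Lemma nth_Leg_iota m n j : (j < n)%N -> nth Special (map Leg (iota m n)) j = Leg (m + j).
Proof. by move=> jn; rewrite (nth_map 0%N) ?size_iota // nth_iota. Qed.

Lemma fcomposeA a b c d (h : forest c d) (g : forest b c) (f : forest a b) :
  fcompose (val h) (fcompose (val g) (val f)) = fcompose (fcompose (val h) (val g)) (val f).
Proof.
rewrite /fcompose map_sub_tsubst; try exact: rednth_for.
by apply: eq_map => t; apply: tsubst_ext => j _; rewrite nth_tsubst.
Qed.

Lemma fcompose1l a b (f : forest a b) : fcompose (map Leg (iota 0 b)) (val f) = val f.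
Proof. by rewrite /fcompose map_sub_Leg -[RHS](mkseq_nth Special) size_for. Qed.

Lemma fcompose1r a b (f : forest a b) : fcompose (val f) (map Leg (iota 0 a)) = val f.
Proof. by apply: tsubst_for => j ja; rewrite nth_Leg_iota. Qed.

Lemma fjuxt_id a b : fjuxt a (map Leg (iota 0 a)) (map Leg (iota 0 b)) = map Leg (iota 0 (a + b)).
Proof.
rewrite /fjuxt map_sub_Leg iotaD map_cat add0n -{4}(addn0 a) iotaDl -map_comp.
by [].
Qed.

Lemma fjuxt_comp a b c a' b' c' (g : forest b c) (f : forest a b) (g' : forest b' c')
    (f' : forest a' b') :
  fjuxt a (fcompose (val g) (val f)) (fcompose (val g') (val f')) =
  fcompose (fjuxt b (val g) (val g')) (fjuxt a (val f) (val f')).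
Proof.
have rj : reduced_fam (nth Special (fjuxt a (val f) (val f'))).
  exact: (rednth_for (fjuxt_for f f')).
rewrite /fjuxt /fcompose map_cat; congr (_ ++ _).
  by apply: fcompose_ext => j jb; rewrite nth_cat size_for jb.
rewrite !map_sub_tsubst //; last exact: rednth_for.
apply: eq_map => t; apply: tsubst_ext => j _ /=.
by rewrite nth_cat size_for ltnNge leq_addr /= addKn nth_tsubst.
Qed.

Lemma fjuxtA a b (f g h : seq rtree) :
  fjuxt a f (fjuxt b g h) = fjuxt (a + b) (fjuxt a f g) h.
Proof.
rewrite /fjuxt map_cat catA map_sub_tsubst //; congr (_ ++ _).
by apply: eq_map => t; apply: tsubst_ext => j _; rewrite /= /shleg addnA.
Qed.

Lemma fjuxt1l m n (f : forest m n) : fjuxt 0 (map Leg (iota 0 0)) (val f) = val f.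
Proof. exact: tsubst_for. Qed.

Lemma fjuxt1r m n (f : forest m n) : fjuxt m (val f) (map Leg (iota 0 0)) = val f.
Proof. exact: cats0. Qed.

Lemma fcompose_swap (X Y : seq rtree) m n : size X = m -> size Y = n ->
  fcompose (fswap m n) (X ++ Y) = Y ++ X.
Proof.
move=> sX sY; rewrite /fcompose map_sub_Leg map_cat -{1}[Y]cats0.
by rewrite (map_nth_seg _ sX sY) (map_nth_seg (X := [::]) _ erefl sX).
Qed.

Lemma fswap_nat a a' b b' (f : forest a a') (g : forest b b') :
  fcompose (fswap a' b') (fjuxt a (val f) (val g)) =
  fcompose (fjuxt b (val g) (val f)) (fswap a b).
Proof.
have rj : reduced_fam (nth Special (fswap a b)) by exact: (rednth_for (fswap_for a b)).
rewrite fcompose_swap ?size_map ?size_for // /fcompose map_cat; congr (_ ++ _).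
  by apply: fcompose_ext => j jb; rewrite /fswap map_cat nth_cat size_map size_iota jb nth_Leg_iota.
rewrite map_sub_tsubst // tsubst_for // => j ja.
by rewrite /= /fswap map_cat nth_cat size_map size_iota ltnNge leq_addr /= addKn nth_Leg_iota.
Qed.

Lemma fswapK a b : fcompose (fswap b a) (fswap a b) = map Leg (iota 0 (a + b)).
Proof.
rewrite {2}/fswap map_cat fcompose_swap ?size_map ?size_iota //.
by rewrite -map_cat iotaD.
Qed.

Lemma fswap_hexagon a b c : fswap a (b + c) =
  fcompose (fjuxt b (map Leg (iota 0 b)) (fswap a c))
           (fjuxt (a + b) (fswap a b) (map Leg (iota 0 c))).
Proof.
rewrite {1}/fjuxt map_sub_Leg map_cat /fcompose [in RHS]map_cat map_sub_Leg.
rewrite /fjuxt (_ : fswap a b = map Leg (iota a b) ++ map Leg (iota 0 a));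
  last by rewrite -map_cat.
rewrite (map_sub_Leg (shleg (a + b))) map_cat -!map_comp -!catA.
(* [X], [Y] and [Z] are the blocks of legs belonging to [b], [a] and [c]; both sides list them in
   the order [X], [Z], [Y]. *)
set X := map Leg (iota a b); set Y := map Leg (iota 0 a); set Z := map (shleg _) _.
have sX : size X = b by rewrite size_map size_iota.
have sY : size Y = a by rewrite size_map size_iota.
have sZ : size Z = c by rewrite size_map size_iota.
rewrite (map_nth_seg (X := [::]) _ erefl sX).
have -> : map (tsubst (nth Special (X ++ Y ++ Z)) \o shleg b) (iota a c) = Z.
  rewrite -[RHS](map_nth_seg (X := X ++ Y) [::] (m := b + a) _ sZ) ?size_cat ?sX ?sY //.
  by rewrite iotaDl -map_comp cats0 -catA.
have -> : map (tsubst (nth Special (X ++ Y ++ Z)) \o shleg b) (iota 0 a) = Y.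
  rewrite -[RHS](map_nth_seg (X := X) Z sX sY).
  by rewrite -[in RHS](addn0 b) iotaDl -map_comp.
rewrite /fswap map_cat iotaD map_cat -catA; congr (_ ++ (_ ++ _)).
by rewrite /Z -{1}(addn0 (a + b)%N) iotaDl -map_comp.
Qed.
End Forests.

(** * The universal category of forests *)

(* The free abelian group on [forest m n], realised by the canonical representatives
   of [freeg] : unlike [freeg], this type is small enough to be a set of morphisms of a
   [zgraph]. *)
Section SmallFree.
Variables m n : nat.

Definition fmor : Set := {s : seq (int * forest m n) | fgenum (Freeg s) == s}.
HB.instance Definition _ := Choice.on fmor.

Definition fm_to (x : fmor) : {freeg (forest m n)} := Freeg (val x).

Lemma fm_ofP (D : {freeg (forest m n)}) : fgenum (Freeg (fgenum D)) == fgenum D.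
Proof. by rewrite Freeg_enum. Qed.

Definition fm_of (D : {freeg (forest m n)}) : fmor := exist _ (fgenum D) (fm_ofP D).

Lemma fm_ofK : cancel fm_of fm_to. Proof. exact: Freeg_enum. Qed.
Lemma fm_toK : cancel fm_to fm_of. Proof. by case=> s p; apply/val_inj/eqP. Qed.

Definition fm_add x y := fm_of (fm_to x + fm_to y).
Definition fm_opp x := fm_of (- fm_to x).
Definition fm_zero := fm_of 0.

Fact fm_addA : associative fm_add.
Proof. by move=> x y z; rewrite /fm_add !fm_ofK addrA. Qed.
Fact fm_addC : commutative fm_add.
Proof. by move=> x y; rewrite /fm_add addrC. Qed.
Fact fm_add0 : left_id fm_zero fm_add.
Proof. by move=> x; rewrite /fm_add fm_ofK add0r fm_toK. Qed.
Fact fm_addN : left_inverse fm_zero fm_opp fm_add.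
Proof. by move=> x; rewrite /fm_add fm_ofK addNr. Qed.

HB.instance Definition _ := GRing.isZmodule.Build fmor fm_addA fm_addC fm_add0 fm_addN.

Fact fm_to_additive : zmod_morphism fm_to.
Proof. by move=> x y; rewrite [LHS]fm_ofK [X in _ + X]fm_ofK. Qed.
HB.instance Definition _ := GRing.isZmodMorphism.Build fmor {freeg (forest m n)} fm_to fm_to_additive.

Fact fm_of_additive : zmod_morphism fm_of.
Proof. by move=> x y; apply: (can_inj fm_toK); rewrite raddfB /= !fm_ofK. Qed.
HB.instance Definition _ := GRing.isZmodMorphism.Build {freeg (forest m n)} fmor fm_of fm_of_additive.

Definition fgen (f : forest m n) : fmor := fm_of << f >>.

Lemma fmor_ind (P : fmor -> Prop) :
  P 0 -> (forall f, P (fgen f)) -> (forall x y, P x -> P y -> P (x - y)) -> forall x, P x.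
Proof.
move=> P0 Pg PB x; rewrite -(fm_toK x); elim/freeg_ind: (fm_to x) => [|f|y z].
- by rewrite raddf0.
- exact: Pg.
- by rewrite raddfB; apply: PB.
Qed.
End SmallFree.

Section SmallBilinear.
Variables (m n m' n' m'' n'' : nat) (op : forest m n -> forest m' n' -> forest m'' n'').

Definition fmor_bilin (x : fmor m n) (y : fmor m' n') : fmor m'' n'' :=
  fm_of (freeg_bilin op (fm_to x) (fm_to y)).

Lemma fm2U f g : fmor_bilin (fgen f) (fgen g) = fgen (op f g).
Proof. by rewrite /fmor_bilin !fm_ofK fg2U. Qed.
Lemma fm20l y : fmor_bilin 0 y = 0. Proof. by rewrite /fmor_bilin raddf0 fg20l raddf0. Qed.
Lemma fm20r x : fmor_bilin x 0 = 0. Proof. by rewrite /fmor_bilin raddf0 fg20r raddf0. Qed.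
Lemma fm2Bl x x' y : fmor_bilin (x - x') y = fmor_bilin x y - fmor_bilin x' y.
Proof. by rewrite /fmor_bilin raddfB fg2Bl raddfB. Qed.
Lemma fm2Br x y y' : fmor_bilin x (y - y') = fmor_bilin x y - fmor_bilin x y'.
Proof. by rewrite /fmor_bilin raddfB fg2Br raddfB. Qed.
Lemma fm2Dl x x' y : fmor_bilin (x + x') y = fmor_bilin x y + fmor_bilin x' y.
Proof. by rewrite /fmor_bilin raddfD fg2Dl raddfD. Qed.
Lemma fm2Dr x y y' : fmor_bilin x (y + y') = fmor_bilin x y + fmor_bilin x y'.
Proof. by rewrite /fmor_bilin raddfD fg2Dr raddfD. Qed.
End SmallBilinear.

Definition Ugraph : zgraph := @ZGraph nat fmor (fun m n => GRing.Zmodule.class (fmor m n)).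

Definition Uid (m : Ugraph) : @mor Ugraph m m := fgen (fid_for m).
Definition Ucomp (a b c : Ugraph) : @mor Ugraph b c -> @mor Ugraph a b -> @mor Ugraph a c :=
  fmor_bilin (@fcomp_for a b c).
Definition Utens (a a' b b' : Ugraph) :
  @mor Ugraph a a' -> @mor Ugraph b b' -> @mor Ugraph (a + b)%N (a' + b')%N :=
  fmor_bilin (@fjuxt_for a a' b b').
Definition Ubraid (a b : Ugraph) : @mor Ugraph (a + b)%N (b + a)%N := fgen (fswap_for a b).

Lemma UcompU a b c (g : forest b c) (f : forest a b) :
  Ucomp (fgen g : @mor Ugraph b c) (fgen f : @mor Ugraph a b) = fgen (fcomp_for g f).
Proof. exact: fm2U. Qed.

Lemma UtensU a a' b b' (f : forest a a') (g : forest b b') :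
  Utens (fgen f : @mor Ugraph a a') (fgen g : @mor Ugraph b b') = fgen (fjuxt_for f g).
Proof. exact: fm2U. Qed.

Lemma Umor_ind (a b : Ugraph) (P : @mor Ugraph a b -> Prop) :
  P 0 -> (forall f : forest a b, P (fgen f)) ->
  (forall x y, P x -> P y -> P (x - y)) -> forall x, P x.
Proof. exact: fmor_ind. Qed.

Lemma Ucomp0l a b c f : @Ucomp a b c 0 f = 0. Proof. exact: fm20l. Qed.
Lemma Ucomp0r a b c f : @Ucomp a b c f 0 = 0. Proof. exact: fm20r. Qed.
Lemma UcompBl a b c x y f : @Ucomp a b c (x - y) f = Ucomp x f - Ucomp y f.
Proof. exact: fm2Bl. Qed.
Lemma UcompBr a b c x y f : @Ucomp a b c f (x - y) = Ucomp f x - Ucomp f y.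
Proof. exact: fm2Br. Qed.
Lemma Utens0l a a' b b' f : @Utens a a' b b' 0 f = 0. Proof. exact: fm20l. Qed.
Lemma Utens0r a a' b b' f : @Utens a a' b b' f 0 = 0. Proof. exact: fm20r. Qed.
Lemma UtensBl a a' b b' x y f : @Utens a a' b b' (x - y) f = Utens x f - Utens y f.
Proof. exact: fm2Bl. Qed.
Lemma UtensBr a a' b b' x y f : @Utens a a' b b' f (x - y) = Utens f x - Utens f y.
Proof. exact: fm2Br. Qed.

Lemma hcastB (G : zgraph) (a a' b b' : G) (ea : a = a') (eb : b = b') (f g : mor a b) :
  hcast ea eb (f - g) = hcast ea eb f - hcast ea eb g.
Proof. by rewrite hcastD hcastN. Qed.

Definition Ulin0 := (Ucomp0l, Ucomp0r, Utens0l, Utens0r, @hcast0).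
Definition UlinB := (UcompBl, UcompBr, UtensBl, UtensBr, @hcastB).

Lemma Ueq m n (a b : forest m n) : val a = val b -> fgen a = fgen b.
Proof. by move=> /val_inj ->. Qed.

(** A cast along an equality of numbers leaves the underlying list of trees alone, so strictness of
    U is a matter of equality of lists. *)
Lemma Uhcast (m n m' n' : Ugraph) (em : m = m') (en : n = n') (a : forest m n)
    (b : forest m' n') : val a = val b ->
  hcast em en (fgen a : @mor Ugraph m n) = fgen b.
Proof. by case: m' / em b; case: n' / en => b; apply: Ueq. Qed.

(** Reduces an identity between expressions additive in [f] to the case where [f] is a single
    forest. *)
Ltac Ulin f := elim/Umor_ind: f => [|f|? ? + +];
  [by rewrite ?Ulin0 | |
   let H1 := fresh in let H2 := fresh in move=> H1 H2; by rewrite ?UlinB H1 H2].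

Lemma UcompA (a b c d : Ugraph) (h : mor c d) (g : mor b c) (f : mor a b) :
  Ucomp h (Ucomp g f) = Ucomp (Ucomp h g) f.
Proof.
Ulin h; Ulin g; Ulin f.
by rewrite !UcompU; apply/Ueq/fcomposeA.
Qed.

Lemma Ucomp1m (a b : Ugraph) (f : mor a b) : Ucomp (Uid b) f = f.
Proof. Ulin f; rewrite UcompU; exact/Ueq/fcompose1l. Qed.

Lemma Ucompm1 (a b : Ugraph) (f : mor a b) : Ucomp f (Uid a) = f.
Proof. Ulin f; rewrite UcompU; exact/Ueq/fcompose1r. Qed.

Lemma Utens_id (a b : Ugraph) : Utens (Uid a) (Uid b) = Uid (a + b)%N.
Proof. rewrite UtensU; exact/Ueq/fjuxt_id. Qed.

Lemma Utens_comp (a b c a' b' c' : Ugraph)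
    (g : mor b c) (f : mor a b) (g' : mor b' c') (f' : mor a' b') :
  Utens (Ucomp g f) (Ucomp g' f') = Ucomp (Utens g g') (Utens f f').
Proof.
Ulin g; Ulin f; Ulin g'; Ulin f'.
by rewrite !UcompU !UtensU UcompU; apply/Ueq/fjuxt_comp.
Qed.

Lemma UtensA (a a' b b' c c' : Ugraph) (f : mor a a') (g : mor b b') (h : mor c c') :
  hcast (G := Ugraph) (addnA a b c) (addnA a' b' c') (Utens f (Utens g h)) = Utens (Utens f g) h.
Proof.
Ulin f; Ulin g; Ulin h.
by rewrite !UtensU; apply/Uhcast/fjuxtA.
Qed.

Lemma Utens1l (a b : Ugraph) (f : mor a b) :
  hcast (G := Ugraph) (add0n a) (add0n b) (Utens (Uid 0%N) f) = f.
Proof. Ulin f; rewrite UtensU; exact/Uhcast/fjuxt1l. Qed.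

Lemma Utens1r (a b : Ugraph) (f : mor a b) :
  hcast (G := Ugraph) (addn0 a) (addn0 b) (Utens f (Uid 0%N)) = f.
Proof. Ulin f; rewrite UtensU; exact/Uhcast/fjuxt1r. Qed.

Lemma Ubraid_nat (a a' b b' : Ugraph) (f : mor a a') (g : mor b b') :
  Ucomp (Ubraid a' b') (Utens f g) = Ucomp (Utens g f) (Ubraid a b).
Proof.
Ulin f; Ulin g; rewrite !UtensU !UcompU; exact/Ueq/fswap_nat.
Qed.

Lemma UbraidK (a b : Ugraph) : Ucomp (Ubraid b a) (Ubraid a b) = Uid (a + b)%N.
Proof. rewrite UcompU; exact/Ueq/fswapK. Qed.

Lemma Ubraid_hexagon (a b c : Ugraph) :
  hcast (G := Ugraph) (addnA a b c) erefl (Ubraid a (b + c)%N) =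
  Ucomp (hcast (G := Ugraph) (addnA b a c) (addnA b c a) (Utens (Uid b) (Ubraid a c)))
        (Utens (Ubraid a b) (Uid c)).
Proof.
rewrite !UtensU.
(* The inner cast is pushed into the forest, because [UcompU] composes generators only. *)
have -> : hcast (G := Ugraph) (addnA b a c) (addnA b c a)
    (fgen (fjuxt_for (fid_for b) (fswap_for a c)) : @mor Ugraph _ _) =
  fgen (ecast x (forest x _) (addnA b a c)
       (ecast y (forest _ y) (addnA b c a) (fjuxt_for (fid_for b) (fswap_for a c)))).
  by case: _ / (addnA b a c); case: _ / (addnA b c a).
rewrite UcompU; apply: Uhcast.
rewrite [RHS](_ : _ = fcompose (fjuxt b (map Leg (iota 0 b)) (fswap a c))
           (fjuxt (a + b) (fswap a b) (map Leg (iota 0 c)))); first exact: fswap_hexagon.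
rewrite /=; congr (fcompose _ _).
by case: _ / (addnA b a c); case: _ / (addnA b c a).
Qed.

Definition Ucat : symcat := @SymCat Ugraph Uid Ucomp 0%N addn Utens Ubraid
  UcompA Ucomp1m Ucompm1
  (fun a b c => @fm2Dl _ _ _ _ _ _ (@fcomp_for a b c)) (fun a b c => @fm2Dr _ _ _ _ _ _ (@fcomp_for a b c))
  Utens_id Utens_comp
  (fun a a' b b' => @fm2Dl _ _ _ _ _ _ (@fjuxt_for a a' b b'))
  (fun a a' b b' => @fm2Dr _ _ _ _ _ _ (@fjuxt_for a a' b b'))
  addnA add0n addn0 UtensA Utens1l Utens1r Ubraid_nat UbraidK Ubraid_hexagon.

Lemma fmulP : is_forest 2 1 [:: Black [:: Leg 0; Leg 1]]. Proof. by []. Qed.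
Lemma foneP : is_forest 0 1 [:: Special]. Proof. by []. Qed.
Definition fmul : forest 2 1 := Sub _ fmulP.
Definition fone : forest 0 1 := Sub _ foneP.
Definition Umul : @mor Ugraph 2 1 := fgen fmul.
Definition Uone : @mor Ugraph 0 1 := fgen fone.

Lemma UmulA : hcast (G := Ugraph) (addnA 1 1 1)%N erefl (Ucomp Umul (Utens (Uid 1%N) Umul)) =
  Ucomp Umul (Utens Umul (Uid 1%N)).
Proof. by rewrite !UtensU !UcompU; apply: Uhcast. Qed.
Lemma Umul1l : hcast (G := Ugraph) (add0n 1%N) erefl (Ucomp Umul (Utens Uone (Uid 1%N))) = Uid 1%N.
Proof. by rewrite !UtensU !UcompU; apply: Uhcast. Qed.
Lemma Umul1r : hcast (G := Ugraph) (addn0 1%N) erefl (Ucomp Umul (Utens (Uid 1%N) Uone)) = Uid 1%N.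
Proof. by rewrite !UtensU !UcompU; apply: Uhcast. Qed.

Definition Utree : symcat_pt := @SymCatPt Ucat 1%N Umul Uone UmulA Umul1l Umul1r.

(** * The universal functor, and evaluation in the universal category *)

Section SymcatLinear.
Variable W : symcat.

Lemma compmBl (a b c : W) (g g' : mor b c) (f : mor a b) :
  compm (g - g') f = compm g f - compm g' f.
Proof. by apply: (addIr (compm g' f)); rewrite -compmDl !subrK. Qed.
Lemma compmBr (a b c : W) (g : mor b c) (f f' : mor a b) :
  compm g (f - f') = compm g f - compm g f'.
Proof. by apply: (addIr (compm g f')); rewrite -compmDr !subrK. Qed.
Lemma tensmBl (a a' b b' : W) (f f' : mor a a') (g : mor b b') :
  tensm (f - f') g = tensm f g - tensm f' g.
Proof. by apply: (addIr (tensm f' g)); rewrite -tensmDl !subrK. Qed.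
Lemma tensmBr (a a' b b' : W) (f : mor a a') (g g' : mor b b') :
  tensm f (g - g') = tensm f g - tensm f g'.
Proof. by apply: (addIr (tensm f g')); rewrite -tensmDr !subrK. Qed.
Lemma tens0m (a a' b b' : W) (g : mor b b') : tensm (0 : mor a a') g = 0.
Proof. by rewrite -(subrr 0) tensmBl subrr. Qed.
Lemma tensm0 (a a' b b' : W) (f : mor a a') : tensm f (0 : mor b b') = 0.
Proof. by rewrite -(subrr 0) tensmBr subrr. Qed.
Lemma compmMn (a b c : W) (g : mor b c) (f : mor a b) m n :
  compm (g *+ m) (f *+ n) = compm g f *+ (m * n).
Proof.
elim: m => [|m IH]; first by rewrite !mulr0n comp0m.
rewrite mulrS compmDl IH mulSn mulrnDr; congr (_ + _).
by elim: n {IH} => [|n IH]; rewrite ?mulr0n ?compm0 // !mulrS compmDr IH.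
Qed.
Lemma tensmMn (a a' b b' : W) (f : mor a a') (g : mor b b') m n :
  tensm (f *+ m) (g *+ n) = tensm f g *+ (m * n).
Proof.
elim: m => [|m IH]; first by rewrite !mulr0n tens0m.
rewrite mulrS tensmDl IH mulSn mulrnDr; congr (_ + _).
by elim: n {IH} => [|n IH]; rewrite ?mulr0n ?tensm0 // !mulrS tensmDr IH.
Qed.
End SymcatLinear.

Section Universal.
Variable W : symcat_pt.
Variable phi : forall i p : nat, opn W p.

Lemma adom_aeval_at m n (f : forest m n) : adom (aeval_at phi m (val f)) = mpow W m.
Proof. by rewrite /= adom_asig ?iota_uniq 1?perm_sym ?legs_for // tobj_const size_iota. Qed.
Lemma acod_aeval_at m n (f : forest m n) : acod (aeval_at phi m (val f)) = mpow W n.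
Proof. by rewrite /= acod_aeval_forest size_for. Qed.

Definition Fgen m n (f : forest m n) : mor (mpow W m) (mpow W n) :=
  hcast (adom_aeval_at f) (acod_aeval_at f) (ahom (aeval_at phi m (val f))).

Lemma Arr_Fgen m n (f : forest m n) : Arr (Fgen f) = aeval_at phi m (val f).
Proof. by rewrite Arr_hcast ArrE. Qed.

Definition Fhom (m n : Utree) (x : mor m n) : mor (mpow W m) (mpow W n) :=
  fglift (Fgen (n := n) : _ -> zmodule (mor (mpow W m) (mpow W n))) (fm_to x).

Fact Fhom_additive m n : zmod_morphism (@Fhom m n).
Proof. by move=> x y; rewrite /Fhom raddfB raddfB. Qed.
HB.instance Definition _ (m n : Utree) :=
  GRing.isZmodMorphism.Build (@mor Utree m n) (@mor W (mpow W m) (mpow W n)) (@Fhom m n)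
    (@Fhom_additive m n).

Lemma Fhom_gen (m n : nat) (f : forest m n) : @Fhom m n (fgen f) = Fgen f.
Proof. by rewrite /Fhom fm_ofK fgliftU. Qed.

Lemma Arr_Fhom (m n : nat) (f : forest m n) : Arr (@Fhom m n (fgen f)) = aeval_at phi m (val f).
Proof. by rewrite Fhom_gen Arr_Fgen. Qed.

Lemma Fhom_id (m : Utree) : Fhom (idm m) = idm (mpow W m).
Proof. by apply: Arr_inj; rewrite Arr_Fhom aeval_at_id. Qed.

Lemma Fhom_comp (a b c : Utree) (g : mor b c) (f : mor a b) :
  Fhom (compm g f) = compm (Fhom g) (Fhom f).
Proof.
elim/Umor_ind: g => [|g|x y Hx Hy]; first by rewrite comp0m !raddf0 comp0m.
  elim/Umor_ind: f => [|f|x y Hx Hy]; first by rewrite compm0 !raddf0 compm0.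
    apply: Arr_inj; rewrite -acompE !Arr_Fhom aeval_at_comp ?legs_for ?size_for //.
    by rewrite -(Arr_Fhom (fcomp_for g f)); congr (Arr (Fhom _)); apply: UcompU.
  by rewrite compmBr !raddfB /= compmBr Hx Hy.
by rewrite compmBl !raddfB /= compmBl Hx Hy.
Qed.

Lemma Fhom_tens (a a' b b' : Utree) (f : mor a a') (g : mor b b') :
  hcast (mpowD W a b) (mpowD W a' b') (Fhom (tensm f g)) = tensm (Fhom f) (Fhom g).
Proof.
elim/Umor_ind: f => [|f|x y Hx Hy]; first by rewrite tens0m !raddf0 hcast0 tens0m.
  elim/Umor_ind: g => [|g|x y Hx Hy]; first by rewrite tensm0 !raddf0 hcast0 tensm0.
    apply: Arr_inj; rewrite Arr_hcast -[RHS]/(atens (Arr (Fhom _)) (Arr (Fhom _))).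
    rewrite !Arr_Fhom aeval_at_tens ?legs_for //.
    by rewrite -(Arr_Fhom (fjuxt_for f g)); congr (Arr (Fhom _)); apply: UtensU.
  by rewrite tensmBr !raddfB hcastB tensmBr Hx Hy.
by rewrite tensmBl !raddfB hcastB tensmBl Hx Hy.
Qed.

Lemma Fhom_braid (a b : Utree) :
  hcast (mpowD W a b) (mpowD W b a) (Fhom (braid a b)) = braid (mpow W a) (mpow W b).
Proof. by apply: Arr_inj; rewrite Arr_hcast Arr_Fhom aeval_at_braid. Qed.

Lemma mpow1 : mpow W 1 = mon W. Proof. exact: tenso1r. Qed.

Lemma Fhom_mul : hcast (etrans (mpowD W 1 1) (congr2 tenso mpow1 mpow1)) mpow1
  (Fhom (mon_mul Utree)) = mon_mul W.
Proof.
apply: Arr_inj; rewrite Arr_hcast Arr_Fhom /aeval_at /aeval_forest [map _ _]/= [atens_seq _]/= atens1r.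
rewrite amul1r // asig_id tobj_const /amul atens_id -acompA acomp1 //.
  by rewrite acomp1.
by rewrite /= tenso1r.
Qed.

Lemma Fhom_one : hcast (erefl : mpow W 0 = unito) mpow1 (Fhom (mon_one Utree)) = mon_one W.
Proof.
apply: Arr_inj; rewrite Arr_hcast Arr_Fhom /aeval_at /aeval_forest [map _ _]/= [atens_seq _]/= atens1r.
by rewrite asig_id acomp1.
Qed.

Definition Ufunctor : symcat_pt_functor Utree W :=
  @SymCatPtFunctor Utree W (mpow W) (fun m n => @Fhom m n) Fhom_id Fhom_comp erefl (mpowD W)
    Fhom_tens Fhom_braid mpow1 Fhom_mul Fhom_one.
End Universal.

(** * Values of trees inside the category of forests *)

Section Represent.

Lemma mpowU n : mpow Utree n = n.
Proof. by elim: n => //= n ->. Qed.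

(** The multiplicity [c] keeps track of scaled corollas. The endpoints are plain numbers, which
    avoids the powers [mpow Utree m]. *)
Definition represents (A : arrow Utree) (m n c : nat) (ts : seq rtree) : Prop :=
  exists f : forest m n, val f = ts /\ A = @Arr Utree m n (fgen f *+ c).

Lemma rep_comp A B m n p c d g f : represents A n p c g -> represents B m n d f ->
  represents (acomp A B) m p (c * d) (fcompose g f).
Proof.
move=> [g' [<- ->]] [f' [<- ->]]; exists (fcomp_for g' f'); split=> //.
by rewrite acompE compmMn; congr (Arr (_ *+ _)); apply: UcompU.
Qed.

Lemma rep_tens A B m n m' n' c d f g : represents A m n c f -> represents B m' n' d g ->
  represents (atens A B) (m + m') (n + n') (c * d) (fjuxt m f g).
Proof.
move=> [f' [<- ->]] [g' [<- ->]]; exists (fjuxt_for f' g'); split=> //.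
apply: etrans (congr1 (@Arr _ _ _)
  (tensmMn (fgen f' : @mor Utree m n) (fgen g' : @mor Utree m' n') c d)) _.
by congr (Arr (_ *+ _)); apply: UtensU.
Qed.

Lemma rep_id m : represents (@aid Utree m) m m 1 (map Leg (iota 0 m)).
Proof. by exists (fid_for m). Qed.
Lemma rep_braid m n : represents (@abraid Utree m n) (m + n) (n + m) 1 (fswap m n).
Proof. by exists (fswap_for m n). Qed.
Lemma rep_mul : represents (Arr (mon_mul Utree)) 2 1 1 [:: Black [:: Leg 0; Leg 1]].
Proof. by exists fmul. Qed.
Lemma rep_one : represents (Arr (mon_one Utree)) 0 1 1 [:: Special].
Proof. by exists fone. Qed.

(** Planar evaluation forgets the names of legs: in the resulting forest a leg is numbered by its
    position in the planar word [s]. *)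
Definition std_leg (s : seq nat) (j : nat) := Leg (index j s).

Lemma rep_asig s t : uniq s -> perm_eq s t ->
  represents (asig (fun=> mon Utree) s t) (size s) (size s) 1 (map (std_leg s) t).
Proof.
elim: t s => [|j t IH] s us st; first by rewrite (perm_nilP st); apply: (rep_id 0).
have [s1 [s2 [es j1 j2 us' st']]] := perm_cons_split st us.
rewrite es asig_split // !tobj_const !mpowU.
have := rep_tens (rep_id 1) (IH _ us' st').
have -> : (1 + size (s1 ++ s2) = size (s1 ++ j :: s2))%N.
  by rewrite !size_cat /= addnS.
have := rep_tens (rep_braid (size s1) 1) (rep_id (size s2)).
have -> : (size s1 + 1 + size s2 = size (s1 ++ j :: s2))%N.
  by rewrite size_cat -addnA add1n.
have -> : (1 + size s1 + size s2 = size (s1 ++ j :: s2))%N.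
  by rewrite size_cat /= addnS -addnA add1n.
move=> r2 r1; have := rep_comp r1 r2; rewrite !muln1.
congr (represents _ _ _ _ _); rewrite /fcompose /fjuxt /=; congr (_ :: _).
  by rewrite /std_leg index_cat (negPf j1) /= eqxx addn0.
rewrite -!map_comp; apply/eq_in_map => x xt /=.
have xs : x \in s1 ++ s2 by rewrite (perm_mem st').
rewrite /std_leg !index_cat; case: ifP => x1.
  have lt1 : (index x s1 < size s1)%N by rewrite index_mem.
  rewrite nth_cat size_map size_iota lt1 (nth_map 0%N) ?size_iota //.
  by rewrite nth_iota.
move: xs; rewrite mem_cat x1 /= => x2.
have lt2 : (index x s2 < size s2)%N by rewrite index_mem.
rewrite add0n nth_cat size_map size_iota ltnNge leq_addr /= addKn.
rewrite (nth_map 0%N) ?size_iota // nth_iota //= /shleg ifN ?addn1 ?addSnnS //.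
by apply: contraNneq j2 => ->.
Qed.

Variables (tau : nat -> nat -> rtree) (c : nat -> nat -> nat).

(** Simultaneous substitution of [tau i p] at all white vertices. Relabelling and grafting are
    special cases ([wsubst_relabel], [wsubst_graft]), which is how the operad structure on trees is
    compared with evaluation in U. *)
Fixpoint wsubst (t : rtree) : rtree :=
  match t with
  | White i ts => tsubst (nth Special (map wsubst ts)) (tau i (size ts))
  | Black ts => mk_black (map wsubst ts)
  | _ => t
  end.

Lemma wsubst_red t : reduced_tree (wsubst t).
Proof.
elim/rtree_mem_ind: t => //= [i ts IH|ts IH].
  by apply/reduced_tsubst/red_nth; rewrite all_map; apply/allP.
by apply: reduced_mk_black; rewrite all_map; apply/allP.
Qed.

(** Only an inclusion, since nothing is assumed about the legs of [tau i p]; it is enough for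
    [tsubst_ext]. *)
Lemma legs_wsubst t : {subset legs (wsubst t) <= legs t}.
Proof.
elim/rtree_mem_ind: t => [j|i ts IH|ts IH|] x //=.
  rewrite legs_tsubst => /flatten_mapP[j _ xj].
  case: (ltnP j (size (map wsubst ts))) xj => jl; last by rewrite nth_default.
  rewrite size_map in jl; rewrite (nth_map Special) // => xj.
  by apply/flatten_mapP; exists (nth Special ts j); rewrite ?mem_nth //; apply: IH; rewrite ?mem_nth.
rewrite (@mk_blackE _ legs) // -map_comp => /flatten_mapP[t tin xt].
by apply/flatten_mapP; exists t => //; apply: IH.
Qed.

Definition weight (w : seq (nat * nat)) : nat := \prod_(p <- w) c p.1 p.2.

Lemma weight_cat w1 w2 : weight (w1 ++ w2) = (weight w1 * weight w2)%N.
Proof. exact: big_cat. Qed.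

Variable phi : forall i p : nat, opn Utree p.

Lemma rep_forest ts :
  {in ts, forall t, uniq (legs t) ->
    represents (aeval phi t) (size (legs t)) 1 (weight (whites t)) [:: tsubst (std_leg (legs t)) (wsubst t)]} ->
  uniq (legsf ts) ->
  represents (aeval_forest phi ts) (size (legsf ts)) (size ts) (weight (flatten (map whites ts)))
    (map (tsubst (std_leg (legsf ts))) (map wsubst ts)).
Proof.
elim: ts => [|t ts IH] rt uts; first by rewrite /weight big_nil; apply: (rep_id 0).
move: (uts); rewrite legsf_cons cat_uniq => /and3P[ut /hasPn ntt uts'].
have IHts : {in ts, forall t, uniq (legs t) ->
    represents (aeval phi t) (size (legs t)) 1 (weight (whites t)) [:: tsubst (std_leg (legs t)) (wsubst t)]}.
  by move=> u us; apply: rt; rewrite inE us orbT.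
have := rep_tens (rt t (mem_head _ _) ut) (IH IHts uts').
rewrite size_cat weight_cat; congr (represents _ _ _ _ _); rewrite /fjuxt /=; congr (_ :: _).
  by apply: tsubst_ext => j /legs_wsubst jt; rewrite /std_leg index_cat jt.
rewrite map_sub_tsubst // -!map_comp; apply/eq_in_map => u us /=; apply: tsubst_ext => j /legs_wsubst ju.
have jts : j \in legsf ts by apply/flatten_mapP; exists u.
by rewrite /std_leg /= /shleg index_cat (negPf (ntt _ jts)).
Qed.

Lemma rep_aeval t :
  (forall i p, (i, p) \in whites t -> represents (Arr (phi i p)) p 1 (c i p) [:: tau i p]) ->
  uniq (legs t) ->
  represents (aeval phi t) (size (legs t)) 1 (weight (whites t)) [:: tsubst (std_leg (legs t)) (wsubst t)].
Proof.
elim/rtree_mem_ind: t => [j|i ts IH|ts IH|] ht ut.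
- by rewrite /= /weight big_nil /std_leg /= eqxx; apply: (rep_id 1).
- have rts := rep_forest (ts := ts) _ ut.
  have /rts r : {in ts, forall t, uniq (legs t) ->
    represents (aeval phi t) (size (legs t)) 1 (weight (whites t)) [:: tsubst (std_leg (legs t)) (wsubst t)]}.
    move=> t tin; apply: IH => // k p kp; apply: ht; rewrite inE; apply/orP; right.
    by apply/flatten_mapP; exists t.
  have := rep_comp (ht _ _ (mem_head _ _)) r.
  rewrite /= /weight big_cons; congr (represents _ _ _ _ _); rewrite /fcompose /=; congr [:: _].
  rewrite tsubst_tsubst //; last by apply/red_nth; rewrite all_map; apply/allP => u _; apply: wsubst_red.
  by apply: tsubst_ext => j _; rewrite nth_tsubst.
- have IHts : {in ts, forall t, uniq (legs t) ->
    represents (aeval phi t) (size (legs t)) 1 (weight (whites t)) [:: tsubst (std_leg (legs t)) (wsubst t)]}.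
    move=> t tin; apply: IH => // k p kp; apply: ht.
    by apply/flatten_mapP; exists t.
  rewrite /= tsubst_mk_black //; last by rewrite all_map; apply/allP => u _; apply: wsubst_red.
  move: ut; rewrite /= -/(legsf ts); move: IHts {IH ht}.
  elim: ts => [|t ts IHts] rt uts; first by rewrite /weight big_nil; apply: rep_one.
  move: (uts); rewrite legsf_cons cat_uniq => /and3P[ut /hasPn ntt uts'].
  have rts : {in ts, forall t, uniq (legs t) ->
    represents (aeval phi t) (size (legs t)) 1 (weight (whites t)) [:: tsubst (std_leg (legs t)) (wsubst t)]}.
    by move=> u us; apply: rt; rewrite inE us orbT.
  have rtens := rep_tens (rt t (mem_head _ _) ut) (IHts rts uts').
  have := rep_comp rep_mul rtens; rewrite mul1n size_cat weight_cat.
  congr (represents _ _ _ _ _); rewrite /fcompose /=; congr [:: _].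
  rewrite tsubst_mk_black //; last by apply: all_reduced_tsubst.
  have -> : map (tsubst (shleg (size (legs t)))) (map (tsubst (std_leg (legsf ts))) (map wsubst ts)) =
    map (tsubst (std_leg (legs t ++ legsf ts))) (map wsubst ts).
    rewrite map_sub_tsubst // -!map_comp; apply/eq_in_map => u us /=; apply: tsubst_ext => j /legs_wsubst ju.
    have jts : j \in legsf ts by apply/flatten_mapP; exists u.
    by rewrite /std_leg /= /shleg index_cat (negPf (ntt _ jts)).
  (* The iterated product is built from binary ones, and flattening turns the nested binary black
     vertices into a single one. *)
  apply: mk_black_flat; rewrite /= black_inputs_mk_black ?all_reduced_tsubst //.
  rewrite cats0; congr (black_inputs _ ++ _).
  by apply: tsubst_ext => j /legs_wsubst jt; rewrite /std_leg index_cat jt.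
- by rewrite /weight big_nil; apply: rep_one.
Qed.

(** The symmetry in [aeval_at] gives the legs, renumbered by [std_leg], their names back. *)
Lemma rep_tree l t :
  (forall i p, (i, p) \in whites t -> represents (Arr (phi i p)) p 1 (c i p) [:: tau i p]) ->
  perm_eq (legs t) (iota 0 l) ->
  represents (aeval_at phi l [:: t]) l 1 (weight (whites t)) [:: wsubst t].
Proof.
move=> ht lt; have ut : uniq (legs t) by rewrite (perm_uniq lt) iota_uniq.
have r1 := rep_aeval ht ut.
have r2 : represents (asig (fun=> mon Utree) (iota 0 l) (legs t)) l l 1 (map (std_leg (iota 0 l)) (legs t)).
  have := rep_asig (iota_uniq 0 l) (t := legs t); rewrite size_iota; apply.
  by rewrite perm_sym.
move: r1; rewrite (perm_size lt) size_iota => /rep_comp/(_ r2).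
rewrite muln1 /aeval_at /aeval_forest /= atens1r /legsf /= cats0.
congr (represents _ _ _ _ _); rewrite /fcompose /=; congr [:: _].
rewrite tsubst_tsubst //; last first.
  by apply: red_nth; rewrite all_map; apply/allP.
rewrite -[RHS](tsubst_Leg (wsubst_red t)); apply: tsubst_ext => j /legs_wsubst jt /=.
rewrite (nth_map 0%N) ?index_mem // nth_index // /std_leg.
move: jt; rewrite (perm_mem lt) mem_iota /= add0n => jl.
by rewrite -{1}[j]add0n -(nth_iota 0 0 jl) index_uniq ?size_iota ?iota_uniq.
Qed.
End Represent.

(** * The operad of natural operations *)

Ltac shift_lia := rewrite /shift ?size_cat /=;
  repeat match goal with |- context [if ?b then _ else _] =>
    lazymatch b with context [if _ then _ else _] => fail | _ => case: (boolP b) => ? end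
  end; lia.

Section Restrict.
Variable V : symcat_pt.

(** Every list of inputs arises from a total family ([restrict_input]). With total families,
    reindexing inputs is arithmetic on [i] and needs no transport between arities. *)
Definition restrict ks (phi : nat -> forall p, opn V p) : inputs V ks :=
  fun i => phi i (nth 0%N ks i).
Arguments restrict : clear implicits.

Lemma phi_congr (phi : nat -> forall p, opn V p) i j p : i = j -> phi i p = phi j p.
Proof. by move=> ->. Qed.

Lemma recast_id p (f : opn V p) : recast p f = f.
Proof. by rewrite (recastE (erefl p)). Qed.

Lemma input_restrict ks phi i p : (i < size ks)%N -> nth 0%N ks i = p ->
  input (restrict ks phi) i p = phi i p.
Proof.
move=> ik <-; rewrite /input insubT /= /restrict.
exact: recast_id.
Qed.

Lemma input_ord ks (fs : inputs V ks) (i : 'I_(size ks)) : input fs i (nth 0%N ks i) = fs i.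
Proof. by rewrite /input valK recast_id. Qed.

Lemma restrict_input ks (fs : inputs V ks) : restrict ks (input fs) = fs.
Proof. by apply: functional_extensionality_dep => i; apply: input_ord. Qed.

Lemma restrict_ext ks (phi psi : nat -> forall p, opn V p) :
  (forall i, (i < size ks)%N -> phi i (nth 0%N ks i) = psi i (nth 0%N ks i)) ->
  restrict ks phi = restrict ks psi.
Proof. by move=> e; apply: functional_extensionality_dep => i; apply: e. Qed.

Lemma nth_shift ks1 c js ks2 (p : nat) : p != size ks1 ->
  nth 0%N (ks1 ++ js ++ ks2) (shift (size ks1) (size js) p) = nth 0%N (ks1 ++ c :: ks2) p.
Proof.
move=> pN; rewrite /shift !nth_cat; case: (ltnP p (size ks1)) => pk; first by rewrite pk.
have pk' : (size ks1 < p)%N by rewrite ltn_neqAle eq_sym pN.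
rewrite ifF; last by lia.
rewrite ifF; last by lia.
have -> : (p - size ks1 = (p - size ks1).-1.+1)%N by lia.
by rewrite /=; congr nth; lia.
Qed.

Lemma shift_lt ks1 c (js ks2 : seq nat) (p : nat) : p != size ks1 ->
  (p < size (ks1 ++ c :: ks2))%N ->
  (shift (size ks1) (size js) p < size (ks1 ++ js ++ ks2))%N.
Proof. rewrite !size_cat /= => pN pk; shift_lia. Qed.

Definition outer_family (k m : nat) c (f : opn V c) (phi : nat -> forall p, opn V p) :
    nat -> forall p, opn V p :=
  fun p q => if p == k then recast q f else phi (shift k m p) q.

Lemma outer_restrict ks1 c js ks2 phi (f : opn V c) :
  outer_inputs (ks1 := ks1) (ks2 := ks2) (restrict (ks1 ++ js ++ ks2) phi) f =
  restrict (ks1 ++ c :: ks2) (outer_family (size ks1) (size js) f phi).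
Proof.
apply: functional_extensionality_dep => p; rewrite /outer_inputs /restrict /outer_family.
case: eqP => // /eqP pN; apply: input_restrict; first exact: shift_lt.
exact: nth_shift.
Qed.

Lemma inner_restrict ks1 js ks2 phi :
  inner_inputs (ks1 := ks1) (restrict (ks1 ++ js ++ ks2) phi) =
  restrict js (fun q => phi (size ks1 + q)%N).
Proof.
apply: functional_extensionality_dep => q; have := ltn_ord q => qj.
apply: input_restrict; first by rewrite !size_cat; lia.
rewrite nth_cat ifF; last by lia.
by rewrite addKn nth_cat qj.
Qed.

Lemma relabel_restrict ks ks' (s : relabelling ks ks') phi :
  relabel_inputs s (restrict ks' phi) = restrict ks (fun i => phi (s i)).
Proof.
apply: functional_extensionality_dep => i; apply: input_restrict; last exact: relab_col.
have := ltn_ord i => ik; have := perm_mem (relab_bij s) (s i).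
by rewrite mem_iota /= add0n map_f // mem_iota.
Qed.

Lemma natop_compE l ks1 c ks2 js (a : natop l (ks1 ++ c :: ks2)) (b : natop c js) phi :
  natop_comp a b V (restrict (ks1 ++ js ++ ks2) phi) =
  a V (restrict _ (outer_family (size ks1) (size js)
         (b V (restrict js (fun q => phi (size ks1 + q)%N))) phi)).
Proof. by rewrite /= outer_restrict inner_restrict. Qed.

Lemma natop_actE l ks ks' (s : relabelling ks ks') (a : natop l ks) phi :
  natop_act s a V (restrict ks' phi) = a V (restrict ks (fun i => phi (s i))).
Proof. by rewrite /= relabel_restrict. Qed.

Lemma natop_pcastE l ks ks' (e : ks = ks') (a : natop_operad l ks) phi :
  natop_fun (pcast e a) (restrict ks' phi) = natop_fun a (restrict ks phi).
Proof. by case: ks' / e. Qed.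
End Restrict.

Arguments restrict {V} ks phi.

Lemma natop_restrP l ks (a b : natop l ks) :
  (forall V phi, a V (restrict ks phi) = b V (restrict ks phi)) -> a = b.
Proof. by move=> ab; apply: natopP => V fs; rewrite -(restrict_input fs). Qed.

Lemma natop_compDr l ks1 c ks2 js (a : natop l (ks1 ++ c :: ks2)) (b b' : natop c js) :
  natop_comp a (b + b') = natop_comp a b + natop_comp a b' :> natop l (ks1 ++ js ++ ks2).
Proof.
apply: natop_restrP => V phi; rewrite natop_compE [RHS]/= !outer_restrict !inner_restrict.
have lt : (size ks1 < size (ks1 ++ c :: ks2))%N by rewrite size_cat /=; lia.
apply: (@natop_additive _ _ a V (Ordinal lt)) => [j jN|].
  have jN' : (j : nat) == size ks1 = false by apply/negbTE; rewrite -val_eqE in jN.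
  by rewrite /restrict /outer_family jN'.
by rewrite /restrict /outer_family /= eqxx recastD.
Qed.

(** At a restricted family the two sides of the associativity and equivariance axioms apply the same
    operations to reindexed families, so what remains is arithmetic of [shift]. *)
Lemma natop_is_operad : is_operad natop_operad.
Proof.
split.
- by move=> l ks1 c ks2 js x x' y; apply: natopP.
- by move=> l ks1 c ks2 js x y y'; apply: natop_compDr.
- by move=> l ks ks' s x x'; apply: natopP.
- move=> l ks s x sid; apply: natop_restrP => V phi; rewrite natop_actE; congr (x V).
  by apply: restrict_ext => i ik; rewrite sid.
- move=> l ks ks' ks'' s t u x ust; apply: natop_restrP => V phi; rewrite !natop_actE; congr (x V).
  by apply: restrict_ext => i ik; rewrite ust.
- move=> c js y e; apply: natop_restrP => V phi; rewrite natop_pcastE.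
  rewrite [opd_comp _ _ _ _]/(natop_comp (ks1 := [::]) (ks2 := [::]) _ _) natop_compE.
  by rewrite /= /restrict /outer_family /= recast_id.
- move=> l ks1 c ks2 x; apply: natop_restrP => V phi; rewrite natop_compE; congr (x V).
  apply: restrict_ext => i ik; rewrite /outer_family /=; case: eqP => [->|/eqP iN].
    rewrite /restrict /= addn0 nth_cat ltnn subnn /=; exact: recast_id.
  by have -> : shift (size ks1) 1 i = i by shift_lia.
- move=> l ks1 c ks2 js1 d js2 hs x y z e e'; apply: natop_restrP => V phi.
  rewrite natop_pcastE !natop_compE natop_pcastE natop_compE; congr (x V).
  apply: restrict_ext => p pk; rewrite /outer_family; case: eqP => [_|/eqP pN].
    congr (recast _ (y V _)); apply: restrict_ext => q qj; rewrite /outer_family size_cat eqn_add2l.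
    case: eqP => [_|/eqP qN].
      congr (recast _ (z V _)); apply: restrict_ext => r rh; by rewrite addnA.
    by apply: phi_congr; shift_lia.
  rewrite ifF; last by shift_lia.
  apply: phi_congr; shift_lia.
- move=> l ks1 c ks2 d ks3 js hs x y z e1 e2 e3 e4; apply: natop_restrP => V phi.
  rewrite natop_pcastE !natop_compE !natop_pcastE !natop_compE natop_pcastE; congr (x V).
  apply: restrict_ext => p pk; rewrite /outer_family.
  case: eqP => [pE|/eqP pN].
    have -> : p == size (ks1 ++ c :: ks2) = false by rewrite size_cat /=; lia.
    have -> : shift (size (ks1 ++ c :: ks2)) (size hs) p == size ks1 = true.
      by rewrite pE; shift_lia.
    congr (recast _ (y V _)); apply: restrict_ext => q qj.
    rewrite ifF; last by rewrite !size_cat; lia.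
    apply: phi_congr; shift_lia.
  have [pE|/eqP pN'] := @eqP _ p (size (ks1 ++ c :: ks2)).
    have -> : shift (size ks1) (size js) p == size (ks1 ++ js ++ ks2) = true.
      by rewrite pE; shift_lia.
    congr (recast _ (z V _)); apply: restrict_ext => q qh.
    have -> : size (ks1 ++ c :: ks2) + q == size ks1 = false by rewrite size_cat /=; lia.
    by apply: phi_congr; shift_lia.
  move: pN'; rewrite !size_cat /= => pN'.
  rewrite ifF; last by shift_lia.
  rewrite ifF; last by shift_lia.
  apply: phi_congr; shift_lia.
- move=> l ks1 ks2 ks1' ks2' c js js' s t u x y s1 u1 u2; apply: natop_restrP => V phi.
  rewrite natop_actE !natop_compE natop_actE; congr (x V).
  apply: restrict_ext => p pk; rewrite /outer_family.
  have [pE|/eqP pN] := @eqP _ p (size ks1).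
    rewrite pE s1 eqxx natop_actE; congr (recast _ (y V _)); apply: restrict_ext => q qj.
    by rewrite u2.
  (* By injectivity of [s], no other position is sent to the one where [y] is inserted. *)
  have spN : s p == size ks1' = false.
    apply/negbTE; apply: contraNneq pN => sp; apply/eqP.
    have /uniqP : uniq [seq s i | i <- iota 0 (size (ks1 ++ c :: ks2))].
      by rewrite (perm_uniq (relab_bij s)) iota_uniq.
    have k1 : (size ks1 < size (ks1 ++ c :: ks2))%N by rewrite size_cat /=; lia.
    move=> /(_ 0%N p (size ks1)); rewrite !inE size_map size_iota.
    rewrite !(nth_map 0%N) ?size_iota // !nth_iota // !add0n sp s1; exact.
  by rewrite spN u1.
Qed.

(** * Naturality and additivity of tree evaluation *)

Section Naturality.
Variables (V W : symcat_pt) (F : symcat_pt_functor V W).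

Definition amap (A : arrow V) : arrow W := Arr (fhom F _ _ (ahom A)).

Lemma amap_comp A B : acod B = adom A -> amap (acomp A B) = acomp (amap A) (amap B).
Proof.
case: A B => [? c g] [a b f] /= e; case: _ / e g => g.
by rewrite !acompE /amap /= fhom_comp -acompE.
Qed.

Lemma amap_tens A B : amap (atens A B) = atens (amap A) (amap B).
Proof. by rewrite /atens /= -fhom_tens Arr_hcast. Qed.

Lemma amap_id a : amap (aid a) = aid (F a).
Proof. by rewrite /amap /= fhom_id. Qed.

Lemma amap_braid a b : amap (abraid a b) = abraid (F a) (F b).
Proof. by rewrite /abraid -fhom_braid Arr_hcast. Qed.

Lemma amap_mul : amap (Arr (mon_mul V)) = Arr (mon_mul W).
Proof. by rewrite -(fhom_mul F) Arr_hcast. Qed.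

Lemma amap_one : amap (Arr (mon_one V)) = Arr (mon_one W).
Proof. by rewrite -(fhom_one F) Arr_hcast. Qed.

Lemma Arr_fopn k (f : opn V k) : Arr (fopn F f) = amap (Arr f).
Proof. exact: Arr_hcast. Qed.

Lemma fobj_tobj a s : F (tobj a s) = tobj (fun j => F (a j)) s.
Proof. by elim: s => [|j s IH] /=; rewrite ?fobj_unit // fobj_tens IH. Qed.

Lemma amap_sig a s t : uniq s -> perm_eq s t ->
  amap (asig a s t) = asig (fun j => F (a j)) s t.
Proof.
elim: t s => [|j t IH] s us st.
  by rewrite amap_id fobj_unit.
have [s1 [s2 [es j1 j2 us' st']]] := perm_cons_split st us.
rewrite es !asig_split // amap_comp; last by rewrite /= adom_asig // tobj_cat tensoA.
by rewrite !amap_tens !amap_id amap_braid IH // !fobj_tobj.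
Qed.

Lemma amap_aeval phi t : amap (aeval phi t) = aeval (fun i p => fopn F (phi i p)) t.
Proof.
elim/rtree_mem_ind: t => /= [j|i ts IH|ts IH|].
- by rewrite amap_id fobj_mon.
- rewrite amap_comp; last by rewrite -/(aeval_forest phi ts) acod_aeval_forest.
  rewrite Arr_fopn; congr acomp.
  elim: ts IH => [|t ts IHts] IH /=; first by rewrite amap_id fobj_unit.
  by rewrite amap_tens IH ?mem_head // IHts // => u us; apply: IH; rewrite inE us orbT.
- elim: ts IH => [|t ts IHts] IH /=; first exact: amap_one.
  rewrite /amul amap_comp; last by rewrite /= acod_aeval acod_amul_seq.
  rewrite amap_tens amap_mul IH ?mem_head // IHts // => u us.
  by apply: IH; rewrite inE us orbT.
- exact: amap_one.
Qed.

Lemma amap_aeval_at phi l t : perm_eq (legs t) (iota 0 l) ->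
  amap (aeval_at phi l [:: t]) = aeval_at (fun i p => fopn F (phi i p)) l [:: t].
Proof.
move=> lt; have lt' : perm_eq (iota 0 l) (legsf [:: t]) by rewrite perm_sym /legsf /= cats0.
rewrite /aeval_at amap_comp; last by rewrite acod_asig adom_aeval_forest tobj_const.
by rewrite amap_sig ?iota_uniq // fobj_mon /aeval_forest /= !atens1r amap_aeval.
Qed.

Lemma tree_eval_natural l ks (t : tree l ks) (fs : inputs V ks) :
  fopn F (tree_eval t fs) = tree_eval t (finputs F fs).
Proof.
apply: Arr_inj; rewrite Arr_fopn !Arr_tree_eval amap_aeval_at ?legs_tree //.
congr (aeval_at _ _ _); apply: functional_extensionality_dep => i.
by apply: functional_extensionality_dep => p; apply: fopn_input.
Qed.
End Naturality.

Section Additivity.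
Variable V : symcat_pt.

(* Untyped arrows cannot be added, so their sum is a relation. *)
Definition asum (A B C : arrow V) : Prop :=
  exists a b (f g : mor a b), [/\ A = Arr f, B = Arr g & C = Arr (f + g)].

Lemma asum_compl A B C D : asum A B C -> asum (acomp A D) (acomp B D) (acomp C D).
Proof.
case: D => d e h [a [b [f [g [-> -> ->]]]]].
have [ea|ne] := pselect (e = a); last first.
  (* All three composites are then zero arrows, and 0 + 0 = 0. *)
  rewrite !acomp_junk //=; exists d, b, 0, 0; by rewrite addr0.
case: _ / ea f g => f g; rewrite !acompE compmDl.
by exists d, b, (compm f h), (compm g h).
Qed.

Lemma asum_compr A B C D : asum A B C -> asum (acomp D A) (acomp D B) (acomp D C).
Proof.
case: D => d e h [a [b [f [g [-> -> ->]]]]].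
have [ea|ne] := pselect (b = d); last first.
  rewrite !acomp_junk //=; exists a, e, 0, 0; by rewrite addr0.
case: _ / ea h => h; rewrite !acompE compmDr.
by exists a, e, (compm h f), (compm h g).
Qed.

Lemma asum_tensl A B C D : asum A B C -> asum (atens A D) (atens B D) (atens C D).
Proof.
move=> [a [b [f [g [-> -> ->]]]]]; exists (tenso a (adom D)), (tenso b (acod D)).
by exists (tensm f (ahom D)), (tensm g (ahom D)); rewrite -tensmDl.
Qed.

Lemma asum_tensr A B C D : asum A B C -> asum (atens D A) (atens D B) (atens D C).
Proof.
move=> [a [b [f [g [-> -> ->]]]]]; exists (tenso (adom D) a), (tenso (acod D) b).
by exists (tensm (ahom D) f), (tensm (ahom D) g); rewrite -tensmDr.
Qed.

Lemma asum_Arr a b (f g h : mor a b) : asum (Arr f) (Arr g) (Arr h) -> h = f + g.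
Proof.
move=> [a' [b' [f' [g' [ef]]]]].
have /= ea := congr1 (@adom V) ef; have /= eb := congr1 (@acod V) ef.
move: f' g' ef; case: _ / ea; case: _ / eb => f' g' ef eg eh.
by rewrite (Arr_inj ef) (Arr_inj eg) (Arr_inj eh).
Qed.

Lemma aeval_ext (phi psi : forall i p, opn V p) t :
  {in whites t, forall x, phi x.1 x.2 = psi x.1 x.2} -> aeval phi t = aeval psi t.
Proof.
elim/rtree_mem_ind: t => //= [i ts IH|ts IH] e.
  rewrite (e (i, size ts)) ?mem_head //; congr (acomp _ (atens_seq _)); apply/eq_in_map => t tin.
  apply: IH => // x xt; apply: e; rewrite inE; apply/orP; right.
  by apply/flatten_mapP; exists t.
congr amul_seq; apply/eq_in_map => t tin.
by apply: IH => // x xt; apply: e; apply/flatten_mapP; exists t.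
Qed.

Variables (f g h : forall i p : nat, opn V p) (i : nat).
Hypothesis off : forall j p, j != i -> f j p = h j p /\ g j p = h j p.
Definition labels (t : rtree) : seq nat := [seq x.1 | x <- whites t].

Lemma aeval_off t : i \notin labels t -> aeval f t = aeval h t /\ aeval g t = aeval h t.
Proof.
move=> it; split; apply: aeval_ext => x xt.
  by case: (off (j := x.1) x.2) => //; apply: contraNneq it => <-; apply: map_f.
by case: (off (j := x.1) x.2) => //; apply: contraNneq it => <-; apply: map_f.
Qed.

Lemma aevals_off ts : i \notin flatten (map labels ts) ->
  map (aeval f) ts = map (aeval h) ts /\ map (aeval g) ts = map (aeval h) ts.
Proof.
move=> its; have off_t t : t \in ts -> i \notin labels t.
  by move=> tin; apply: contra its => it; apply/flatten_mapP; exists t.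
by split; apply/eq_in_map => t /off_t /aeval_off[].
Qed.

(** The label [i] sits at exactly one vertex, and the value is additive in the operation placed
    there; subtrees that avoid this vertex have the same value for [f], [g] and [h]. *)
Lemma asum_aeval t : (forall p, (i, p) \in whites t -> h i p = f i p + g i p) ->
  count_mem i (labels t) = 1%N -> asum (aeval f t) (aeval g t) (aeval h t).
Proof.
have labs ts : flatten (map labels ts) = [seq x.1 | x <- flatten (map whites ts)].
  by rewrite map_flatten -map_comp.
(* One argument serves both the tensor product under a white vertex and the product under a black
   one: the label lies in exactly one factor. *)
have step (op : arrow V -> arrow V -> arrow V) (z : arrow V) ts :
    (forall A B C D, asum A B C -> asum (op A D) (op B D) (op C D)) ->
    (forall A B C D, asum A B C -> asum (op D A) (op D B) (op D C)) ->
    {in ts, forall t, (forall p, (i, p) \in whites t -> h i p = f i p + g i p) ->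
       count_mem i (labels t) = 1%N -> asum (aeval f t) (aeval g t) (aeval h t)} ->
    (forall p, (i, p) \in flatten (map whites ts) -> h i p = f i p + g i p) ->
    count_mem i (flatten (map labels ts)) = 1%N ->
    asum (foldr op z (map (aeval f) ts)) (foldr op z (map (aeval g) ts))
         (foldr op z (map (aeval h) ts)).
  move=> opl opr; elim: ts => //= u ts IHts IH hi; rewrite count_cat => ct.
  have hit p : (i, p) \in whites u -> h i p = f i p + g i p.
    by move=> ip; apply: hi; rewrite mem_cat ip.
  have hits p : (i, p) \in flatten (map whites ts) -> h i p = f i p + g i p.
    by move=> ip; apply: hi; rewrite mem_cat ip orbT.
  have [it|it] := boolP (i \in labels u).
    have c1 : (0 < count_mem i (labels u))%N by rewrite -has_count has_pred1.
    have its : i \notin flatten (map labels ts).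
      apply/count_memPn; move: c1 ct; case: (count_mem i (labels u)) => // k _.
      by rewrite addSn => -[] /eqP; rewrite addn_eq0 => /andP[_ /eqP].
    have [-> ->] := aevals_off its; apply: opl; apply: IH; rewrite ?mem_head //.
    by move: ct; rewrite (count_memPn its) addn0.
  have [-> ->] := aeval_off it; apply: opr; apply: IHts => //.
    by move=> v vs; apply: IH; rewrite inE vs orbT.
  by move: ct; rewrite (count_memPn it).
elim/rtree_mem_ind: t => [//|j ts IH|ts IH|//] hi ct.
- rewrite /=; move: ct; rewrite /labels /= -labs.
  have [ji|ji] := eqVneq j i.
    rewrite add1n => -[ct]; have its : i \notin flatten (map labels ts) by apply/count_memPn.
    have [-> ->] := aevals_off its; apply: asum_compl.
    exists (mpow V (size ts)), (mon V), (f j (size ts)), (g j (size ts)); split=> //.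
    by rewrite ji hi //= ji mem_head.
  rewrite add0n => ct; have [-> ->] := off (size ts) ji; apply: asum_compr.
  apply: step => //.
  + by move=> *; apply: asum_tensl.
  + by move=> *; apply: asum_tensr.
  + by move=> p ip; apply: hi; rewrite inE ip orbT.
- rewrite /=; apply: step => //.
  + by move=> *; apply/asum_compr/asum_tensl.
  + by move=> *; apply/asum_compr/asum_tensr.
  + by rewrite labs.
Qed.
End Additivity.

Lemma whites_tree l ks (t : tree l ks) i p :
  (i, p) \in whites (val t) -> (i < size ks)%N /\ nth 0%N ks i = p.
Proof.
case: t => t /= /and3P[_ wt _]; rewrite (perm_mem wt) zip_iotaE => /mapP[j].
by rewrite mem_iota /= add0n => jk [-> ->].
Qed.

Lemma labels_tree l ks (t : tree l ks) : perm_eq (labels (val t)) (iota 0 (size ks)).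
Proof.
case: t => t /= /and3P[_ /(perm_map fst) wt _]; apply: perm_trans wt _.
by rewrite zip_iotaE -map_comp map_id_in.
Qed.

Lemma tree_eval_additive V l ks (t : tree l ks) : multiadditive (@tree_eval V l ks t).
Proof.
move=> i f g h fgh hi; apply: asum_Arr; rewrite !Arr_tree_eval /aeval_at /aeval_forest /= !atens1r.
apply: asum_compl; apply: (@asum_aeval _ _ _ _ i).
- move=> j p ji.
  have fh k : k != i -> f k = h k by case/fgh.
  have gh k : k != i -> g k = h k by case/fgh.
  by split; apply: input_eq ji.
- by move=> p _; apply: inputD.
- rewrite (permP (labels_tree t)) count_uniq_mem ?iota_uniq //.
  by rewrite mem_iota /= add0n ltn_ord.
Qed.

Definition tree_op l ks (t : tree l ks) : natop l ks :=
  NatOp (fun V => @tree_eval_additive V l ks t) (fun V W F fs => tree_eval_natural F t fs).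

Definition tree_natop l ks (x : {freeg (tree l ks)}) : natop l ks :=
  fglift (@tree_op l ks : _ -> zmodule (natop l ks)) x.

Fact tree_natop_additive l ks : zmod_morphism (@tree_natop l ks).
Proof. by move=> x y; rewrite /tree_natop raddfB. Qed.

HB.instance Definition _ l ks :=
  GRing.isZmodMorphism.Build {freeg (tree l ks)} (natop l ks) (@tree_natop l ks) (@tree_natop_additive l ks).

Lemma tree_natopU l ks (t : tree l ks) : tree_natop << t >> = tree_op t.
Proof. by rewrite /tree_natop fgliftU. Qed.

(** * Generic operations, and the values of trees at them *)

Section Generic.

Definition corolla_at (i p : nat) : rtree := White i (map Leg (iota 0 p)).

Lemma corolla_atP i p : is_forest p 1 [:: corolla_at i p].
Proof.
rewrite /is_forest /legsf /= cats0 -/(legsf (map Leg (iota 0 p))) legsf_Leg perm_refl.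
by rewrite all_map /= andbT; apply/allP.
Qed.

Definition corolla_forest i p : forest p 1 := Sub _ (corolla_atP i p).

(* [mpow Utree p] is equal to [p] but not convertible to it. *)
Definition gen_op (i p : nat) : opn Utree p :=
  hcast (esym (mpowU p)) erefl (fgen (corolla_forest i p) : @mor Utree p 1).

Lemma Arr_gen_op i p : Arr (gen_op i p) = @Arr Utree p 1 (fgen (corolla_forest i p)).
Proof. exact: Arr_hcast. Qed.

Lemma rep_gen_op i p : represents (Arr (gen_op i p)) p 1 1 [:: corolla_at i p].
Proof. by exists (corolla_forest i p); rewrite Arr_gen_op. Qed.

Lemma fopn_gen_op (W : symcat_pt) (phi : forall i p, opn W p) i p :
  fopn (Ufunctor phi) (gen_op i p) = phi i p.
Proof.
apply: Arr_inj; rewrite Arr_fopn Arr_gen_op.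
by rewrite -[amap _ _]/(Arr (@Fhom W phi p 1 (fgen (corolla_forest i p)))) Arr_Fhom aeval_at_corolla.
Qed.

Lemma finputs_gen_op (W : symcat_pt) (phi : forall i p, opn W p) ks :
  finputs (Ufunctor phi) (restrict ks gen_op) = restrict ks phi.
Proof. by apply: functional_extensionality_dep => i; apply: fopn_gen_op. Qed.

Lemma natop_generic l ks (a : natop l ks) (W : symcat_pt) (phi : forall i p, opn W p) :
  a W (restrict ks phi) = fopn (Ufunctor phi) (a Utree (restrict ks gen_op)).
Proof. by rewrite natop_natural finputs_gen_op. Qed.

Lemma natop_eqU l ks (a b : natop l ks) :
  a Utree (restrict ks gen_op) = b Utree (restrict ks gen_op) -> a = b.
Proof. by move=> ab; apply: natop_restrP => W phi; rewrite natop_generic ab -natop_generic. Qed.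

Lemma rep_eq A B m n c ts : represents A m n c ts -> represents B m n c ts -> A = B.
Proof. by move=> [f [<- ->]] [g [/val_inj -> ->]]. Qed.

Lemma weight1 w : weight (fun _ _ => 1%N) w = 1%N.
Proof. exact: big1. Qed.

Lemma rep_tree_eval l ks (t : tree l ks) (phi : forall i p, opn Utree p) tau :
  (forall i, (i < size ks)%N ->
    represents (Arr (phi i (nth 0%N ks i))) (nth 0%N ks i) 1 1 [:: tau i (nth 0%N ks i)]) ->
  represents (Arr (tree_eval t (restrict ks phi))) l 1 1 [:: wsubst tau (val t)].
Proof.
move=> H; rewrite Arr_tree_eval.
rewrite -[X in represents _ _ _ X _](weight1 (whites (val t))).
apply: (rep_tree (c := fun _ _ => 1%N)) => //; last exact: legs_tree.
by move=> i p; move=> /whites_tree[ik <-]; rewrite input_restrict //; apply: H.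
Qed.

Lemma wsubst_relabel (s : nat -> nat) t :
  wsubst (fun i p => corolla_at (s i) p) t = reduce_tree (relabel s t).
Proof.
elim/rtree_mem_ind: t => //= [i ts IH|ts IH]; last first.
  by rewrite -map_comp; congr mk_black; apply/eq_in_map.
congr White; rewrite -map_comp -[RHS](mkseq_nth Special) !size_map.
rewrite -map_comp; apply/eq_in_map => j; rewrite mem_iota /= add0n => jt.
by rewrite !(nth_map Special) //= IH // mem_nth.
Qed.

Lemma reduce_id t : reduced_tree t -> reduce_tree t = t.
Proof. by rewrite reduce_treeE; apply: tsubst_Leg. Qed.

Lemma tree_red l ks (t : tree l ks) : reduced_tree (val t).
Proof. by case: t => t /= /and3P[]. Qed.

Lemma relabel_id t : relabel id t = t.
Proof.
by elim/rtree_mem_ind: t => //= [i ts IH|ts IH]; congr (_ _); rewrite -[RHS]map_id; apply/eq_in_map.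
Qed.

Lemma rep_generic l ks (t : tree l ks) :
  represents (Arr (tree_eval t (restrict ks gen_op))) l 1 1 [:: val t].
Proof.
have := @rep_tree_eval l ks t gen_op corolla_at (fun i _ => rep_gen_op i _).
by rewrite (wsubst_relabel id) relabel_id reduce_id ?tree_red.
Qed.

(** Grafting is the substitution that puts [u] at the vertex [i] and a renumbered corolla at every
    other white vertex. *)
Lemma wsubst_graft i m u t :
  wsubst (fun j p => if j == i then relabel (addn i) u else corolla_at (shift i m j) p) t =
  graft i m t u.
Proof.
rewrite /graft; elim/rtree_mem_ind: t => //= [j ts IH|ts IH]; last first.
  by rewrite -map_comp; congr mk_black; apply/eq_in_map.
have IH' : map (wsubst (fun j p => if j == i then relabel (addn i) u else corolla_at (shift i m j) p)) ts =
  map reduce_tree (map (replace_white i m (relabel (addn i) u)) ts).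
  by rewrite -map_comp; apply/eq_in_map.
rewrite IH'; case: eqP => _; first by rewrite reduce_plug.
rewrite /=; congr White; rewrite map_sub_Leg -[RHS](mkseq_nth Special).
by rewrite !size_map.
Qed.
End Generic.

(** * The isomorphism *)

Section Coordinates.
Variable l : nat.

Definition Utree_op (z : @mor Utree l 1) : opn Utree l := hcast (esym (mpowU l)) erefl z.
Definition coords (x : opn Utree l) : {freeg (forest l 1)} :=
  fm_to (hcast (mpowU l) erefl x : @mor Utree l 1).

Lemma Arr_Utree_op z : Arr (Utree_op z) = @Arr Utree l 1 z.
Proof. exact: Arr_hcast. Qed.

Lemma coordsE x (z : @mor Utree l 1) : Arr x = Arr z -> coords x = fm_to z.
Proof. by move=> xz; congr fm_to; apply: (@Arr_inj Utree); rewrite Arr_hcast. Qed.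

Lemma opU_coords x : Utree_op (fm_of (coords x)) = x.
Proof. by apply: (@Arr_inj Utree); rewrite Arr_Utree_op /coords fm_toK Arr_hcast. Qed.

Lemma coords_inj : injective coords.
Proof. by move=> x y xy; rewrite -(opU_coords x) xy opU_coords. Qed.

Fact coords_additive : zmod_morphism coords.
Proof. by move=> x y; rewrite /coords hcastB; apply: fm_to_additive. Qed.
HB.instance Definition _ :=
  GRing.isZmodMorphism.Build (opn Utree l) {freeg (forest l 1)} coords coords_additive.

Fact opU_additive : zmod_morphism Utree_op.
Proof. by move=> x y; rewrite /Utree_op hcastB. Qed.
HB.instance Definition _ := GRing.isZmodMorphism.Build (@mor Utree l 1) (opn Utree l) Utree_op opU_additive.

(** The default is never returned, as a forest with codomain 1 has exactly one tree. *)
Definition ftree (f : forest l 1) : rtree := head Special (val f).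

Lemma ftreeE f : val f = [:: ftree f].
Proof. by have := size_for f; rewrite /ftree; case: (val f) => [|t []]. Qed.

Lemma ftree_red f : reduced_tree (ftree f).
Proof. by have := red_for f; rewrite ftreeE /= andbT. Qed.

Lemma ftree_legs f : perm_eq (legs (ftree f)) (iota 0 l).
Proof. by have := legs_for f; rewrite ftreeE /legsf /= cats0. Qed.

Lemma coords_rep x c ts : represents (Arr x) l 1 c ts ->
  exists2 f : forest l 1, val f = ts & coords x = << f >> *+ c.
Proof.
move=> [f [ft ex]]; exists f => //; rewrite (coordsE ex).
by rewrite [LHS](raddfMn (@fm_to l 1)) /= fm_ofK.
Qed.
End Coordinates.

(** * Rescaled generic operations and the support of a natural operation *)

Section Scaling.
Variable c : nat -> nat -> nat.

Definition scaled_op (i p : nat) : opn Utree p := gen_op i p *+ c i p.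

Lemma hcastMn (G : zgraph) (a a' b b' : G) (ea : a = a') (eb : b = b') (f : mor a b) n :
  hcast ea eb (f *+ n) = hcast ea eb f *+ n.
Proof. by case: a' / ea; case: b' / eb. Qed.

Lemma rep_scaled_op i p : represents (Arr (scaled_op i p)) p 1 (c i p) [:: corolla_at i p].
Proof. by exists (corolla_forest i p); split=> //; rewrite /scaled_op -hcastMn Arr_hcast. Qed.

(** The endofunctor of U given by [scaled_op] is diagonal on trees: the eigenvalue of a tree is the
    product of the scalars at its white vertices. *)
Lemma coords_scaled_op l (x : opn Utree l) :
  coords (fopn (Ufunctor scaled_op) x) =
  fglift (fun f => << f >> *+ weight c (whites (ftree f))) (coords x).
Proof.
rewrite -(opU_coords x); elim/freeg_ind: (coords x) => [|f|y z Hy Hz].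
- by rewrite !raddf0 fopn0 !raddf0.
- rewrite (coordsE (Arr_Utree_op _)) fm_ofK fgliftU.
  have : represents (Arr (fopn (Ufunctor scaled_op) (Utree_op (fgen f : @mor Utree l 1)))) l 1
             (weight c (whites (ftree f))) [:: ftree f].
    rewrite Arr_fopn Arr_Utree_op.
    rewrite -[amap _ _]/(Arr (@Fhom Utree scaled_op l 1 (fgen f))) Arr_Fhom ftreeE.
    have := rep_tree (tau := corolla_at) (fun i p _ => rep_scaled_op i p) (ftree_legs f).
    by rewrite (wsubst_relabel id) relabel_id reduce_id ?ftree_red.
  move=> /coords_rep[g gf ->]; congr (<< _ >> *+ _).
  by apply/val_inj; rewrite gf ftreeE.
- by rewrite !raddfB /= fopnD fopnN !raddfB /= Hy Hz.
Qed.
End Scaling.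

Lemma coeff_scale (K : choiceType) (w : K -> nat) (y : {freeg K}) f :
  coeff f (fglift (fun g => << g >> *+ w g : {freeg K}) y) = coeff f y *+ w f.
Proof.
elim/freeg_ind: y => [|g|x y Hx Hy]; first by rewrite !raddf0 mul0rn.
  rewrite fgliftU raddfMn /= coeffU mul1r.
  by have [->|_] := eqVneq g f; rewrite ?mul0rn.
by rewrite !raddfB /= Hx Hy mulrnBl.
Qed.

Definition ival (x : nat * nat) (n : nat) (i p : nat) : nat := if (i, p) == x then n else 1.

Lemma weight_ival x n w : weight (ival x n) w = (n ^ count_mem x w)%N.
Proof.
rewrite /weight; elim: w => [|y w IH]; first by rewrite big_nil.
rewrite big_cons IH /= /ival -surjective_pairing expnD; congr muln.
by case: eqP => _; rewrite ?expn1.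
Qed.

Section Support.
Variables (l : nat) (ks : seq nat) (a : natop l ks).
Let y := coords (a Utree (restrict ks gen_op)).

Lemma coords_ival x n f : coeff f (coords (a Utree (restrict ks (scaled_op (ival x n))))) =
  coeff f y *+ (n ^ count_mem x (whites (ftree f)))%N.
Proof. by rewrite natop_generic coords_scaled_op coeff_scale weight_ival. Qed.

(* Doubling the i-th generic operation doubles the value of a, by additivity, and
   multiplies a tree by 2 to the number of its vertices labelled i. *)
Lemma support_in f i : coeff f y != 0 -> (i < size ks)%N ->
  count_mem (i, nth 0%N ks i) (whites (ftree f)) = 1%N.
Proof.
move=> fy ik; set x := (i, _); have := coords_ival x 2 f.
have -> : a Utree (restrict ks (scaled_op (ival x 2))) = a Utree (restrict ks gen_op) + a Utree (restrict ks gen_op).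
  apply: (@natop_additive _ _ a Utree (Ordinal ik)) => [j ji|].
    have ji' : (j : nat) == i = false by apply/negbTE; rewrite -val_eqE in ji.
    by rewrite /restrict /scaled_op /ival xpair_eqE ji'.
  by rewrite /restrict /scaled_op /ival eqxx.
(* Cancelling the nonzero coefficient leaves an equality of 2 with 2 to the multiplicity. *)
rewrite raddfD coeffD -mulr2n -[RHS]mulr_natr -[LHS]mulr_natr => /(mulfI fy)/eqP.
rewrite eqr_nat => /eqP; case: (count_mem x (whites (ftree f))) => [|[|k]] //.
by rewrite !expnS; lia.
Qed.

(* Replacing by 0 a generic operation that is not an input of a has no effect on a. *)
Lemma support_out f x : coeff f y != 0 -> x \notin zip (iota 0 (size ks)) ks ->
  count_mem x (whites (ftree f)) = 0%N.
Proof.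
move=> fy xk; have := coords_ival x 0 f.
have -> : restrict ks (scaled_op (ival x 0)) = restrict ks gen_op.
  apply: restrict_ext => i ik; rewrite /scaled_op /ival ifN //.
  apply: contraNneq xk => <-; rewrite zip_iotaE; apply/mapP; exists i => //.
  by rewrite mem_iota.
(* A positive multiplicity would make the coefficient zero; for multiplicity 0 the factor is 0 to
   the power 0, that is 1. *)
rewrite -/y; case: (count_mem x (whites (ftree f))) => // k; rewrite exp0n // mulr0n => fy0.
by rewrite fy0 eqxx in fy.
Qed.

Lemma support_tree f : coeff f y != 0 -> is_tree l ks (ftree f).
Proof.
move=> fy; rewrite /is_tree ftree_legs ftree_red andbT /=.
have uz : uniq (zip (iota 0 (size ks)) ks).
  by rewrite zip_iotaE map_inj_uniq ?iota_uniq // => i j [].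
(* [perm_eq] compares multiplicities, and in the profile each pair has multiplicity 1 or 0 because
   the labels are distinct. *)
apply/allP => x _ /=; rewrite (count_uniq_mem _ uz).
have [xk|xk] := boolP (x \in zip _ _); last by rewrite support_out.
move: xk; rewrite zip_iotaE => /mapP[i]; rewrite mem_iota /= add0n => ik ->.
by rewrite support_in.
Qed.
End Support.

Section Inverse.
Variables (l : nat) (ks : seq nat).

Lemma tree_forestP (t : tree l ks) : is_forest l 1 [:: val t].
Proof. by rewrite /is_forest /legsf /= cats0 legs_tree tree_red. Qed.

Definition tree_forest (t : tree l ks) : forest l 1 := Sub _ (tree_forestP t).

Definition forest_tree (f : forest l 1) : {freeg (tree l ks)} :=
  if insub (ftree f) is Some t then << t >> else 0.

Lemma forest_treeK t : forest_tree (tree_forest t) = << t >>.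
Proof. by rewrite /forest_tree /ftree /= valK. Qed.

Lemma coords_tree_natop (z : {freeg (tree l ks)}) :
  coords (tree_natop z Utree (restrict ks gen_op)) = fglift (fun t => << tree_forest t >>) z.
Proof.
elim/freeg_ind: z => [|t|x y Hx Hy].
- by rewrite !raddf0.
- rewrite tree_natopU fgliftU; have [f ft ->] := coords_rep (rep_generic t).
  by congr << _ >>; apply: val_inj.
- by rewrite !raddfB /= Hx Hy.
Qed.

Definition natop_tree (a : natop l ks) : {freeg (tree l ks)} :=
  fglift forest_tree (coords (a Utree (restrict ks gen_op))).

Lemma tree_natopK : cancel (@tree_natop l ks) natop_tree.
Proof.
move=> z; rewrite /natop_tree coords_tree_natop; elim/freeg_ind: z => [|t|x y Hx Hy].
- by rewrite !raddf0.
- by rewrite !fgliftU forest_treeK.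
- by rewrite !raddfB /= Hx Hy.
Qed.

Lemma natop_treeK : cancel natop_tree (@tree_natop l ks).
Proof.
move=> a; apply/natop_eqU/coords_inj; rewrite coords_tree_natop /natop_tree.
(* From here on [a] enters only through its coordinates [y], supported on trees of profile [ks]; the
   expansion of [y] over its support is compared term by term. *)
have := @support_tree l ks a; move: (coords _) => y supp.
rewrite -{1 2}[y]freeg_sumE !raddf_sum /= big_seq [RHS]big_seq; apply: eq_bigr => f.
rewrite mem_dom => /supp ft; rewrite -[coeff f y]intz -freegU_mulz !raddfMz /=.
rewrite !fgliftU /forest_tree insubT fgliftU; congr (<< _ >> *~ _).
by apply: val_inj; rewrite [RHS]ftreeE.
Qed.
End Inverse.

(** * Compatibility with identities, composition and relabelling *)

Section Morphism.

Lemma tree_natop_id c : tree_natop (opd_id c : tree_operad c [:: c]) = natop_id c.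
Proof.
rewrite [opd_id _]/= tree_natopU; apply: natopP => V fs; apply: Arr_inj.
rewrite [tree_op _ _ _]/= Arr_tree_eval aeval_at_corolla.
by rewrite -[RHS](congr1 (@Arr _ _ _) (input_ord fs ord0)).
Qed.

Lemma tree_natop_comp_gen l ks1 c ks2 js (t : tree l (ks1 ++ c :: ks2)) (u : tree c js) :
  tree_natop << tree_comp t u >> = natop_comp (tree_natop << t >>) (tree_natop << u >>).
Proof.
rewrite !tree_natopU; apply: natop_eqU; apply: (@Arr_inj Utree); rewrite natop_compE.
(* It remains to see that the inputs of the outer operation represent [u], relabelled, at position
   [size ks1] and shifted corollas elsewhere. *)
apply: rep_eq (rep_generic _) _; rewrite [val _]/= -wsubst_graft.
apply: rep_tree_eval => j jk; rewrite /outer_family; case: eqP => [->|/eqP jN]; last exact: rep_gen_op.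
have nk : nth 0%N (ks1 ++ c :: ks2) (size ks1) = c by rewrite nth_cat ltnn subnn.
rewrite nk recast_id.
have := @rep_tree_eval _ _ u (fun q => gen_op (size ks1 + q)) (fun q => corolla_at (size ks1 + q)).
rewrite (wsubst_relabel (addn (size ks1))) reduce_id ?reduced_relabel ?tree_red //.
by apply=> i _; apply: rep_gen_op.
Qed.

Lemma natop_compBl l ks1 c ks2 js (a a' : natop l (ks1 ++ c :: ks2)) (b : natop c js) :
  natop_comp (a - a') b = natop_comp a b - natop_comp a' b :> natop l (ks1 ++ js ++ ks2).
Proof. exact: natopP. Qed.

Lemma natop_compBr l ks1 c ks2 js (a : natop l (ks1 ++ c :: ks2)) (b b' : natop c js) :
  natop_comp a (b - b') = natop_comp a b - natop_comp a b' :> natop l (ks1 ++ js ++ ks2).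
Proof. by apply: (addIr (natop_comp a b')); rewrite -natop_compDr !subrK. Qed.

Lemma natop_comp0r l ks1 c ks2 js (a : natop l (ks1 ++ c :: ks2)) :
  natop_comp a (0 : natop c js) = 0 :> natop l (ks1 ++ js ++ ks2).
Proof. by rewrite -(subrr (0 : natop c js)) natop_compBr subrr. Qed.

Lemma tree_natop_comp l ks1 c ks2 js (x : tree_operad l (ks1 ++ c :: ks2)) (y : tree_operad c js) :
  tree_natop (opd_comp ks1 ks2 x y) = natop_comp (tree_natop x) (tree_natop y).
Proof.
rewrite -[opd_comp _ _ _ _]/(freeg_bilin (@tree_comp l ks1 c ks2 js) x y).
elim/freeg_ind: x => [|t|x x' Hx Hx'].
- by rewrite fg20l !raddf0; apply: natopP.
- elim/freeg_ind: y => [|u|y y' Hy Hy'].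
  + by rewrite fg20r !raddf0 natop_comp0r.
  + by rewrite fg2U tree_natop_comp_gen.
  + by rewrite fg2Br !raddfB /= natop_compBr Hy Hy'.
- by rewrite fg2Bl !raddfB /= natop_compBl Hx Hx'.
Qed.

Lemma tree_natop_act l ks ks' (s : relabelling ks ks') (x : tree_operad l ks) :
  tree_natop (opd_act s x) = natop_act s (tree_natop x).
Proof.
rewrite /=; elim/freeg_ind: x => [|t|x y Hx Hy].
- by rewrite !raddf0; apply: natopP.
- rewrite fgliftU !tree_natopU; apply: natop_eqU; apply: (@Arr_inj Utree); rewrite natop_actE.
  apply: rep_eq (rep_generic _) _.
  have := @rep_tree_eval _ _ t (fun i => gen_op (s i)) (fun i => corolla_at (s i)).
  rewrite (wsubst_relabel s) reduce_id ?reduced_relabel ?tree_red //.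
  by apply=> i _; apply: rep_gen_op.
- rewrite !raddfB /= Hx Hy; exact: natopP.
Qed.

Lemma tree_natop_pcast l ks ks' (e : ks = ks') (x : tree_operad l ks) :
  tree_natop (pcast e x) = pcast e (tree_natop x : natop_operad l ks).
Proof. by case: ks' / e. Qed.
End Morphism.

Lemma tree_is_operad : is_operad tree_operad.
Proof.
have [D1 D2 D3 D4 D5 D6 D7 D8 D9 D10] := natop_is_operad.
have inj l ks : injective (@tree_natop l ks) := can_inj (@tree_natopK l ks).
split.
- by move=> *; apply: inj; rewrite raddfD /= !tree_natop_comp raddfD; apply: D1.
- by move=> *; apply: inj; rewrite raddfD /= !tree_natop_comp raddfD; apply: D2.
- by move=> *; apply: inj; rewrite raddfD /= !tree_natop_act raddfD; apply: D3.
- by move=> *; apply: inj; rewrite tree_natop_act; apply: D4.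
- by move=> *; apply: inj; rewrite !tree_natop_act; apply: D5.
- move=> c js y e; apply: inj; rewrite tree_natop_pcast; apply: etrans (D6 c js (tree_natop y) e).
  congr (pcast e _); apply: etrans (tree_natop_comp (ks1 := [::]) (ks2 := [::]) _ _) _.
  by rewrite tree_natop_id.
- by move=> *; apply: inj; rewrite tree_natop_comp tree_natop_id; apply: D7.
- by move=> *; apply: inj; rewrite tree_natop_pcast !tree_natop_comp tree_natop_pcast;
  rewrite tree_natop_comp; apply: D8.
- move=> *; apply: inj; rewrite tree_natop_comp !tree_natop_pcast !tree_natop_comp.
  rewrite !tree_natop_pcast tree_natop_comp tree_natop_pcast.
  exact: D9.
- by move=> *; apply: inj; rewrite tree_natop_comp !tree_natop_act tree_natop_comp; apply: D10; eauto.
Qed.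

Theorem theoremA :
  is_operad tree_operad /\
  is_operad natop_operad /\
  exists Phi : forall l ks, {additive tree_operad l ks -> natop_operad l ks},
    (forall (l : nat) (ks : seq nat) (t : tree l ks) (V : symcat_pt) (fs : inputs V ks),
       natop_fun (Phi l ks << t >>) fs = tree_eval t fs) /\
    is_operad_iso Phi.
Proof.
split; first exact: tree_is_operad.
split; first exact: natop_is_operad.
exists (fun l ks => @tree_natop l ks : {additive _ -> _}); split.
  by move=> l ks t V fs; rewrite /= tree_natopU.
split.
- exact: tree_natop_id.
- exact: tree_natop_comp.
- exact: tree_natop_act.
- by move=> l ks; exists (@natop_tree l ks); [apply: tree_natopK | apply: natop_treeK].
Qed.
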